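(* Assume that for each $k$ the $k$th moment with respect to $G_\theta$ of each entry of $\mathbf X$ and of $Y$ is bounded uniformly in $\theta\in\Theta$, and that for every subset of covariates $\mathcal P$ the entries of $(\mathbb X_n^{(\mathcal P)\prime}\mathbb X_n^{(\mathcal P)}/n)^{-1}$ have third moments with respect to $G_\theta$ that are bounded uniformly in $n$ (for all $n$ from some $n_0$ on) and $\theta$. Assume in addition that $n/N_j,\ \lambda_{\max}(\mathbb W_\theta^{(\mathcal P)}),\ 1/\lambda_{\min}(\mathbb W_\theta^{(\mathcal P)}),\ \lambda_{\max}(\mathbb Q_\theta^{(\mathcal P)})\le C$ for all $j$, $\theta$ and $\mathcal P$. 1. When $n$ is fixed, $$\liminf_{\mathbf N\to\infty}P\Big(\widehat{\boldsymbol\pi^*}(n,\mathbf N)\subseteq\boldsymbol\pi^*_{pop}(n)\Big)\ge1-\frac{K_C}J.$$ 2. Letting $n,\mathbf N\to\infty$, $$\liminf_{n/N_j\le C,\ n\to\infty,\ \mathbf N\to\infty}P\left(\widehat{\boldsymbol\pi^*}(n,\mathbf N)=\boldsymbol{\mathcal P}^*_{pop}(n)\right)\ge1-\frac{K_C}J.$$ Here $K_C$ depends only on $C$.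
   Context: $(\Theta,\mathscr T,\mu)$ is a probability space and $\{G_\theta:\theta\in\Theta\}$ a family of distributions of pairs $(\mathbf X,Y)$, $\mathbf X\in\mathbb R^d$ a column vector of covariates (one may be the constant 1), $Y\in\mathbb R$; functions of $\theta$ given by expectations under $G_\theta$ are assumed measurable with well-defined $\mu$-integrals. $\theta_1,\dots,\theta_J$ is an iid sample from $\mu$, $G_j:=G_{\theta_j}$, and given the $\theta_j$'s the datasets $\{(\mathbf X_{ij},Y_{ij})\}_{i=1}^{N_j}$ are independent across $j$ and iid from $G_j$. $\mathbf N=(N_1,\dots,N_J)$; $\mathbf N\to\infty$ means all $N_j\to\infty$. The probability $P$ is obtained by first conditioning on $\theta_1,\dots,\theta_J$ and then taking expectation over them with respect to the product measure $\mu^J$. A model $\mathcal P$ is a subset of the $d$ covariates, $\mathbf X^{(\mathcal P)}$ the corresponding subvector of $\mathbf X$. $\arg\min_{\mathcal P}$ is over all subsets of covariates and denotes the set of all minimizers. $\lambda_{\max},\lambda_{\min}$ are the largest and smallest eigenvalues. For each $\theta,\mathcal P$: $\mathbb Q_\theta^{(\mathcal P)}:=E_{G_\theta}(\mathbf X^{(\mathcal P)}\mathbf X^{(\mathcal P)\prime})$, assumed invertible; $\boldsymbol\beta_\theta^{(\mathcal P)}:=(\mathbb Q_\theta^{(\mathcal P)})^{-1}E_{G_\theta}(\mathbf X^{(\mathcal P)}Y)$; $\mathbb W_\theta^{(\mathcal P)}:=E_{G_\theta}\big(\mathbf X^{(\mathcal P)}\mathbf X^{(\mathcal P)\prime}(Y-\mathbf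 X^{(\mathcal P)\prime}\boldsymbol\beta_\theta^{(\mathcal P)})^2\big)$, assumed positive definite; $\mathbb V_\theta^{(\mathcal P)}:=\mathbb W_\theta^{(\mathcal P)}(\mathbb Q_\theta^{(\mathcal P)})^{-1}$. For an iid sample of size $n$ from $G_\theta$, $\mathbb X_n^{(\mathcal P)}$ is the matrix whose rows are the transposed $\mathcal P$-subvectors of the covariate vectors, and $\widehat{\boldsymbol\beta}_{\theta,n}^{(\mathcal P)}$ is the least squares estimator (response vector regressed on $\mathbb X_n^{(\mathcal P)}$; inverse assumed to exist with probability 1, sample sizes exceeding the number of covariates). $\mathbf R_{pop}(n,\mathcal P):=\int E_{G_\theta}(Y-\mathbf X^{(\mathcal P)\prime}\widehat{\boldsymbol\beta}_{\theta,n}^{(\mathcal P)})^2\mu(d\theta)$, where $(\mathbf X,Y)\sim G_\theta$ is independent of $\widehat{\boldsymbol\beta}_{\theta,n}^{(\mathcal P)}$ and $E_{G_\theta}$ is over both; $\mathbf{AR}_{pop}(n,\mathcal P):=\int\big\{E_{G_\theta}(Y-\mathbf X^{(\mathcal P)\prime}\boldsymbol\beta_\theta^{(\mathcal P)})^2+\frac1n\mathrm{tr}(\mathbb V_\theta^{(\mathcal P)})\big\}\mu(d\theta)$. $\boldsymbol{\mathcal P}^*_{pop}(n):=\arg\min_{\mathcal P}\mathbf R_{pop}(n,\mathcal P)$ and $\boldsymbol\pi^*_{pop}(n):=\arg\min_{\mathcal P}\mathbf{AR}_{pop}(n,\mathcal P)$. For the $j$th dataset, $\mathbb X_{j,N_j}^{(\mathcal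 P)}$ has rows $\mathbf X_{ij}^{(\mathcal P)\prime}$, $\mathbf Y_{j,N_j}$ is the vector of responses, $\widehat{\boldsymbol\beta}_{j,N_j}^{(\mathcal P)}$ the least squares estimator, $\widehat{\mathbb Q}_{j,N_j}^{(\mathcal P)}:=\frac1{N_j}\mathbb X_{j,N_j}^{(\mathcal P)\prime}\mathbb X_{j,N_j}^{(\mathcal P)}$, $\widehat{\mathbb W}_{j,N_j}^{(\mathcal P)}:=\frac1{N_j}\sum_{i=1}^{N_j}\mathbf X_{ij}^{(\mathcal P)}\mathbf X_{ij}^{(\mathcal P)\prime}(Y_{ij}-\mathbf X_{ij}^{(\mathcal P)\prime}\widehat{\boldsymbol\beta}_{j,N_j}^{(\mathcal P)})^2$, $\widehat{\mathbb V}_{j,N_j}^{(\mathcal P)}:=\widehat{\mathbb W}_{j,N_j}^{(\mathcal P)}(\widehat{\mathbb Q}_{j,N_j}^{(\mathcal P)})^{-1}$, and $$\mathbf C^{(\mathcal P)}(n,\mathbf N):=\frac1J\sum_{j=1}^J\Big\{\frac1{N_j}\|\mathbf Y_{j,N_j}-\mathbb X_{j,N_j}^{(\mathcal P)}\widehat{\boldsymbol\beta}_{j,N_j}^{(\mathcal P)}\|^2+\mathrm{tr}(\widehat{\mathbb V}_{j,N_j}^{(\mathcal P)})\Big(\frac1n+\frac1{N_j}\Big)\Big\},\quad\widehat{\boldsymbol\pi^*}(n,\mathbf N):=\arg\min_{\mathcal P}\mathbf C^{(\mathcal P)}(n,\mathbf N).$$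
   Formalization: The constant K_C may depend on the fixed setting (d, Theta, mu and the family G_theta) as well as on C, but not on J, n or N; a constant depending on C alone, uniform over all mu, is impossible (take mu putting mass eps → 0 on the only environment where a covariate matters). *)

(* Defs.v *)
From HB Require Import structures.
From mathcomp Require Import all_boot all_order all_algebra.
From mathcomp Require Import all_classical all_reals all_analysis.
From mathcomp Require Import measurable_realfun.
Set Implicit Arguments.
Unset Strict Implicit.
Unset Printing Implicit Defensive.
Import Order.TTheory GRing.Theory Num.Theory.
Import numFieldNormedType.Exports.
Local Open Scope classical_set_scope.
Local Open Scope ring_scope.

Section product_probability.
Context {d : measure_display} {T : measurableType d} {R : realType}.

Definition tuple_cons n (p : T * n.-tuple T) : n.+1.-tuple T :=
  [the n.+1.-tuple T of p.1 :: p.2].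

Lemma measurable_tuple_cons n : measurable_fun setT (@tuple_cons n).
Proof. by apply: measurable_cons. Qed.

HB.instance Definition _ n :=
  isMeasurableFun.Build _ _ _ _ (@tuple_cons n) (@measurable_tuple_cons n).

Fixpoint prod_prob n : ('I_n -> probability T R) -> probability (n.-tuple T) R :=
  match n with
  | 0%N => fun=> \d_[tuple]
  | m.+1 => fun Q => distribution
      (Q ord0 \x prod_prob (fun i : 'I_m => Q (lift ord0 i)))%E (@tuple_cons m)
  end.

Lemma prod_prob_box n (Q : 'I_n -> probability T R) (A : 'I_n -> set T) :
  (forall i, measurable (A i)) ->
  prod_prob Q [set x | forall i, A i (tnth x i)] = (\prod_(i < n) Q i (A i))%E.
Proof.
elim: n Q A => [|n IH] Q A mA /=.
  rewrite big_ord0 diracE mem_set//= => -[].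
  by case.
rewrite big_ord_recl /= -(IH _ (fun i => A (lift ord0 i)))//.
rewrite -product_measure1E//; last first.
  rewrite [X in measurable X](_ : _ = \bigcap_(i : 'I_n)
      ((@tnth _ T ^~ i) @^-1` A (lift ord0 i))); last first.
    by apply/seteqP; split=> [x /= Ax i _|x /= Ax i]; exact: Ax.
  apply: fin_bigcap_measurable => // i _.
  by rewrite -[X in measurable X]setTI; exact: measurable_tnth.
congr (_ \x _)%E.
apply/seteqP; split => [[a x] /= H|[a x] /= [Aa Ax] i].
  split; first exact: (H ord0).
  by move=> i; have := H (lift ord0 i); rewrite tnthS.
by case: (unliftP ord0 i) => [j ->|->] //; rewrite tnthS.
Qed.

Definition iid n (Q : probability T R) : probability (n.-tuple T) R :=
  prod_prob (fun=> Q).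

End product_probability.

Section matrices.
Context {R : realType}.

(* The eigenvalues of a 0 x 0 matrix form the empty set, whose [sup] and [inf]
   are 0: for the model without covariates, bounds by C only say 0 <= C. *)
Definition lambda_max n (A : 'M[R]_n) : R := sup [set a | eigenvalue A a].
Definition lambda_min n (A : 'M[R]_n) : R := inf [set a | eigenvalue A a].

Definition posdefmx n (A : 'M[R]_n) : Prop :=
  A^T = A /\ forall v : 'cV[R]_n, v != 0 -> 0 < (v^T *m A *m v) ord0 ord0.

Definition sqnorm n (v : 'cV[R]_n) : R := \sum_i v i ord0 ^+ 2.

Definition expect_mx {d} {T : measurableType d} (Q : probability T R)
    m n (F : T -> 'M[R]_(m, n)) : 'M[R]_(m, n) :=
  \matrix_(i, j) \int[Q]_z F z i j.

End matrices.

(* An observation is a pair (X, Y); X is a tuple because tuples, unlike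
   matrices, carry the product sigma-algebra. *)
Notation obs R d := ((d.-tuple R) * R)%type.

Section least_squares.
Context {R : realType} {d : nat}.
Implicit Types (P : {set 'I_d}) (z : obs R d) (s : seq (obs R d)).

Definition subcov P z : 'cV[R]_#|P| := \col_k tnth z.1 (enum_val k).

Definition resid P (b : 'cV[R]_#|P|) z : R :=
  z.2 - ((subcov P z)^T *m b) ord0 ord0.

Definition design P s : 'M[R]_(size s, #|P|) :=
  \matrix_(i, k) subcov P (tnth (in_tuple s) i) k ord0.

Definition response s : 'cV[R]_(size s) := \col_i (tnth (in_tuple s) i).2.

Definition gram P s : 'M[R]_#|P| := (design P s)^T *m design P s.

Definition ols P s : 'cV[R]_#|P| :=
  invmx (gram P s) *m (design P s)^T *m response s.

Definition Qhat P s : 'M[R]_#|P| := (size s)%:R^-1 *: gram P s.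

Definition What P s : 'M[R]_#|P| :=
  (size s)%:R^-1 *: \sum_(z <- s)
    (resid (ols P s) z ^+ 2 *: (subcov P z *m (subcov P z)^T)).

Definition Vhat P s : 'M[R]_#|P| := What P s *m invmx (Qhat P s).

End least_squares.

Section population.
Context {R : realType} {d : nat}.
Implicit Types (D : probability (obs R d) R) (P : {set 'I_d}).

Definition Qmx D P : 'M[R]_#|P| :=
  expect_mx D (fun z => subcov P z *m (subcov P z)^T).

Definition beta D P : 'cV[R]_#|P| :=
  invmx (Qmx D P) *m expect_mx D (fun z => z.2 *: subcov P z).

Definition Wmx D P : 'M[R]_#|P| :=
  expect_mx D (fun z =>
    resid (beta D P) z ^+ 2 *: (subcov P z *m (subcov P z)^T)).

Definition Vmx D P : 'M[R]_#|P| := Wmx D P *m invmx (Qmx D P).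

End population.

Section selection.
Context {R : realType} {d : nat}.

Definition argmin_model {disp} {V : porderType disp} (f : {set 'I_d} -> V) :
    {set {set 'I_d}} :=
  [set P | [forall P', (f P <= f P')%O]]%SET.

Section pop.
Context {dT : measure_display} {Theta : measurableType dT}.
Variables (mu : probability Theta R) (G : Theta -> probability (obs R d) R).
Local Open Scope ereal_scope.

Definition R_pop (n : nat) (P : {set 'I_d}) : \bar R :=
  \int[mu]_t \int[iid n (G t) \x G t]_w ((resid (ols P w.1) w.2 ^+ 2)%R)%:E.

Definition AR_pop (n : nat) (P : {set 'I_d}) : \bar R :=
  \int[mu]_t (\int[G t]_z ((resid (beta (G t) P) z ^+ 2)%R)%:E
              + (n%:R^-1 * \tr (Vmx (G t) P))%:E).

Definition Pstar_pop (n : nat) : {set {set 'I_d}} := argmin_model (R_pop n).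
Definition pistar_pop (n : nat) : {set {set 'I_d}} := argmin_model (AR_pop n).

(* The probability of the event E about J datasets of sizes N_1, ..., N_J:
   conditionally on the theta_j's the datasets are independent, and the j-th
   one is iid from G_(theta_j). Each is drawn with the common size max_j N_j,
   so that all live in the same type, and only its first N_j observations,
   again an iid sample from G_(theta_j), are kept. *)
Definition data_prob J (N : 'rV[nat]_J) (E : set ('I_J -> seq (obs R d))) :
    \bar R :=
  \int[iid J mu]_t
    prod_prob (fun j => iid (\max_(k < J) N ord0 k)%N (G (tnth t j)))
      [set x : J.-tuple (_.-tuple (obs R d)) | E (fun j => take (N ord0 j) (tnth x j : seq (obs R d)))].

End pop.

Definition criterion J (n : nat) (D : 'I_J -> seq (obs R d)) (P : {set 'I_d}) :
    R :=
  J%:R^-1 * \sum_(j < J)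
    ((size (D j))%:R^-1
       * sqnorm (response (D j) - design P (D j) *m ols P (D j))
     + \tr (Vhat P (D j)) * (n%:R^-1 + (size (D j))%:R^-1)).

Definition pihat J (n : nat) (D : 'I_J -> seq (obs R d)) : {set {set 'I_d}} :=
  argmin_model (criterion n D).

End selection.

Definition sizes_oo J : set_system 'rV[nat]_J :=
  filter_from setT (fun M : nat => [set N : 'rV[nat]_J | forall j, (M <= N ord0 j)%N]).

Definition n_sizes_oo {R : realType} J (C : R) :
    set_system (nat * 'rV[nat]_J)%type :=
  within [set x : nat * 'rV[nat]_J | forall j, x.1%:R / (x.2 ord0 j)%:R <= C]
    (filter_prod \oo (@sizes_oo J)).

Arguments sizes_oo : clear implicits.
Arguments n_sizes_oo {R} J C.

(* Main.v *)
(* Least squares on a sample and on a population are the same construction,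
   applied to the average over the sample or to the expectation [L]. The risk
   and the penalty of a model depend on finitely many moments of order at most
   4, which are estimated at rate [N_j^(-1/2)] uniformly in theta.

   Population side: [R_pop] equals the mean risk plus [1/n] times the mean
   penalty up to [o(1/n)], uniformly in theta; the third moments of the inverse
   Gram matrices control the remainder. For large [n] both [R_pop] and [AR_pop]
   are therefore minimized by the smallest model of minimal mean risk only,
   larger risk optimal models having strictly larger penalties because [W] is
   positive definite.

   Part 1: as [N -> oo] the criterion converges to the average of risk +
   penalty / [n] over theta_1, ..., theta_J, which by Chebyshev's inequality
   separates the minimizers of [AR_pop] from the other models outside an event of
   probability [O(1/J)]. For large [n] the risks and the penalties can be
   compared separately, so the constant is uniform in [n].

   Part 2: a model that is not risk optimal loses by a margin that does not
   shrink with [n]. For a risk optimal model, [n] times the excess of the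
   criterion is the average over [j] of the penalty difference [D_j] plus
   [n / N_j] times the difference of [D_j] and a quadratic form in the
   normalized score. This form has mean [D_j], so the second part averages out
   by Chebyshev's inequality over [j], with failure probability [O(1/J)] as
   [n / N_j <= C]. *)

Require Import Defs.
From HB Require Import structures.
From mathcomp Require Import all_boot all_order all_algebra.
From mathcomp Require Import all_classical all_reals all_analysis.
From mathcomp Require Import measurable_realfun.
From mathcomp Require Import ring lra zify.
Import Order.TTheory GRing.Theory Num.Theory.
Import numFieldNormedType.Exports.
Local Open Scope classical_set_scope.
Local Open Scope ring_scope.

Set Implicit Arguments.
Unset Strict Implicit.
Unset Printing Implicit Defensive.

(** * Expectations of functions with all moments *)

Lemma le_nnintegral d (T : measurableType d) (R : realType)
    (mu : {measure set T -> \bar R}) (f g : T -> \bar R) :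
  (forall x, 0 <= f x)%E -> (forall x, f x <= g x)%E ->
  (\int[mu]_x f x <= \int[mu]_x g x)%E.
Proof.
move=> f0 fg; have g0 x : (0 <= g x)%E by exact: le_trans (f0 x) (fg x).
rewrite !ge0_integralTE//; apply: ereal_sup_le => _ [h /= hf <-].
by exists h => //= x; exact: le_trans (hf x) (fg x).
Qed.

Section prod_prob_theory.
Context {R : realType}.

Lemma prod_prob_le d (T : measurableType d) n (Q : 'I_n -> probability T R)
    (A B : set (n.-tuple T)) :
  A `<=` B -> (prod_prob Q A <= prod_prob Q B)%E.
Proof.
elim: n Q A B => [|n IH] Q A B AB /=.
  rewrite /dirac /= lee_fin !indicE.
  case: (boolP ([tuple] \in A)) => [|_]; last by rewrite ler0n.
  by rewrite inE => /AB tB; rewrite mem_set.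
apply: le_nnintegral => [x|x] /=; first exact: measure_ge0.
by apply: IH => y; rewrite /xsection /= !inE; exact: AB.
Qed.

End prod_prob_theory.

Definition ubm {R : realType} (I : Type) (disp : I -> measure_display)
    (T : forall i, measurableType (disp i)) (D : forall i, probability (T i) R)
    (f : forall i, T i -> R) : Prop :=
  (forall i, measurable_fun setT (f i)) /\
  forall k : nat, exists B : R, forall i,
    (\int[D i]_x (`|f i x| ^+ k)%:E <= B%:E)%E.

Notation mom D f := (ubm (fun _ : unit => D) (fun _ : unit => f)).

Definition EX {R : realType} d (T : measurableType d) (D : probability T R)
  (f : T -> R) : R := \int[D]_x f x.

Section ubm_theory.
Context {R : realType} (I : Type) (disp : I -> measure_display)
    (T : forall i, measurableType (disp i)) (D : forall i, probability (T i) R).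
Implicit Types f g : forall i, T i -> R.

Lemma ubm_at f i : ubm D f -> mom (D i) (f i).
Proof. by move=> [mf bf]; split=> // k; have [B HB] := bf k; exists B. Qed.

Lemma eq_ubm f g : (forall i x, f i x = g i x) -> ubm D f -> ubm D g.
Proof.
by move=> fg; suff -> : f = g by []; apply: functional_extensionality_dep => i; apply/funext => x.
Qed.

Lemma measurable_normX (i : I) (f : T i -> R) k : measurable_fun setT f ->
  measurable_fun setT (fun x => (`|f x| ^+ k)%:E).
Proof.
move=> mf; apply/measurable_EFinP; apply: measurable_funX.
by apply: measurableT_comp => //; exact: normr_measurable.
Qed.

Lemma ubm_dom f g1 g2 (c : nat -> R) (e : nat -> nat):
  (forall i, measurable_fun setT (f i)) -> ubm D g1 -> ubm D g2 ->
  (forall k i x, `|f i x| ^+ k <= c k * (`|g1 i x| ^+ e k + `|g2 i x| ^+ e k)) ->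
  ubm D f.
Proof.
move=> mf [mg1 bg1] [mg2 bg2] fg; split=> // k.
have [B1 HB1] := bg1 (e k); have [B2 HB2] := bg2 (e k).
exists (Num.max 0 (c k) * (B1 + B2)) => i.
have c0 : 0 <= Num.max 0 (c k) by rewrite le_max lexx.
apply: (@le_trans _ _ (\int[D i]_x ((Num.max 0 (c k))%:E * ((`|g1 i x| ^+ e k)%:E + (`|g2 i x| ^+ e k)%:E)))%E).
  apply: le_nnintegral => x; first by rewrite lee_fin exprn_ge0.
  rewrite -EFinD -EFinM lee_fin (le_trans (fg k i x))//.
  by apply: ler_wpM2r; rewrite ?addr_ge0 ?exprn_ge0// le_max lexx orbT.
rewrite ge0_integralZl//; last 2 first.
- by apply: emeasurable_funD; exact: measurable_normX.
- by move=> x _; rewrite -EFinD lee_fin addr_ge0// exprn_ge0.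
rewrite EFinM lee_wpmul2l ?lee_fin//.
rewrite ge0_integralD//.
- by rewrite EFinD leeD.
- exact: measurable_normX.
- exact: measurable_normX.
Qed.

Lemma ubm_cst (c : I -> R) (B : R) : (forall i, `|c i| <= B) ->
  ubm D (fun i _ => c i).
Proof.
move=> cB; split=> [i|k]; first exact: measurable_cst.
exists (B ^+ k) => i; rewrite integral_cst//= probability_setT mule1 lee_fin.
by rewrite lerXn2r// nnegrE// (le_trans _ (cB i)).
Qed.

Lemma ubmN f : ubm D f -> ubm D (fun i x => - f i x).
Proof.
move=> [mf bf]; split=> [i|k]; first by apply: measurable_funN; exact: mf.
by have [B HB] := bf k; exists B => i; under eq_integral do rewrite normrN.
Qed.

Lemma ubmM f g : ubm D f -> ubm D g -> ubm D (fun i x => f i x * g i x).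
Proof.
move=> uf ug; have [[mf _] [mg _]] := (uf, ug).
apply: (@ubm_dom _ f g (fun _ => 1) (fun k => k * 2)%N) => //.
  by move=> i; apply: measurable_funM; [exact: mf|exact: mg].
move=> k i x; rewrite mul1r normrM exprMn !exprM.
have := sqr_ge0 (`|f i x| ^+ k - `|g i x| ^+ k).
have : 0 <= `|f i x| ^+ k by rewrite exprn_ge0.
have : 0 <= `|g i x| ^+ k by rewrite exprn_ge0.
by nra.
Qed.

Lemma ubmD f g : ubm D f -> ubm D g -> ubm D (fun i x => f i x + g i x).
Proof.
move=> uf ug; have [[mf _] [mg _]] := (uf, ug).
apply: (@ubm_dom _ f g (fun k => 2 ^+ k) id) => //.
  by move=> i; apply: measurable_funD; [exact: mf|exact: mg].
move=> k i x.
have [fg|fg] := leP `|f i x| `|g i x|.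
  apply: (@le_trans _ _ ((2 * `|g i x|) ^+ k)).
    by rewrite lerXn2r ?nnegrE ?mulr_ge0// (le_trans (ler_normD _ _))// mulr2n mulrDl !mul1r lerD2r.
  by rewrite exprMn ler_wpM2l ?exprn_ge0// lerDr exprn_ge0.
apply: (@le_trans _ _ ((2 * `|f i x|) ^+ k)).
  by rewrite lerXn2r ?nnegrE ?mulr_ge0// (le_trans (ler_normD _ _))// mulr2n mulrDl !mul1r lerD2l ltW.
by rewrite exprMn ler_wpM2l ?exprn_ge0// lerDl exprn_ge0.
Qed.

Lemma ubmB f g : ubm D f -> ubm D g -> ubm D (fun i x => f i x - g i x).
Proof. by move=> uf ug; apply: ubmD => //; exact: ubmN. Qed.

Lemma ubm_constant (c : R) : ubm D (fun i _ => c).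
Proof. exact: (@ubm_cst (fun=> c) `|c|). Qed.

Lemma ubmX f k : ubm D f -> ubm D (fun i x => f i x ^+ k).
Proof.
move=> uf; elim: k => [|k IH].
  by apply: eq_ubm (ubm_constant 1) => i x; rewrite expr0.
by apply: eq_ubm (ubmM uf IH) => i x; rewrite exprS.
Qed.

Lemma ubm_sum (J : Type) (r : seq J) (P : pred J) (f : J -> forall i, T i -> R) :
  (forall j, ubm D (f j)) -> ubm D (fun i x => \sum_(j <- r | P j) f j i x).
Proof.
move=> uf; elim: r => [|j r IH].
  by apply: eq_ubm (ubm_constant 0) => i x; rewrite big_nil.
case Pj : (P j); last by apply: eq_ubm IH => i x; rewrite big_cons Pj.
by apply: eq_ubm (ubmD (uf j) IH) => i x; rewrite big_cons Pj.
Qed.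

Lemma ubm_norm f : ubm D f -> ubm D (fun i x => `|f i x|).
Proof.
move=> [mf bf]; split=> [i|k].
  by apply: measurableT_comp; [exact: normr_measurable|exact: mf].
by have [B HB] := bf k; exists B => i; under eq_integral do rewrite normr_id.
Qed.

End ubm_theory.

Lemma ubm_reindex {R : realType} (I : Type) (disp : I -> measure_display)
    (T : forall i, measurableType (disp i)) (D : forall i, probability (T i) R)
    (f : forall i, T i -> R) (K : Type) (h : K -> I) :
  ubm D f -> ubm (fun k => D (h k)) (fun k => f (h k)).
Proof. by move=> [mf bf]; split=> // k; have [B HB] := bf k; exists B. Qed.

Section EX_theory.
Context {R : realType} d (T : measurableType d) (D : probability T R).
Implicit Types f g : T -> R.

Lemma mom_measurable f : mom D f -> measurable_fun setT f.
Proof. by move=> [/(_ tt)]. Qed.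

Lemma mom_integrable f : mom D f -> D.-integrable setT (EFin \o f).
Proof.
move=> [/(_ tt) mf bf]; apply/integrableP; split; first exact/measurable_EFinP.
have [B /(_ tt) HB] := bf 1%N; apply: le_lt_trans (ltry B).
by apply: le_trans HB; under [in leRHS]eq_integral do rewrite expr1.
Qed.

Lemma EXE f : mom D f -> (\int[D]_x (f x)%:E = (EX D f)%:E)%E.
Proof.
by move=> /mom_integrable mf; rewrite /EX /Rintegral fineK//; exact: integrable_fin_num.
Qed.

Lemma EX_D f g : mom D f -> mom D g -> EX D (fun x => f x + g x) = EX D f + EX D g.
Proof. by move=> mf mg; apply: RintegralD => //; exact: mom_integrable. Qed.

Lemma EX_B f g : mom D f -> mom D g -> EX D (fun x => f x - g x) = EX D f - EX D g.
Proof. by move=> mf mg; apply: RintegralB => //; exact: mom_integrable. Qed.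

Lemma EX_Z c f : mom D f -> EX D (fun x => c * f x) = c * EX D f.
Proof. by move=> mf; apply: RintegralZl => //; exact: mom_integrable. Qed.

Lemma EX_Zr c f : mom D f -> EX D (fun x => f x * c) = EX D f * c.
Proof. by move=> mf; apply: RintegralZr => //; exact: mom_integrable. Qed.

Lemma EX_cst c : EX D (fun=> c) = c.
Proof.
rewrite /EX Rintegral_cst//.
by have /= -> := @probability_setT _ _ _ D; rewrite mulr1.
Qed.

Lemma EX_sum (J : Type) (r : seq J) (P : pred J) (f : J -> T -> R) :
  (forall j, mom D (f j)) ->
  EX D (fun x => \sum_(j <- r | P j) f j x) = \sum_(j <- r | P j) EX D (f j).
Proof.
move=> uf; elim: r => [|j r IH].
  by rewrite big_nil -[RHS]EX_cst; congr EX; apply/funext => x; rewrite big_nil.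
rewrite big_cons -IH.
under [X in EX D X]eq_fun do rewrite big_cons.
by case: (P j) => //; rewrite EX_D//; exact: (@ubm_sum _ _ _ _ _ _ _ _ (fun j _ => f j)).
Qed.

Lemma EX_le f g : mom D f -> mom D g -> (forall x, f x <= g x) -> EX D f <= EX D g.
Proof. by move=> mf mg fg; apply: le_Rintegral => //; exact: mom_integrable. Qed.

Lemma EX_ge0 f : (forall x, 0 <= f x) -> 0 <= EX D f.
Proof. by move=> f0; exact: Rintegral_ge0. Qed.

Lemma EX_norm f : mom D f -> `|EX D f| <= EX D (fun x => `|f x|).
Proof. by move=> mf; apply: le_normr_Rintegral => //; exact: mom_integrable. Qed.

End EX_theory.

Lemma ubm_EX_bound {R : realType} (I : Type) (disp : I -> measure_display)
    (T : forall i, measurableType (disp i)) (D : forall i, probability (T i) R)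
    (f : forall i, T i -> R) : ubm D f -> exists B : R, forall i, `|EX (D i) (f i)| <= B.
Proof.
move=> uf; have [_ bf] := uf; have [B HB] := bf 1%N; exists B => i.
have ui := ubm_at i uf.
rewrite -lee_fin (le_trans _ (HB i))//.
under eq_integral do rewrite expr1.
rewrite (@EXE _ _ _ _ (fun x => `|f i x|)) ?lee_fin; last exact: (ubm_norm ui).
exact: EX_norm.
Qed.

Lemma mom_cst {R : realType} d (T : measurableType d) (D : probability T R) (c : R) :
  mom D (fun=> c).
Proof. exact: ubm_constant. Qed.

Section product_expectation.
Context {R : realType} d1 d2 (T1 : measurableType d1) (T2 : measurableType d2).
Variables (P1 : probability T1 R) (P2 : probability T2 R).

Lemma mom_fst (f : T1 -> R) : mom P1 f -> mom (P1 \x P2)%E (f \o fst).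
Proof.
move=> [/(_ tt) mf bf]; split=> [_|k]; first exact: measurableT_comp.
have [B /(_ tt) HB] := bf k; exists B => _.
rewrite fubini_tonelli1/=; last 2 first.
- by apply: (@measurable_normX _ _ (fun=> _) (fun=> (T1 * T2)%type) tt); exact: measurableT_comp.
- by move=> x; rewrite lee_fin exprn_ge0.
apply: le_trans HB; rewrite /fubini_F /=.
by under eq_integral do rewrite integral_cst//= probability_setT mule1.
Qed.

Lemma mom_snd (f : T2 -> R) : mom P2 f -> mom (P1 \x P2)%E (f \o snd).
Proof.
move=> [/(_ tt) mf bf]; split=> [_|k]; first exact: measurableT_comp.
have [B /(_ tt) HB] := bf k; exists B => _.
rewrite fubini_tonelli1/=; last 2 first.
- by apply: (@measurable_normX _ _ (fun=> _) (fun=> (T1 * T2)%type) tt); exact: measurableT_comp.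
- by move=> x; rewrite lee_fin exprn_ge0.
rewrite /fubini_F /= integral_cst//=.
by rewrite probability_setT mule1.
Qed.

Lemma EX_prod (f : T1 -> R) (g : T2 -> R) : mom P1 f -> mom P2 g ->
  EX (P1 \x P2)%E (fun x => f x.1 * g x.2) = EX P1 f * EX P2 g.
Proof.
move=> mf mg; have mfg := ubmM (mom_fst mf) (mom_snd mg).
rewrite /EX /Rintegral -integral12_prod_meas1; last exact: (mom_integrable mfg).
rewrite /fubini_F /=.
under eq_integral => x _.
  under eq_integral do rewrite EFinM.
  rewrite integralZl//; last exact: mom_integrable.
  rewrite EXE// -EFinM mulrC.
  over.
by rewrite -[LHS]/(EX P1 (fun x => EX P2 g * f x)) (EX_Z (EX P2 g) mf) mulrC.
Qed.

End product_expectation.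

Section cons_expectation.
Context {R : realType} d (T : measurableType d) (n : nat) (Q : 'I_n.+1 -> probability T R).
Let Q' := fun i => Q (lift ord0 i).

Lemma mom_cons (F : n.+1.-tuple T -> R) : measurable_fun setT F ->
  mom (Q ord0 \x prod_prob Q')%E (fun p => F (tuple_cons p)) -> mom (prod_prob Q) F.
Proof.
move=> mF [_ bF]; split=> // k; have [B /(_ tt) HB] := bF k; exists B => _.
rewrite /= ge0_integral_distribution//.
  by apply: (@measurable_normX _ _ (fun=> _) (fun=> n.+1.-tuple T) tt).
Qed.

Lemma EX_cons (F : n.+1.-tuple T -> R) : measurable_fun setT F ->
  mom (Q ord0 \x prod_prob Q')%E (fun p => F (tuple_cons p)) ->
  EX (prod_prob Q) F = EX (Q ord0 \x prod_prob Q')%E (fun p => F (tuple_cons p)).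
Proof.
move=> mF mFc; rewrite /EX /Rintegral /= integral_distribution//.
- exact/measurable_EFinP.
- exact: (mom_integrable mFc).
Qed.

End cons_expectation.

Section sums.
Context {R : realType}.

Definition tsum d (T : measurableType d) n (b : pred 'I_n) (f : 'I_n -> T -> R)
  (x : n.-tuple T) : R := \sum_(i | b i) f i (tnth x i).

Lemma tsum_cons d (T : measurableType d) n (b : pred 'I_n.+1) (f : 'I_n.+1 -> T -> R) x y :
  tsum b f (tuple_cons (x, y)) =
   (if b ord0 then f ord0 x else 0) + tsum (fun i => b (lift ord0 i)) (fun i => f (lift ord0 i)) y.
Proof.
rewrite /tsum big_mkcond big_ord_recl [in RHS]big_mkcond.
by congr (_ + _); apply: eq_bigr => i _; rewrite tnthS.
Qed.

Lemma measurable_tsum d (T : measurableType d) n (b : pred 'I_n) (f : 'I_n -> T -> R) :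
  (forall i, b i -> measurable_fun setT (f i)) -> measurable_fun setT (tsum b f).
Proof.
move=> mf; rewrite [X in measurable_fun _ X](_ : _ = fun x => \sum_(i <- [seq i <- enum 'I_n | b i]) f i (tnth x i)); last first.
  by apply/funext => x; rewrite big_filter big_enum_cond.
have : all b [seq i <- enum 'I_n | b i] by apply: filter_all.
elim: [seq _ <- _ | _] => [_|i s IH /= /andP[bi bs]].
  by under eq_fun do rewrite big_nil; exact: measurable_cst.
under eq_fun do rewrite big_cons; apply: measurable_funD; last exact: IH.
by apply: (@measurableT_comp _ _ _ _ _ _ (f i)); [exact: mf|exact: measurable_tnth].
Qed.

Lemma mom_tsum d (T : measurableType d) n (Q : 'I_n -> probability T R) (b : pred 'I_n) (f : 'I_n -> T -> R) :
  (forall i, b i -> mom (Q i) (f i)) -> mom (prod_prob Q) (tsum b f).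
Proof.
elim: n Q b f => [|n IH] Q b f mf.
  apply: eq_ubm (ubm_constant (fun _ : unit => prod_prob Q) 0) => i x.
  by rewrite /tsum big_ord0.
apply: mom_cons.
  by apply: measurable_tsum => i /mf /mom_measurable.
have mS := IH (fun i => Q (lift ord0 i)) (fun i => b (lift ord0 i)) (fun i => f (lift ord0 i)) (fun i => mf (lift ord0 i)).
have h1 : mom (Q ord0) (fun x => if b ord0 then f ord0 x else 0).
  by case: (boolP (b ord0)) => [/mf //|_]; exact: ubm_constant.
have := ubmD (mom_fst (prod_prob (fun i => Q (lift ord0 i))) h1) (mom_snd (Q ord0) mS).
by apply: eq_ubm => _ [x y]; rewrite tsum_cons.
Qed.

Lemma EX_tsum d (T : measurableType d) n (Q : 'I_n -> probability T R) (b : pred 'I_n)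
    (f : 'I_n -> T -> R) :
  (forall i, b i -> mom (Q i) (f i)) ->
  EX (prod_prob Q) (tsum b f) = \sum_(i | b i) EX (Q i) (f i).
Proof.
elim: n Q b f => [|n IH] Q b f mf.
  rewrite big_ord0 -[RHS](EX_cst (prod_prob Q)); congr EX; apply/funext => x.
  by rewrite /tsum big_ord0.
pose Q' i := Q (lift ord0 i); pose b' i := b (lift ord0 i).
pose f' i := f (lift ord0 i).
have mS : mom (prod_prob Q') (tsum b' f') by apply: mom_tsum => i; exact: mf.
pose f1 x := if b ord0 then f ord0 x else 0.
have m1 : mom (Q ord0) f1 by rewrite /f1; case: (boolP (b ord0)) => [/mf //|_]; exact: ubm_constant.
have mm := ubmD (mom_fst (prod_prob Q') m1) (mom_snd (Q ord0) mS).
rewrite EX_cons; last 2 first.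
- by apply: measurable_tsum => i bi; exact: (mom_measurable (mf i bi)).
- by apply: eq_ubm mm => _ [x y]; rewrite tsum_cons.
have -> : (fun p => tsum b f (tuple_cons p)) =
   (fun p : T * _ => (f1 p.1 * 1) + 1 * tsum b' f' p.2).
  by apply/funext => -[x y]; rewrite tsum_cons -/(f1 x) /= mulr1 mul1r.
have p1 := ubmM (mom_fst (prod_prob Q') m1) (mom_cst (Q ord0 \x prod_prob Q')%E 1).
have p2 := ubmM (mom_cst (Q ord0 \x prod_prob Q')%E 1) (mom_snd (Q ord0) mS).
rewrite (EX_D p1 p2) (EX_prod m1 (mom_cst (prod_prob Q') 1)) (EX_prod (mom_cst (Q ord0) 1) mS).
rewrite !EX_cst mulr1 mul1r IH; last by move=> i; exact: mf.
rewrite [RHS]big_mkcond big_ord_recl [in LHS]big_mkcond; congr (_ + _).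
by rewrite /f1; case: ifP => // _; rewrite EX_cst.
Qed.

Lemma EX_tsum2 d (T : measurableType d) n (Q : 'I_n -> probability T R) (b : pred 'I_n)
    (f g : 'I_n -> T -> R) :
  (forall i, b i -> mom (Q i) (f i)) -> (forall i, b i -> mom (Q i) (g i)) ->
  (forall i, b i -> EX (Q i) (f i) = 0) -> (forall i, b i -> EX (Q i) (g i) = 0) ->
  EX (prod_prob Q) (fun x => tsum b f x * tsum b g x) =
  \sum_(i | b i) EX (Q i) (fun x => f i x * g i x).
Proof.
elim: n Q b f g => [|n IH] Q b f g mf mg f0 g0.
  rewrite big_ord0 -[RHS](EX_cst (prod_prob Q)); congr EX; apply/funext => x.
  by rewrite /tsum big_ord0 mul0r.
pose Q' i := Q (lift ord0 i); pose b' i := b (lift ord0 i).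
pose f' i := f (lift ord0 i); pose g' i := g (lift ord0 i).
have mS : mom (prod_prob Q') (tsum b' f') by apply: mom_tsum => i; exact: mf.
have mS' : mom (prod_prob Q') (tsum b' g') by apply: mom_tsum => i; exact: mg.
pose f1 x := if b ord0 then f ord0 x else 0.
pose g1 x := if b ord0 then g ord0 x else 0.
have m1 : mom (Q ord0) f1 by rewrite /f1; case: (boolP (b ord0)) => [/mf //|_]; exact: ubm_constant.
have m2 : mom (Q ord0) g1 by rewrite /g1; case: (boolP (b ord0)) => [/mg //|_]; exact: ubm_constant.
have e1 : EX (Q ord0) f1 = 0 by rewrite /f1; case: (boolP (b ord0)) => [/f0 //|_]; rewrite EX_cst.
have e2 : EX (Q ord0) g1 = 0 by rewrite /g1; case: (boolP (b ord0)) => [/g0 //|_]; rewrite EX_cst.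
have mm := ubmM (ubmD (mom_fst (prod_prob Q') m1) (mom_snd (Q ord0) mS))
                (ubmD (mom_fst (prod_prob Q') m2) (mom_snd (Q ord0) mS')).
rewrite EX_cons; last 2 first.
- by apply: measurable_funM; apply: measurable_tsum => i bi;
    [exact: (mom_measurable (mf i bi))|exact: (mom_measurable (mg i bi))].
- by apply: eq_ubm mm => _ [x y]; rewrite !tsum_cons.
have -> : (fun p => tsum b f (tuple_cons p) * tsum b g (tuple_cons p)) =
   (fun p : T * _ => (f1 p.1 * g1 p.1 * 1) + (f1 p.1 * tsum b' g' p.2)
      + (g1 p.1 * tsum b' f' p.2) + 1 * (tsum b' f' p.2 * tsum b' g' p.2)).
  by apply/funext => -[x y]; rewrite !tsum_cons -/(f1 x) -/(g1 x) /=; ring.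
have mc := mom_cst (Q ord0 \x prod_prob Q')%E 1.
have p1 := ubmM (ubmM (mom_fst (prod_prob Q') m1) (mom_fst (prod_prob Q') m2)) mc.
have p2 := ubmM (mom_fst (prod_prob Q') m1) (mom_snd (Q ord0) mS').
have p3 := ubmM (mom_fst (prod_prob Q') m2) (mom_snd (Q ord0) mS).
have p4 := ubmM mc (ubmM (mom_snd (Q ord0) mS) (mom_snd (Q ord0) mS')).
rewrite (EX_D (ubmD (ubmD p1 p2) p3) p4) (EX_D (ubmD p1 p2) p3) (EX_D p1 p2).
rewrite (EX_prod (ubmM m1 m2) (mom_cst (prod_prob Q') 1)) (EX_prod m1 mS') (EX_prod m2 mS) (EX_prod (mom_cst (Q ord0) 1) (ubmM mS mS')).
rewrite e1 e2 !mul0r !addr0 !EX_cst mulr1 mul1r IH//; last 4 first.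
- by move=> i; exact: mf.
- by move=> i; exact: mg.
- by move=> i; exact: f0.
- by move=> i; exact: g0.
rewrite [RHS]big_mkcond big_ord_recl [in LHS]big_mkcond; congr (_ + _).
rewrite /f1 /g1; case: ifP => // _.
by under [X in EX _ X]eq_fun do rewrite mul0r; rewrite EX_cst.
Qed.

End sums.

Section moments_of_sums.
Context {R : realType}.

Lemma powD1_step (c h : nat) :
  (c.+1 ^ h + (if h is h'.+1 then c.+1 ^ h' else 0) <= c.+2 ^ h)%N.
Proof.
case: h => [|h] //.
have E : (c.+1 ^ h <= c.+2 ^ h)%N by case: h => // h; rewrite leq_exp2r.
by rewrite !expnS [in leqRHS]mulSn addnC leq_add// leq_mul2l E orbT.
Qed.

(* Binomial expansion over the last summand: its linear term vanishes by
   centering, so that each new summand raises the moment by a term of order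
   [c ^ (m/2 - 1)] only. *)
Lemma moment_tsum (B : nat -> R) (m : nat) : exists2 K : R, 0 <= K &
  forall d (T : measurableType d) n (Q : 'I_n -> probability T R) (b : pred 'I_n)
    (f : 'I_n -> T -> R),
  (forall i, b i -> mom (Q i) (f i)) -> (forall i, b i -> EX (Q i) (f i) = 0) ->
  (forall k i, b i -> `|EX (Q i) (fun x => f i x ^+ k)| <= B k) ->
  `|EX (prod_prob Q) (fun x => tsum b f x ^+ m)| <= K * ((\sum_i b i)%N.+1 ^ m./2)%:R.
Proof.
elim/ltn_ind: m => m IHm.
have /choice [Dm HDm] : forall j : nat, exists K : R, (j < m)%N -> 0 <= K /\
    forall d (T : measurableType d) n (Q : 'I_n -> probability T R) (b : pred 'I_n)
    (f : 'I_n -> T -> R),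
  (forall i, b i -> mom (Q i) (f i)) -> (forall i, b i -> EX (Q i) (f i) = 0) ->
  (forall k i, b i -> `|EX (Q i) (fun x => f i x ^+ k)| <= B k) ->
  `|EX (prod_prob Q) (fun x => tsum b f x ^+ j)| <= K * ((\sum_i b i)%N.+1 ^ j./2)%:R.
  move=> j; have [jm|jm] := ltnP j m; last by exists 0.
  by have [K K0 HK] := IHm j jm; exists K.
pose co (i : 'I_m) := 'C(m, i.+1)%:R * `|B i.+1| * `|Dm (m - i.+1)%N|.
have co0 i : 0 <= co i by rewrite /co !mulr_ge0.
exists (1 + \sum_i co i); first by rewrite addr_ge0// sumr_ge0.
set K := 1 + _; have K0 : 0 <= K by rewrite addr_ge0// sumr_ge0.
move=> d T; elim=> [|n IH] Q b f mf f0 fB.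
  rewrite big_ord0 exp1n mulr1.
  rewrite (_ : (fun x => _) = fun=> 0 ^+ m); last first.
    by apply/funext => x; rewrite /tsum big_ord0.
  rewrite EX_cst normrX normr0 expr0n (@le_trans _ _ 1)//; first by case: (m == 0%N).
  by rewrite lerDl sumr_ge0.
pose Q' i := Q (lift ord0 i); pose b' i := b (lift ord0 i).
pose f' i := f (lift ord0 i).
have mS : mom (prod_prob Q') (tsum b' f') by apply: mom_tsum => i; exact: mf.
have mF : measurable_fun setT (fun x : n.+1.-tuple T => tsum b f x ^+ m).
  by apply: measurable_funX; apply: measurable_tsum => i bi; exact: (mom_measurable (mf i bi)).
have {}IH := IH Q' b' f' (fun i => mf _) (fun i => f0 _) (fun k i => fB k _).
rewrite big_ord_recl.
have [b0|b0] := boolP (b ord0); last first.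
  rewrite add0n.
  have tE p : tsum b f (tuple_cons p) ^+ m = 1 * tsum b' f' p.2 ^+ m.
    by case: p => x y; rewrite tsum_cons (negbTE b0) add0r mul1r.
  rewrite EX_cons//; last first.
    apply: eq_ubm (mom_snd (Q ord0) (ubmX m mS)) => _ p.
    by rewrite tE mul1r.
  under [X in EX _ X]eq_fun do rewrite tE.
  by rewrite (EX_prod (mom_cst (Q ord0) 1) (ubmX m mS)) EX_cst mul1r.
have m0 := mf _ b0.
have tE p : tsum b f (tuple_cons p) ^+ m =
   \sum_(i < m.+1) 'C(m, i)%:R * (f ord0 p.1 ^+ i * tsum b' f' p.2 ^+ (m - i)).
  case: p => x y; rewrite tsum_cons b0 addrC exprDn; apply: eq_bigr => i _.
  by rewrite mulr_natl /= mulrC.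
have mt (i : 'I_m.+1) : mom (Q ord0 \x prod_prob Q')%E
    (fun p => f ord0 p.1 ^+ i * tsum b' f' p.2 ^+ (m - i)).
  exact: (ubmM (mom_fst (prod_prob Q') (ubmX i m0)) (mom_snd (Q ord0) (ubmX (m - i) mS))).
have mct (i : 'I_m.+1) := ubmM (mom_cst (Q ord0 \x prod_prob Q')%E 'C(m, i)%:R) (mt i).
rewrite EX_cons//; last first.
  by apply: eq_ubm (ubm_sum (index_enum 'I_m.+1) predT mct) => _ p; rewrite tE.
under [X in EX _ X]eq_fun do rewrite tE.
rewrite (EX_sum (index_enum 'I_m.+1) predT mct) big_ord_recl.
have E1 (i : 'I_m.+1) : EX (Q ord0 \x prod_prob Q')%E
   (fun p => 'C(m, i)%:R * (f ord0 p.1 ^+ i * tsum b' f' p.2 ^+ (m - i))) =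
   'C(m, i)%:R * (EX (Q ord0) (fun x => f ord0 x ^+ i) * EX (prod_prob Q') (fun y => tsum b' f' y ^+ (m - i))).
  by rewrite EX_Z// (EX_prod (ubmX i m0) (ubmX (m - i) mS)).
rewrite (E1 ord0) bin0 mul1r subn0 (_ : EX _ _ = 1) ?mul1r; last first.
  by rewrite -[RHS](EX_cst (Q ord0)); congr EX; apply/funext => x; rewrite expr0.
set c := (\sum_i b' i)%N in IH *.
pose G := (if m./2 is h'.+1 then c.+1 ^ h' else 0)%N.
apply: (le_trans (ler_normD _ _)).
apply: (@le_trans _ _ (K * (c.+1 ^ m./2)%:R + K * G%:R)); last first.
  by rewrite -mulrDr ler_wpM2l// -natrD ler_nat add1n powD1_step.
apply: lerD => //; apply: (le_trans (ler_norm_sum _ _ _)).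
apply: (@le_trans _ _ ((\sum_i co i) * G%:R)); last first.
  by rewrite ler_wpM2r// lerDr.
rewrite mulr_suml; apply: ler_sum => i _.
rewrite E1 /= /bump /= add1n.
have [i0|i0] := posnP i.
  by rewrite i0 (_ : EX _ (fun x => f ord0 x ^+ 1) = 0) ?mul0r ?mulr0 ?normr0 ?mulr_ge0 ?co0//; exact: f0.
have im : (m - i.+1 < m)%N by rewrite ltn_subrL (leq_ltn_trans _ (ltn_ord i)).
have [D0 HD] := HDm _ im.
rewrite !normrM /co normr_nat -!mulrA ler_wpM2l// -/b' ler_pM//.
  by rewrite (le_trans (fB _ _ b0))// ler_norm.
apply: (le_trans (HD _ _ _ Q' b' f' (fun i => mf _) (fun i => f0 _) (fun k i => fB k _))).
rewrite ger0_norm// ler_wpM2l// ler_nat /G.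
have mE : m = m.-2.+2 by move: (ltn_ord i) i0; lia.
have -> : m./2 = (m.-2)./2.+1 by rewrite {1}mE.
by rewrite leq_pexp2l// half_leq//; lia.
Qed.

Lemma ubm_nsum (I : Type) (disp : I -> measure_display)
    (T : forall i, measurableType (disp i)) (n : I -> nat)
    (Q : forall i, 'I_(n i) -> probability (T i) R) (b : forall i, pred 'I_(n i))
    (f : forall i, 'I_(n i) -> T i -> R) :
  (forall i j, b i j -> measurable_fun setT (f i j)) ->
  (forall k : nat, exists B : R, forall i j, b i j ->
     (\int[Q i j]_x (`|f i j x| ^+ k)%:E <= B%:E)%E) ->
  (forall i j, b i j -> EX (Q i j) (f i j) = 0) ->
  ubm (fun i => prod_prob (Q i))
    (fun i x => (Num.sqrt (\sum_j b i j)%:R)^-1 * tsum (b i) (f i) x).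
Proof.
move=> mf bf f0.
have mom_f i j : b i j -> mom (Q i j) (f i j).
  move=> bij; split=> [_|k]; first exact: mf.
  by have [B HB] := bf k; exists B => _; exact: HB.
have /choice [B HB] : forall k : nat, exists B : R, forall i j, b i j -> `|EX (Q i j) (fun x => f i j x ^+ k)| <= B.
  move=> k; have [B HB] := bf k; exists B => i j bij.
  have mk := ubmX k (mom_f i j bij).
  rewrite -lee_fin (le_trans _ (HB i j bij))//.
  under eq_integral do rewrite -normrX.
  rewrite (@EXE _ _ _ _ (fun x => `|f i j x ^+ k|)) ?lee_fin; first exact: EX_norm.
  exact: (ubm_norm mk).
split=> [i|k].
  by apply: measurable_funM => //; apply: measurable_tsum => j; exact: mf.
have [K K0 HK] := moment_tsum B (k + k).
exists (1 + K * 2 ^+ k) => i; set a := Num.sqrt _.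
have mS : mom (prod_prob (Q i)) (tsum (b i) (f i)) by apply: mom_tsum => j; exact: mom_f.
have m2 := ubmM (mom_cst (prod_prob (Q i)) (a ^- (k + k))) (ubmX (k + k) mS).
apply: (@le_trans _ _ (\int[prod_prob (Q i)]_x (1 + a ^- (k + k) * tsum (b i) (f i) x ^+ (k + k))%:E)%E).
  apply: le_nnintegral => x; first by rewrite lee_fin exprn_ge0.
  rewrite lee_fin -exprVn -exprMn exprD -expr2.
  rewrite -[X in 1 + X]real_normK ?num_real// normrX.
  by set t := _ ^+ k; have := sqr_ge0 (t - 1); have : 0 <= t by [rewrite exprn_ge0]; nra.
rewrite (EXE (ubmD (mom_cst (prod_prob (Q i)) 1) m2)) lee_fin (EX_D (mom_cst _ 1) m2).
rewrite EX_cst lerD2l (EX_Z _ (ubmX (k + k) mS)).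
rewrite (le_trans (ler_norm _))// normrM ger0_norm ?invr_ge0 ?exprn_ge0 ?sqrtr_ge0//.
have {HK} := HK _ _ _ (Q i) (b i) (f i) (mom_f i) (f0 i) (fun k => HB k i).
rewrite addnn doubleK => HK.
have a0 : 0 <= a ^- k.*2 by rewrite invr_ge0 exprn_ge0// sqrtr_ge0.
apply: (le_trans (ler_wpM2l a0 HK)).
rewrite mulrCA ler_wpM2l// -addnn exprD -expr2 -exprM mulnC exprM sqr_sqrtr ?ler0n//.
rewrite natrX -exprVn -exprMn.
case: (\sum_j b i j)%N => [|c]; first by rewrite invr0 mul0r lerXn2r ?nnegrE.
rewrite lerXn2r ?nnegrE ?mulr_ge0// mulrC ler_pdivrMr ?ltr0n// -natrM ler_nat; lia.
Qed.

Lemma ubm_chebyshev (I : Type) (disp : I -> measure_display)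
    (T : forall i, measurableType (disp i)) (D : forall i, probability (T i) R)
    (f : forall i, T i -> R) : ubm D f ->
  exists2 K : R, 0 <= K & forall i (e : R), 0 < e ->
    measurable [set x | e <= `|f i x|] /\
    (D i [set x | (e <= `|f i x|)%R] <= (K / e ^+ 2)%:E)%E.
Proof.
move=> [mf bf]; have [B HB] := bf 2%N; exists `|B| => // i e e0.
have mA : measurable [set x | e <= `|f i x|].
  rewrite -[X in measurable X]setTI.
  have mn : measurable_fun setT (fun x => `|f i x|) by apply: measurableT_comp; [exact: normr_measurable|exact: mf].
  have := mn measurableT _ (measurable_itv `[e, +oo[).
  by congr measurable; apply/seteqP; split => x /=; rewrite in_itv/= andbT.
split=> //; set A := [set x | _] in mA *.
have e2 : 0 < e ^+ 2 by rewrite exprn_gt0.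
suff : ((e ^+ 2)%:E * D i A <= `|B|%:E)%E.
  by move=> H; rewrite mulrC EFinM lee_pdivlMl.
rewrite -[in X in (X <= _)%E](setIT A) -integral_indic// -ge0_integralZl//; last 2 first.
- exact/measurable_EFinP.
- by rewrite lee_fin ltW.
rewrite (le_trans _ (le_trans (HB i) _)) ?lee_fin ?ler_norm//.
apply: le_nnintegral => x; rewrite -EFinM lee_fin.
  by apply: mulr_ge0; rewrite // ltW.
rewrite indicE.
case: (boolP (x \in A)) => [|_]; last by rewrite mulr0 exprn_ge0.
by rewrite inE /A /= mulr1 => ex; rewrite lerXn2r ?nnegrE ?(ltW e0)// (le_trans (ltW e0)).
Qed.

End moments_of_sums.

(** * Quadratic forms and inverses of principal submatrices *)

Section quadratic_forms.
Context {R : realType}.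

Definition qf n (A : 'M[R]_n) (u v : 'cV[R]_n) : R := (u^T *m A *m v) ord0 ord0.

Lemma qfDl n (A : 'M[R]_n) u1 u2 v : qf A (u1 + u2) v = qf A u1 v + qf A u2 v.
Proof. by rewrite /qf linearD /= !mulmxDl mxE. Qed.

Lemma qfDr n (A : 'M[R]_n) u v1 v2 : qf A u (v1 + v2) = qf A u v1 + qf A u v2.
Proof. by rewrite /qf mulmxDr mxE. Qed.

Lemma qfZl n (A : 'M[R]_n) a u v : qf A (a *: u) v = a * qf A u v.
Proof. by rewrite /qf linearZ /= -!scalemxAl mxE. Qed.

Lemma qfZr n (A : 'M[R]_n) a u v : qf A u (a *: v) = a * qf A u v.
Proof. by rewrite /qf -scalemxAr mxE. Qed.

Lemma qfNl n (A : 'M[R]_n) u v : qf A (- u) v = - qf A u v.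
Proof. by rewrite -scaleN1r qfZl mulN1r. Qed.

Lemma qfNr n (A : 'M[R]_n) u v : qf A u (- v) = - qf A u v.
Proof. by rewrite -scaleN1r qfZr mulN1r. Qed.

Lemma qfBm n (A B : 'M[R]_n) u v : qf (A - B) u v = qf A u v - qf B u v.
Proof. by rewrite /qf mulmxBr mulmxBl !mxE. Qed.

Lemma qfC n (A : 'M[R]_n) u v : A^T = A -> qf A u v = qf A v u.
Proof.
move=> As; rewrite /qf -[in RHS](trmxK (v^T *m A *m u)) [in RHS]mxE.
by rewrite !trmx_mul trmxK As mulmxA.
Qed.

Lemma qf_mulr n (A B : 'M[R]_n) u v : qf A u (B *m v) = qf (A *m B) u v.
Proof. by rewrite /qf !mulmxA. Qed.

Lemma qf_mull n (A B : 'M[R]_n) u v : qf A (B *m u) v = qf (B^T *m A) u v.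
Proof. by rewrite /qf trmx_mul !mulmxA. Qed.

Lemma qf_congr n m (A : 'M[R]_n) (B : 'M[R]_(n, m)) u v :
  qf (B^T *m A *m B) u v = qf A (B *m u) (B *m v).
Proof. by rewrite /qf trmx_mul !mulmxA. Qed.

Lemma qfE n (A : 'M[R]_n) u v :
  qf A u v = \sum_i \sum_j u i ord0 * A i j * v j ord0.
Proof.
rewrite /qf mxE exchange_big /=; apply: eq_bigr => j _.
by rewrite mxE mulr_suml; apply: eq_bigr => i _; rewrite mxE.
Qed.

Lemma qf_delta n (A : 'M[R]_n) i j : qf A (delta_mx i ord0) (delta_mx j ord0) = A i j.
Proof. by rewrite /qf trmx_delta -rowE -colE !mxE. Qed.

Definition psdmx n (A : 'M[R]_n) := A^T = A /\ forall v, 0 <= qf A v v.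

Lemma posdef_psd n (A : 'M[R]_n) : posdefmx A -> psdmx A.
Proof.
move=> [As Ap]; split=> // v; have [->|/Ap/ltW//] := eqVneq v 0.
by rewrite /qf mulmx0 mxE.
Qed.

Lemma posdef_unit n (A : 'M[R]_n) : posdefmx A -> A \in unitmx.
Proof.
move=> [As Ap]; rewrite unitmxE unitfE; apply/negP => /det0P[v v0 vA].
have vT : v^T != 0 by rewrite trmx_eq0.
by have := Ap _ vT; rewrite trmxK vA mul0mx mxE ltxx.
Qed.

Lemma psd_young n (A : 'M[R]_n) (t : R) u v : psdmx A -> 0 < t ->
  `|2 * qf A u v| <= t * qf A u u + t^-1 * qf A v v.
Proof.
move=> [As Ap] t0.
have E (s : R) : s ^+ 2 = 1 -> 0 <= t * qf A u u + t^-1 * qf A v v + s * (2 * qf A u v).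
  move=> s2; have := Ap (t *: u + s *: v).
  rewrite !(qfDl, qfDr, qfZl, qfZr) (qfC v u As).
  have -> : t * (t * qf A u u + s * qf A u v) + s * (t * qf A u v + s * qf A v v) =
     t * (t * qf A u u + t^-1 * qf A v v + s * (2 * qf A u v)).
    transitivity (t ^+ 2 * qf A u u + s ^+ 2 * qf A v v + 2 * s * t * qf A u v); first by ring.
    by rewrite s2; field; exact: lt0r_neq0.
  by rewrite pmulr_rge0.
have := E 1 (expr1n _ _); have := E (- 1) (sqrr_sign _ 1).
by rewrite ler_norml; lra.
Qed.

Lemma psd_cauchy n (A : 'M[R]_n) u v : psdmx A ->
  qf A u v ^+ 2 <= qf A u u * qf A v v.
Proof.
move=> [As Ap]; have uu := Ap u; have vv := Ap v.
have H (s : R) : 0 <= s ^+ 2 * qf A u u + 2 * s * qf A u v + qf A v v.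
  have := Ap (s *: u + v); rewrite !(qfDl, qfDr, qfZl, qfZr) (qfC v u As).
  by congr (0 <= _); ring.
have [u0|u0] := eqVneq (qf A u u) 0.
  rewrite u0 mul0r; have [->|uv0] := eqVneq (qf A u v) 0; first by rewrite expr0n.
  have := H (- (qf A v v + 1) / (2 * qf A u v)).
  rewrite u0 mulr0 add0r.
  have -> : 2 * (- (qf A v v + 1) / (2 * qf A u v)) * qf A u v = - (qf A v v + 1).
    by field.
  by rewrite opprD addrAC addNr add0r ler0N1.
have := H (- qf A u v / qf A u u).
have -> : (- qf A u v / qf A u u) ^+ 2 * qf A u u + 2 * (- qf A u v / qf A u u) * qf A u v + qf A v v
  = qf A v v - qf A u v ^+ 2 / qf A u u by field.
by rewrite subr_ge0 ler_pdivrMr ?lt0r ?u0// mulrC.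
Qed.

Lemma psd_unit_posdef n (A : 'M[R]_n) : psdmx A -> A \in unitmx -> posdefmx A.
Proof.
move=> pA Au; have [As Ap] := pA; split=> // v v0.
rewrite -/(qf A v v) lt0r Ap andbT; apply: contra v0 => /eqP vv0.
have Av0 : A *m v = 0.
  apply/matrixP => i j; rewrite (ord1 j) [RHS]mxE.
  have := psd_cauchy (delta_mx i ord0) v pA.
  rewrite vv0 mulr0 real_exprn_even_le0 ?num_real//= /qf trmx_delta -rowE.
  by rewrite -row_mul [X in X == 0]mxE => /eqP.
by rewrite -(mulKmx Au v) Av0 mulmx0.
Qed.

Lemma invmx_sym n (A : 'M[R]_n) : A^T = A -> (invmx A)^T = invmx A.
Proof. by move=> As; rewrite trmx_inv As. Qed.

Lemma invmx_psd n (A : 'M[R]_n) : posdefmx A -> psdmx (invmx A).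
Proof.
move=> pA; have [As Ap] := posdef_psd pA; split; first exact: invmx_sym.
move=> v; have := Ap (invmx A *m v).
by rewrite qf_mulr qf_mull invmx_sym// (mulmxV (posdef_unit pA)) mulmx1.
Qed.

Lemma psd_entry n (A : 'M[R]_n) i j : psdmx A -> `|A i j| <= A i i + A j j.
Proof.
move=> pA; have [As Ap] := pA.
have := psd_young (delta_mx i ord0) (delta_mx j ord0) pA ltr01.
rewrite invr1 !mul1r !qf_delta normrM normr_nat.
have := normr_ge0 (A i j); lra.
Qed.

Lemma psd_diag_ge0 n (A : 'M[R]_n) i : psdmx A -> 0 <= A i i.
Proof. by move=> [_ /(_ (delta_mx i ord0))]; rewrite qf_delta. Qed.

Lemma perturbed_qf n (A E : 'M[R]_n) (g h : 'cV[R]_n) (t : R) : posdefmx A -> 0 < t ->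
  A *m h = g + E *m h ->
  `|qf A h h - qf (invmx A) g g| <=
    t * qf (invmx A) g g + (1 + t^-1) * qf (invmx A) (E *m h) (E *m h).
Proof.
move=> pA t0 hE; have [As Ap] := posdef_psd pA; have pI := invmx_psd pA.
set w := E *m h in hE *.
have -> : h = invmx A *m (g + w) by rewrite -hE mulKmx// posdef_unit.
rewrite qf_mulr qf_mull invmx_sym// mulmxV ?posdef_unit// mulmx1.
rewrite !(qfDl, qfDr) (qfC w g pI.1).
have := psd_young g w pI t0; have := pI.2 w; have := pI.2 g.
set a := qf _ g g; set b := qf _ g w; set c := qf _ w w => a0 c0 H.
rewrite (_ : a + b + (b + c) - a = 2 * b + c); last by ring.
apply: (le_trans (ler_normD _ _)); rewrite (ger0_norm c0); nra.
Qed.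

End quadratic_forms.

Section submodels.
Context {R : realType} {d : nat}.
Implicit Types (P : {set 'I_d}) (Q : 'M[R]_d).

Definition emb P : 'M[R]_(d, #|P|) := \matrix_(i, k) (i == enum_val k)%:R.

Definition subgram Q P : 'M[R]_#|P| := (emb P)^T *m Q *m emb P.

Definition subinv Q P : 'M[R]_d := emb P *m invmx (subgram Q P) *m (emb P)^T.

Lemma tr_emb_mul m P (A : 'M[R]_(d, m)) k j : ((emb P)^T *m A) k j = A (enum_val k) j.
Proof.
rewrite mxE (bigD1 (enum_val k))//= !mxE eqxx mul1r big1 ?addr0// => i ik.
by rewrite !mxE (negbTE ik) mul0r.
Qed.

Lemma mul_emb m P (A : 'M[R]_(m, d)) k j : (A *m emb P) j k = A j (enum_val k).
Proof.
rewrite mxE (bigD1 (enum_val k))//= !mxE eqxx mulr1 big1 ?addr0// => i ik.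
by rewrite !mxE (negbTE ik) mulr0.
Qed.

Lemma subgramE Q P k l : subgram Q P k l = Q (enum_val k) (enum_val l).
Proof. by rewrite mul_emb tr_emb_mul. Qed.

Lemma embK P : (emb P)^T *m emb P = 1%:M.
Proof.
by apply/matrixP => k l; rewrite mul_emb !mxE (inj_eq enum_val_inj) eq_sym.
Qed.

Lemma emb_outside P m (A : 'M[R]_(#|P|, m)) i j : i \notin P -> (emb P *m A) i j = 0.
Proof.
move=> iP; rewrite mxE big1// => k _; rewrite mxE.
by case: eqP => [iE|]; rewrite ?mul0r//; rewrite iE enum_valP in iP.
Qed.

Lemma emb_id P m (A : 'M[R]_(d, m)) : (forall i j, i \notin P -> A i j = 0) ->
  emb P *m ((emb P)^T *m A) = A.
Proof.
move=> A0; apply/matrixP => i j; have [iP|iP] := boolP (i \in P); last first.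
  by rewrite emb_outside// A0.
rewrite mxE (bigD1 (enum_rank_in iP i))//= tr_emb_mul mxE !enum_rankK_in// eqxx mul1r.
rewrite big1 ?addr0// => k ki; rewrite mxE; case: eqP => [iE|]; rewrite ?mul0r//.
by move: ki; rewrite [X in enum_rank_in _ X]iE enum_valK_in eqxx.
Qed.

Lemma emb_sub P0 P : P0 \subset P -> emb P *m ((emb P)^T *m emb P0) = emb P0.
Proof.
move=> sP; apply: emb_id => i k iP; rewrite mxE.
by case: eqP => // iE; rewrite iE (fintype.subsetP sP) ?enum_valP in iP.
Qed.

Lemma subgram_posdef Q P : posdefmx Q -> posdefmx (subgram Q P).
Proof.
move=> [Qs Qp]; split; first by rewrite /subgram !trmx_mul trmxK Qs mulmxA.
move=> v v0; have := Qp (emb P *m v); rewrite trmx_mul !mulmxA; apply.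
apply: contra v0 => /eqP/(congr1 (mulmx (emb P)^T)).
by rewrite mulmxA embK mul1mx mulmx0 => ->.
Qed.

Lemma subinv_sym Q P : Q^T = Q -> (subinv Q P)^T = subinv Q P.
Proof.
move=> Qs; rewrite /subinv !trmx_mul trmxK invmx_sym ?mulmxA//.
by rewrite /subgram !trmx_mul trmxK Qs mulmxA.
Qed.

Lemma subinv_mul_emb Q P P0 : posdefmx Q -> P0 \subset P ->
  subinv Q P *m Q *m emb P0 = emb P0.
Proof.
move=> pQ sP; have Su := posdef_unit (subgram_posdef P pQ).
have E : subinv Q P *m Q *m emb P = emb P.
  have -> : subinv Q P *m Q *m emb P = emb P *m (invmx (subgram Q P) *m subgram Q P).
    by rewrite /subinv /subgram !mulmxA.
  by rewrite mulVmx// mulmx1.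
by rewrite -(emb_sub sP) !mulmxA E.
Qed.

Lemma subinv_absorbl Q P P0 : posdefmx Q -> P0 \subset P ->
  subinv Q P *m Q *m subinv Q P0 = subinv Q P0.
Proof. by move=> pQ sP; rewrite {2}/subinv !mulmxA subinv_mul_emb. Qed.

Lemma subinv_absorbr Q P P0 : posdefmx Q -> P0 \subset P ->
  subinv Q P0 *m Q *m subinv Q P = subinv Q P0.
Proof.
move=> pQ sP; have := congr1 trmx (subinv_absorbl pQ sP).
by rewrite trmx_mul [(_ *m Q)^T]trmx_mul !subinv_sym ?pQ.1// mulmxA.
Qed.

Definition subinvB Q P P0 := subinv Q P - subinv Q P0.

Lemma subinvB_sym Q P P0 : Q^T = Q -> (subinvB Q P P0)^T = subinvB Q P P0.
Proof. by move=> Qs; rewrite /subinvB linearB /= !subinv_sym. Qed.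

Lemma subinvB_proj Q P P0 : posdefmx Q -> P0 \subset P ->
  subinvB Q P P0 *m Q *m subinvB Q P P0 = subinvB Q P P0.
Proof.
move=> pQ sP; rewrite /subinvB !(mulmxBl, mulmxBr).
rewrite !(subinv_absorbl pQ sP) !(subinv_absorbr pQ sP) !(subinv_absorbl pQ (subxx _)).
by rewrite subrr subr0.
Qed.

Lemma subinvB_psd Q P P0 : posdefmx Q -> P0 \subset P -> psdmx (subinvB Q P P0).
Proof.
move=> pQ sP; have [Qs Qp] := posdef_psd pQ; split; first exact: subinvB_sym.
move=> v; rewrite -(subinvB_proj pQ sP) -{1}(subinvB_sym P P0 Qs).
by rewrite -qf_mulr -qf_mull.
Qed.

Lemma subinvB_neq0 Q P P0 : posdefmx Q -> P0 \proper P ->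
  exists v : 'cV[R]_d, exists2 w : 'cV[R]_#|P|, w != 0 & subinvB Q P P0 *m v = emb P *m w.
Proof.
move=> pQ /fintype.properP[sP [k kP kP0]].
pose e : 'cV[R]_d := delta_mx k ord0.
have eE : emb P *m ((emb P)^T *m e) = e.
  apply: emb_id => i j; apply: contraNeq; rewrite mxE.
  by have [->|] := eqVneq i k; rewrite //= eqxx.
exists (Q *m e); exists ((emb P)^T *m (subinvB Q P P0 *m (Q *m e))).
  apply/eqP => /matrixP/(_ (enum_rank_in kP k) ord0).
  rewrite tr_emb_mul enum_rankK_in// mulmxBl mxE.
  rewrite -{1}eE !mulmxA subinv_mul_emb// -(mulmxA (emb P)) eE.
  rewrite /subinv -!mulmxA [X in _ + X]mxE emb_outside// !mxE !eqxx subr0 => /eqP.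
  by rewrite oner_eq0.
rewrite emb_id// => i j iP; rewrite mulmxBl /subinv -!mulmxA mxE emb_outside//.
rewrite mxE emb_outside ?subrr//.
by apply: contra iP; exact: (fintype.subsetP sP).
Qed.

Lemma posdef_setT Q : psdmx Q -> subgram Q [set: 'I_d]%SET \in unitmx -> posdefmx Q.
Proof.
move=> [Qs Qp] U.
have E : emb [set: 'I_d]%SET *m (emb [set: 'I_d]%SET)^T = 1%:M.
  by rewrite -[X in _ *m X]mulmx1; apply: emb_id => i j; rewrite inE.
split=> // v v0; rewrite -/(qf Q v v).
have : posdefmx (subgram Q [set: 'I_d]%SET).
  apply: psd_unit_posdef => //; split=> [|w].
    by rewrite /subgram !trmx_mul trmxK Qs mulmxA.
  by rewrite /subgram qf_congr.
move=> [_ /(_ ((emb [set: 'I_d]%SET)^T *m v))].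
rewrite -/(qf _ _ _) /subgram qf_congr mulmxA E mul1mx; apply.
by apply: contra v0 => /eqP/(congr1 (mulmx (emb [set: 'I_d]%SET))); rewrite mulmxA E mul1mx mulmx0 => ->.
Qed.

End submodels.

Section inequalities.
Context {R : realType}.

Lemma cubic_young (x w c : R) : 0 <= w -> 0 < c ->
  x ^+ 2 * w <= c^-1 * `|x| ^+ 3 + c ^+ 2 * w ^+ 3.
Proof.
move=> w0 c0; rewrite -[x ^+ 2]real_normK ?num_real//.
have x0 := normr_ge0 x; move: (`|x|) x0 => {}x x0.
have [wx|xw] := leP (c * w) x.
  apply: (@le_trans _ _ (c^-1 * x ^+ 3)); last by rewrite lerDl mulr_ge0 ?exprn_ge0// ltW.
  rewrite [x ^+ 3]exprSr mulrCA ler_wpM2l ?exprn_ge0//.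
  by rewrite ler_pdivlMl.
apply: (@le_trans _ _ (c ^+ 2 * w ^+ 3)); last by rewrite lerDr mulr_ge0 ?exprn_ge0// invr_ge0 ltW.
rewrite [w ^+ 3]exprSr mulrA ler_wpM2r// -exprMn lerXn2r ?nnegrE ?(ltW xw)//.
by rewrite mulr_ge0// ltW.
Qed.

Lemma sqr_sum_le (J : finType) (f : J -> R) :
  (\sum_j f j) ^+ 2 <= #|J|%:R * \sum_j f j ^+ 2.
Proof.
have : 0 <= \sum_i \sum_j (f i - f j) ^+ 2.
  by apply: sumr_ge0 => i _; apply: sumr_ge0 => j _; exact: sqr_ge0.
rewrite (eq_bigr (fun i => #|J|%:R * f i ^+ 2 + \sum_j f j ^+ 2 - 2 * f i * \sum_j f j)); last first.
  move=> i _; transitivity (\sum_j (f i ^+ 2 + f j ^+ 2 - (2 * f i) * f j)).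
    by apply: eq_bigr => j _; ring.
  by rewrite sumrB big_split /= sumr_const -[X in X + _ - _]mulr_natl -mulr_sumr.
rewrite sumrB big_split /= -mulr_sumr -mulr_suml -mulr_sumr sumr_const -[X in _ + X - _]mulr_natl.
by rewrite expr2; lra.
Qed.

Lemma qf_bound n (A : 'M[R]_n) (B : R) (u : 'cV[R]_n) : (forall i j, `|A i j| <= B) ->
  qf A u u <= B * n%:R * \sum_i u i ord0 ^+ 2.
Proof.
move=> AB; rewrite qfE.
case: n => [|n] in A u AB *; first by rewrite !big_ord0 mulr0.
have B0 : 0 <= B by apply: le_trans (AB ord0 ord0).
apply: (@le_trans _ _ (B * (\sum_i `|u i ord0|) ^+ 2)); last first.
  rewrite -mulrA ler_wpM2l// (le_trans (sqr_sum_le _))// card_ord.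
  by under eq_bigr do rewrite real_normK ?num_real//.
rewrite expr2 mulr_suml mulr_sumr; apply: ler_sum => i _.
rewrite mulr_sumr mulr_sumr; apply: ler_sum => j _.
rewrite (le_trans (ler_norm _))// !normrM mulrAC [X in _ <= X]mulrC.
by rewrite ler_wpM2l// mulr_ge0.
Qed.

End inequalities.

Section ring_classes.
Context {R : realType} (T : Type).

Record ring_class (cls : (T -> R) -> Prop) : Prop := RingClass {
  cls_cst : forall c, cls (fun=> c);
  clsD : forall f g, cls f -> cls g -> cls (fun x => f x + g x);
  clsM : forall f g, cls f -> cls g -> cls (fun x => f x * g x) }.

Variables (cls : (T -> R) -> Prop) (H : ring_class cls).

Lemma eq_cls f g : f =1 g -> cls f -> cls g.
Proof. by move=> /funext ->. Qed.

Lemma clsZ c f : cls f -> cls (fun x => c * f x).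
Proof. by apply: (clsM H); exact: cls_cst. Qed.

Lemma clsN f : cls f -> cls (fun x => - f x).
Proof. by move=> /(clsZ (-1)); apply: eq_cls => x; rewrite mulN1r. Qed.

Lemma clsB f g : cls f -> cls g -> cls (fun x => f x - g x).
Proof. by move=> cf cg; apply: (clsD H) => //; exact: clsN. Qed.

Lemma cls_sum (J : Type) (r : seq J) (P : pred J) (f : J -> T -> R) :
  (forall j, cls (f j)) -> cls (fun x => \sum_(j <- r | P j) f j x).
Proof.
move=> cf; elim: r => [|j r IH].
  by apply: eq_cls (cls_cst H 0) => x; rewrite big_nil.
case Pj : (P j); last by apply: eq_cls IH => x; rewrite big_cons Pj.
by apply: eq_cls (clsD H (cf j) IH) => x; rewrite big_cons Pj.
Qed.

Lemma cls_prod (J : Type) (r : seq J) (P : pred J) (f : J -> T -> R) :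
  (forall j, cls (f j)) -> cls (fun x => \prod_(j <- r | P j) f j x).
Proof.
move=> cf; elim: r => [|j r IH].
  by apply: eq_cls (cls_cst H 1) => x; rewrite big_nil.
case Pj : (P j); last by apply: eq_cls IH => x; rewrite big_cons Pj.
by apply: eq_cls (clsM H (cf j) IH) => x; rewrite big_cons Pj.
Qed.

Lemma clsX f k : cls f -> cls (fun x => f x ^+ k).
Proof.
move=> cf; elim: k => [|k IH]; first by apply: eq_cls (cls_cst H 1) => x.
by apply: eq_cls (clsM H cf IH) => x; rewrite exprS.
Qed.

Definition clsmx m n (A : T -> 'M[R]_(m, n)) := forall i j, cls (fun x => A x i j).

Lemma eq_clsmx m n (A B : T -> 'M[R]_(m, n)) : A =1 B -> clsmx A -> clsmx B.
Proof. by move=> /funext ->. Qed.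

Lemma clsmx_cst m n (A : 'M[R]_(m, n)) : clsmx (fun=> A).
Proof. by move=> i j; exact: (cls_cst H). Qed.

Lemma clsmxM m n p (A : T -> 'M[R]_(m, n)) (B : T -> 'M[R]_(n, p)) :
  clsmx A -> clsmx B -> clsmx (fun x => A x *m B x).
Proof.
move=> cA cB i j; apply: (@eq_cls (fun x => \sum_k A x i k * B x k j)).
  by move=> x; rewrite mxE.
by apply: cls_sum => k; exact: (clsM H).
Qed.

Lemma clsmxT m n (A : T -> 'M[R]_(m, n)) : clsmx A -> clsmx (fun x => (A x)^T).
Proof. by move=> cA i j; apply: eq_cls (cA j i) => x; rewrite mxE. Qed.

Lemma cls_trace n (A : T -> 'M[R]_n) : clsmx A -> cls (fun x => \tr (A x)).
Proof. by move=> cA; apply: cls_sum => i; exact: cA. Qed.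

Lemma cls_qf n (A : T -> 'M[R]_n) u v : clsmx A -> clsmx u -> clsmx v ->
  cls (fun x => qf (A x) (u x) (v x)).
Proof. by move=> cA cu cv; apply: (clsmxM (clsmxM (clsmxT cu) cA) cv). Qed.

Lemma cls_det n (A : T -> 'M[R]_n) : clsmx A -> cls (fun x => \det (A x)).
Proof.
move=> cA; apply: cls_sum => s; apply: (clsM H); first exact: (cls_cst H).
by apply: cls_prod => i; exact: cA.
Qed.

Lemma clsmx_adj n (A : T -> 'M[R]_n) : clsmx A -> clsmx (fun x => \adj (A x)).
Proof.
move=> cA i j; apply: (@eq_cls (fun x => cofactor (A x) j i)).
  by move=> x; rewrite mxE.
apply: (clsM H); first exact: (cls_cst H).
by apply: cls_det => k l; apply: eq_cls (cA (lift j k) (lift i l)) => x; rewrite !mxE.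
Qed.

Definition cramer n (A : 'M[R]_n) := (\det A)^-1 *: \adj A.

Lemma cramerE n (A : 'M[R]_n) : A \in unitmx -> cramer A = invmx A.
Proof. by move=> Au; rewrite /invmx Au. Qed.

Lemma clsmx_cramer n (A : T -> 'M[R]_n) : clsmx A ->
  cls (fun x => (\det (A x))^-1) -> clsmx (fun x => cramer (A x)).
Proof.
move=> cA cd i j; apply: eq_cls (clsM H cd (clsmx_adj cA i j)) => x.
by rewrite [RHS]mxE.
Qed.

End ring_classes.

Section measurable_class.
Context {R : realType} {d} (T : measurableType d).

Lemma measurable_ring_class : ring_class (fun f : T -> R => measurable_fun setT f).
Proof.
split=> [c|f g|f g]; first exact: measurable_cst.
  exact: measurable_funD.
exact: measurable_funM.
Qed.

Lemma measurable_invr (f : T -> R) : measurable_fun setT f ->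
  measurable_fun setT (fun x => (f x)^-1).
Proof.
move=> mf; have -> : (fun x => (f x)^-1) = (fun x => f x * powR (f x ^+ 2) (- 1)).
  apply/funext => x; rewrite powR_inv1 ?sqr_ge0//.
  by have [->|f0] := eqVneq (f x) 0; [rewrite invr0 mul0r|field].
apply: measurable_funM => //.
apply: (@measurableT_comp _ _ _ _ _ _ (@powR R ^~ (- 1))); first exact: measurable_powR.
exact: measurable_funX.
Qed.

Lemma measurable_invmx n (A : T -> 'M[R]_n) :
  clsmx (fun f : T -> R => measurable_fun setT f) A ->
  clsmx (fun f : T -> R => measurable_fun setT f) (fun x => invmx (A x)).
Proof.
move=> mA i j; have H := measurable_ring_class.
have mdet : measurable_fun setT (fun x => \det (A x)) by exact: (cls_det H).
have -> : (fun x => invmx (A x) i j) =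
    (fun x => if (\det (A x) == 0) then A x i j else cramer (A x) i j).
  apply/funext => x; rewrite /invmx unitmxE unitfE.
  by case: eqP.
apply: measurable_fun_ifT => //.
- by apply: measurable_fun_eqr => //; exact: measurable_cst.
- by apply: (clsmx_cramer H) => //; exact: measurable_invr.
Qed.

Definition bounded_measurable (f : T -> R) :=
  measurable_fun setT f /\ exists B, forall x, `|f x| <= B.

Lemma bounded_measurable_ring_class : ring_class bounded_measurable.
Proof.
split=> [c|f g [mf [B HB]] [mg [B' HB']]|f g [mf [B HB]] [mg [B' HB']]].
- by split; [exact: measurable_cst|exists `|c|].
- split; first exact: measurable_funD.
  by exists (B + B') => x; rewrite (le_trans (ler_normD _ _))// lerD.
- split; first exact: measurable_funM.
  by exists (B * B') => x; rewrite normrM ler_pM.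
Qed.

End measurable_class.

(** * Least squares for a population or a sample *)

Section moment_functionals.
Context {R : realType} {d : nat}.
Implicit Types (P : {set 'I_d}) (b : 'cV[R]_d) (z : obs R d).

Definition covX z : 'cV[R]_d := \col_i tnth z.1 i.

Definition residX b z : R := z.2 - \sum_i b i ord0 * tnth z.1 i.

(* [None] stands for the constant 1, so that products of four of these
   variables yield all the moments of order at most 4. *)
Definition obs_var (v : option (option 'I_d)) z : R :=
  match v with None => 1 | Some None => z.2 | Some (Some i) => tnth z.1 i end.

Definition monomial
    (q : option (option 'I_d) * option (option 'I_d) *
         option (option 'I_d) * option (option 'I_d)) z : R :=
  obs_var q.1.1.1 z * obs_var q.1.1.2 z * obs_var q.1.2 z * obs_var q.2 z.

(* The common features of the expectation under a distribution and of the
   average over a sample. *)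
Record lfun (C : (obs R d -> R) -> Prop) (L : (obs R d -> R) -> R) : Prop := LFun {
  lfun_ring : ring_class C;
  lfun_y : C snd;
  lfun_x : forall i, C (fun z => tnth z.1 i);
  lfunD : forall f g, C f -> C g -> L (fun z => f z + g z) = L f + L g;
  lfunZ : forall a f, C f -> L (fun z => a * f z) = a * L f;
  lfun_ge0 : forall f, (forall z, 0 <= f z) -> 0 <= L f }.

Definition mom_xx (L : (obs R d -> R) -> R) : 'M[R]_d :=
  \matrix_(i, j) L (fun z => tnth z.1 i * tnth z.1 j).
Definition mom_xy (L : (obs R d -> R) -> R) : 'cV[R]_d :=
  \col_i L (fun z => z.2 * tnth z.1 i).
Definition slope (L : (obs R d -> R) -> R) P : 'cV[R]_d :=
  subinv (mom_xx L) P *m mom_xy L.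
Definition score (L : (obs R d -> R) -> R) b : 'cV[R]_d :=
  \col_i L (fun z => residX b z * tnth z.1 i).
Definition wmom (L : (obs R d -> R) -> R) b : 'M[R]_d :=
  \matrix_(i, j) L (fun z => residX b z ^+ 2 * (tnth z.1 i * tnth z.1 j)).
Definition risk (L : (obs R d -> R) -> R) P : R :=
  L (fun z => residX (slope L P) z ^+ 2).
Definition penalty (L : (obs R d -> R) -> R) P : R :=
  \tr (wmom L (slope L P) *m subinv (mom_xx L) P).

Section lfun_theory.
Variables (C : (obs R d -> R) -> Prop) (L : (obs R d -> R) -> R) (H : lfun C L).

Let HC := lfun_ring H.

Lemma lfun0 : L (fun=> 0) = 0.
Proof.
rewrite -[RHS](mul0r (L (fun=> 0))) -(lfunZ H); last exact: (cls_cst HC).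
by congr L; apply/funext => z; rewrite mul0r.
Qed.

Lemma lfunN f : C f -> L (fun z => - f z) = - L f.
Proof.
move=> Cf; rewrite -mulN1r -(lfunZ H)//; congr L; apply/funext => z.
by rewrite mulN1r.
Qed.

Lemma lfunB f g : C f -> C g -> L (fun z => f z - g z) = L f - L g.
Proof. by move=> Cf Cg; rewrite (lfunD H)// ?lfunN//; exact: (clsN HC). Qed.

Lemma lfun_sum (J : finType) (f : J -> obs R d -> R) : (forall j, C (f j)) ->
  L (fun z => \sum_j f j z) = \sum_j L (f j).
Proof.
move=> Cf; elim: (index_enum J) => [|j r IH].
  by rewrite big_nil -[RHS]lfun0; congr L; apply/funext => z; rewrite big_nil.
rewrite big_cons -IH -(lfunD H)//; last exact: (cls_sum HC).
by congr L; apply/funext => z; rewrite big_cons.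
Qed.

Lemma lfun_comb (f : obs R d -> R) b : C f ->
  L (fun z => (\sum_i b i ord0 * tnth z.1 i) * f z) =
  \sum_i b i ord0 * L (fun z => tnth z.1 i * f z).
Proof.
move=> Cf; have Cx i : C (fun z => tnth z.1 i * f z).
  by apply: (clsM HC) => //; exact: (lfun_x H).
transitivity (L (fun z => \sum_i b i ord0 * (tnth z.1 i * f z))).
  by congr L; apply/funext => z; rewrite mulr_suml; apply: eq_bigr => i _; rewrite mulrA.
rewrite lfun_sum; last by move=> i; exact: (clsZ HC).
by apply: eq_bigr => i _; rewrite (lfunZ H).
Qed.

Lemma C_comb b : C (fun z => \sum_i b i ord0 * tnth z.1 i).
Proof. by apply: (cls_sum HC) => i; apply: (clsZ HC); exact: (lfun_x H). Qed.

Lemma C_resid b : C (residX b).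
Proof. by apply: (clsB HC); [exact: (lfun_y H)|exact: C_comb]. Qed.

Lemma lfun_sub_comb2 (u f : obs R d -> R) b : C u -> C f ->
  L (fun z => (u z - \sum_i b i ord0 * tnth z.1 i) ^+ 2 * f z) =
  L (fun z => u z ^+ 2 * f z)
  - 2 * \sum_i b i ord0 * L (fun z => u z * tnth z.1 i * f z)
  + \sum_i \sum_j b i ord0 * L (fun z => tnth z.1 i * tnth z.1 j * f z) * b j ord0.
Proof.
move=> Cu Cf; have Cx := lfun_x H.
have CB := C_comb b.
have C1 : C (fun z => u z ^+ 2 * f z) by apply: (clsM HC) => //; exact: (clsX HC).
have C2 : C (fun z => (\sum_i b i ord0 * tnth z.1 i) * (u z * f z)).
  by apply: (clsM HC) => //; exact: (clsM HC).
have C3 : C (fun z => (\sum_i b i ord0 * tnth z.1 i) * ((\sum_i b i ord0 * tnth z.1 i) * f z)).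
  by apply: (clsM HC) => //; exact: (clsM HC).
transitivity (L (fun z => u z ^+ 2 * f z
    - 2 * ((\sum_i b i ord0 * tnth z.1 i) * (u z * f z))
    + (\sum_i b i ord0 * tnth z.1 i) * ((\sum_i b i ord0 * tnth z.1 i) * f z))).
  by congr L; apply/funext => z; ring.
rewrite (lfunD H)//; last by apply: (clsB HC) => //; exact: (clsZ HC).
rewrite lfunB//; last exact: (clsZ HC).
rewrite (lfunZ H)// lfun_comb; last exact: (clsM HC).
congr (_ - 2 * _ + _).
  by apply: eq_bigr => i _; congr (_ * L _); apply/funext => z; ring.
rewrite lfun_comb; last exact: (clsM HC).
apply: eq_bigr => i _.
rewrite (_ : (fun z => _) = fun z => (\sum_i b i ord0 * tnth z.1 i) * (tnth z.1 i * f z)); last first.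
  by apply/funext => z; rewrite mulrCA.
rewrite lfun_comb ?mulr_sumr; last exact: (clsM HC).
apply: eq_bigr => j _; rewrite -mulrA; congr (_ * _); rewrite mulrC; congr (_ * _).
by congr L; apply/funext => z; ring.
Qed.

Lemma mom_xx_sym : (mom_xx L)^T = mom_xx L.
Proof. by apply/matrixP => i j; rewrite !mxE; congr L; apply/funext => z; rewrite mulrC. Qed.

Lemma mom_xx_quad v :
  qf (mom_xx L) v v = L (fun z => (\sum_i v i ord0 * tnth z.1 i) ^+ 2).
Proof.
rewrite (_ : (fun z => _) = fun z => (0 - \sum_i v i ord0 * tnth z.1 i) ^+ 2 * 1); last first.
  by apply/funext => z; rewrite sub0r sqrrN mulr1.
rewrite (@lfun_sub_comb2 (fun=> 0) (fun=> 1)); try exact: (cls_cst HC).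
rewrite (_ : (fun z => 0 ^+ 2 * 1) = fun=> 0) ?lfun0; last first.
  by apply/funext => z; rewrite expr0n mul0r.
rewrite big1 ?mulr0 ?subr0 ?add0r; last first.
  move=> i _; rewrite (_ : (fun z => _) = fun=> 0) ?lfun0 ?mulr0//.
  by apply/funext => z; rewrite !mul0r.
rewrite qfE; apply: eq_bigr => i _; apply: eq_bigr => j _; rewrite mxE.
by congr (_ * L _ * _); apply/funext => z; rewrite mulr1.
Qed.

Lemma mom_xx_psd : psdmx (mom_xx L).
Proof.
split=> [|v]; first exact: mom_xx_sym.
by rewrite mom_xx_quad; apply: (lfun_ge0 H) => z; rewrite sqr_ge0.
Qed.

Lemma scoreE b : score L b = mom_xy L - mom_xx L *m b.
Proof.
apply/matrixP => i j; rewrite !mxE /residX.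
have Cx := lfun_x H.
rewrite (_ : (fun z => _) = fun z => z.2 * tnth z.1 i - (\sum_k b k ord0 * tnth z.1 k) * tnth z.1 i); last first.
  by apply/funext => z; rewrite mulrBl.
rewrite lfunB; last 2 first.
- by apply: (clsM HC); [exact: (lfun_y H)|].
- by apply: (clsM HC) => //; exact: C_comb.
rewrite lfun_comb//; congr (_ - _); apply: eq_bigr => k _; rewrite !mxE mulrC (ord1 j).
by congr (L _ * _); apply/funext => z; rewrite mulrC.
Qed.

Lemma lfun_resid_shift b h :
  L (fun z => residX (b + h) z ^+ 2) =
  L (fun z => residX b z ^+ 2) - 2 * (h^T *m score L b) ord0 ord0 + qf (mom_xx L) h h.
Proof.
rewrite (_ : (fun z => _) = fun z => (residX b z - \sum_i h i ord0 * tnth z.1 i) ^+ 2 * 1); last first.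
  apply/funext => z; rewrite mulr1 /residX -addrA -opprD -big_split /=.
  by congr ((_ - _) ^+ 2); apply: eq_bigr => i _; rewrite mxE mulrDl.
rewrite lfun_sub_comb2; [|exact: C_resid|exact: (cls_cst HC)].
congr (_ - 2 * _ + _).
- by congr L; apply/funext => z; rewrite mulr1.
- rewrite mxE; apply: eq_bigr => i _; rewrite !mxE; congr (_ * L _).
  by apply/funext => z; rewrite mulr1.
- rewrite qfE; apply: eq_bigr => i _; apply: eq_bigr => j _; rewrite mxE.
  by congr (_ * L _ * _); apply/funext => z; rewrite mulr1.
Qed.

Definition supported P b := emb P *m ((emb P)^T *m b) = b.

Lemma supported_emb P v : supported P (emb P *m v).
Proof. by rewrite /supported (mulmxA (emb P)^T) embK mul1mx. Qed.

Lemma supportedB P b b' : supported P b -> supported P b' -> supported P (b - b').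
Proof. by rewrite /supported !mulmxBr => -> ->. Qed.

Lemma supported_slope P : supported P (slope L P).
Proof. by rewrite /slope /subinv -!mulmxA; exact: supported_emb. Qed.

Lemma supported_setT b : supported [set: 'I_d]%SET b.
Proof. by apply: emb_id => i j; rewrite inE. Qed.

Section nondegenerate.
Hypothesis Qpos : posdefmx (mom_xx L).

Lemma subinv_supported P b : supported P b -> subinv (mom_xx L) P *m (mom_xx L *m b) = b.
Proof. by move=> sb; rewrite -sb !mulmxA subinv_mul_emb// mulmxA. Qed.

Lemma slope_shift P b : supported P b ->
  slope L P - b = subinv (mom_xx L) P *m score L b.
Proof. by move=> sb; rewrite scoreE mulmxBr subinv_supported. Qed.

Lemma slope_score P : (emb P)^T *m score L (slope L P) = 0.
Proof.
rewrite scoreE mulmxBr /slope.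
have := congr1 trmx (subinv_mul_emb Qpos (subxx P)).
rewrite [LHS]trmx_mul [(_ *m mom_xx L)^T]trmx_mul subinv_sym ?mom_xx_sym// => E.
by rewrite (mulmxA (mom_xx L)) (mulmxA (emb P)^T) E subrr.
Qed.

Lemma risk_pythagoras P b : supported P b ->
  L (fun z => residX b z ^+ 2) =
  risk L P + qf (mom_xx L) (b - slope L P) (b - slope L P).
Proof.
move=> sb; rewrite -{1}(subrKC (slope L P) b) lfun_resid_shift.
have sh := supportedB sb (supported_slope P).
by rewrite -{1}sh trmx_mul -mulmxA slope_score mulmx0 mxE mulr0 subr0.
Qed.

Lemma risk_le P b : supported P b -> risk L P <= L (fun z => residX b z ^+ 2).
Proof. by move=> sb; rewrite (risk_pythagoras sb) lerDl; exact: (posdef_psd Qpos).2. Qed.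

Lemma risk_score P b : supported P b ->
  risk L P = L (fun z => residX b z ^+ 2) - qf (subinv (mom_xx L) P) (score L b) (score L b).
Proof.
move=> sb; apply/eqP; rewrite eq_sym subr_eq (risk_pythagoras sb); apply/eqP; congr (_ + _).
have -> : b - slope L P = - (subinv (mom_xx L) P *m score L b).
  by rewrite -slope_shift// opprB.
rewrite qfNl qfNr opprK qf_mulr qf_mull subinv_sym ?mom_xx_sym//.
by rewrite mulmxA subinv_absorbl.
Qed.

Lemma risk_le_setT P : risk L [set: 'I_d]%SET <= risk L P.
Proof. exact: (risk_le (@supported_setT (slope L P))). Qed.

Lemma risk_eq_setT P : risk L P = risk L [set: 'I_d]%SET -> slope L P = slope L [set: 'I_d]%SET.
Proof.
move=> E; apply/eqP; rewrite -subr_eq0; apply/negP => /negP h0.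
have := Qpos.2 _ h0; rewrite -/(qf _ _ _).
have := risk_pythagoras (@supported_setT (slope L P)).
by rewrite -/(risk L P) E => /esym/eqP; rewrite -subr_eq0 addrC addKr => /eqP ->; rewrite ltxx.
Qed.

End nondegenerate.

Lemma wmomE b i j : wmom L b i j =
  L (fun z => z.2 ^+ 2 * (tnth z.1 i * tnth z.1 j))
  - 2 * \sum_k b k ord0 * L (fun z => z.2 * tnth z.1 k * (tnth z.1 i * tnth z.1 j))
  + \sum_k \sum_l b k ord0 * L (fun z => tnth z.1 k * tnth z.1 l * (tnth z.1 i * tnth z.1 j)) * b l ord0.
Proof.
rewrite mxE lfun_sub_comb2//; first exact: (lfun_y H).
by apply: (clsM HC); exact: (lfun_x H).
Qed.

Lemma riskE P : risk L P = L (fun z => z.2 ^+ 2)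
  - 2 * ((slope L P)^T *m mom_xy L) ord0 ord0 + qf (mom_xx L) (slope L P) (slope L P).
Proof.
rewrite /risk -{1}(add0r (slope L P)) lfun_resid_shift scoreE mulmx0 subr0.
congr (L _ - _ + _); apply/funext => z; rewrite /residX big1 ?subr0// => i _.
by rewrite mxE mul0r.
Qed.

Lemma wmom_quad b w : qf (wmom L b) w w =
  L (fun z => residX b z ^+ 2 * (\sum_i w i ord0 * tnth z.1 i) ^+ 2).
Proof.
have Cr := clsX HC 2 (C_resid b).
rewrite (_ : (fun z => _) = fun z => (0 - \sum_i w i ord0 * tnth z.1 i) ^+ 2 * residX b z ^+ 2); last first.
  by apply/funext => z; rewrite sub0r sqrrN mulrC.
rewrite (@lfun_sub_comb2 (fun=> 0)) ?cls_cst//; last exact: (cls_cst HC).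
rewrite (_ : (fun z => 0 ^+ 2 * _) = fun=> 0) ?lfun0; last first.
  by apply/funext => z; rewrite expr0n mul0r.
rewrite big1 ?mulr0 ?subr0 ?add0r; last first.
  move=> i _; rewrite (_ : (fun z => _) = fun=> 0) ?lfun0 ?mulr0//.
  by apply/funext => z; rewrite !mul0r.
rewrite qfE; apply: eq_bigr => i _; apply: eq_bigr => j _; rewrite mxE.
by congr (_ * L _ * _); apply/funext => z; rewrite mulrC.
Qed.

Lemma wmom_sym b : (wmom L b)^T = wmom L b.
Proof.
apply/matrixP => i j; rewrite !mxE; congr L; apply/funext => z.
by rewrite [tnth z.1 j * _]mulrC.
Qed.

Lemma trace_wmom b (A : 'M[R]_d) : \tr (wmom L b *m A) =
  L (fun z => residX b z ^+ 2 * qf A (covX z) (covX z)).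
Proof.
have Cx := lfun_x H; have Cr := clsX HC 2 (C_resid b).
have Cxx i j : C (fun z => residX b z ^+ 2 * (tnth z.1 i * tnth z.1 j)).
  by apply: (clsM HC) => //; exact: (clsM HC).
transitivity (L (fun z => \sum_i \sum_j A j i * (residX b z ^+ 2 * (tnth z.1 i * tnth z.1 j)))).
  rewrite lfun_sum; last by move=> i; apply: (cls_sum HC) => j; exact: (clsZ HC).
  apply: eq_bigr => i _; rewrite lfun_sum; last by move=> j; exact: (clsZ HC).
  by rewrite mxE; apply: eq_bigr => j _; rewrite mxE (lfunZ H)// mulrC.
congr L; apply/funext => z; rewrite qfE exchange_big mulr_sumr; apply: eq_bigr => i _.
rewrite mulr_sumr; apply: eq_bigr => j _; rewrite !mxE; ring.
Qed.

End lfun_theory.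
End moment_functionals.

Section lfun_penalty.
Context {R : realType} {d : nat}.
Variables (C : (obs R d -> R) -> Prop) (L : (obs R d -> R) -> R) (H : lfun C L).
Hypothesis Qpos : posdefmx (mom_xx L).
Implicit Types (P : {set 'I_d}).
Let HC := lfun_ring H.

Lemma lfun_le f g : C f -> C g -> (forall z, f z <= g z) -> L f <= L g.
Proof.
move=> Cf Cg fg; rewrite -subr_ge0 -(lfunB H)//; apply: (lfun_ge0 H) => z.
by rewrite subr_ge0.
Qed.

Lemma clsmx_covX : clsmx C (covX : obs R d -> _).
Proof. by move=> i j; apply: eq_cls (lfun_x H i) => z; rewrite mxE. Qed.

Lemma penalty_lt P0 P : P0 \proper P -> slope L P = slope L P0 ->
  posdefmx (subgram (wmom L (slope L P)) P) -> penalty L P0 < penalty L P.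
Proof.
move=> P0P sE Wpos; have sP := proper_sub P0P.
pose M := subinvB (mom_xx L) P P0.
have Mpsd : psdmx M by exact: subinvB_psd.
rewrite -subr_gt0 [X in _ - X]/penalty -sE.
have -> : penalty L P - \tr (wmom L (slope L P) *m subinv (mom_xx L) P0) = \tr (wmom L (slope L P) *m M).
  by rewrite /M /subinvB mulmxBr linearB.
have [v [w w0 MvE]] := subinvB_neq0 Qpos P0P.
have : 0 < qf (wmom L (slope L P)) (M *m v) (M *m v).
  rewrite MvE; have := Wpos.2 _ w0.
  by rewrite /qf /subgram trmx_mul !mulmxA.
rewrite (wmom_quad H).
have CM : C (fun z => residX (slope L P) z ^+ 2 * qf M (covX z) (covX z)).
  apply: (clsM HC); first exact: (clsX HC 2 (C_resid H _)).
  by apply: (cls_qf HC); [exact: clsmx_cst|exact: clsmx_covX|exact: clsmx_covX].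
have le1 : L (fun z => residX (slope L P) z ^+ 2 * (\sum_i (M *m v) i ord0 * tnth z.1 i) ^+ 2)
   <= qf M v v * \tr (wmom L (slope L P) *m M).
  rewrite (trace_wmom H) -(lfunZ H)//.
  apply: lfun_le => [||z].
  - apply: (clsM HC); first exact: (clsX HC 2 (C_resid H _)).
    by apply: (clsX HC); exact: (C_comb H).
  - exact: (clsZ HC).
  - rewrite [X in _ <= X]mulrCA; apply: ler_wpM2l; first exact: sqr_ge0.
    rewrite (_ : \sum_i _ = qf M v (covX z)); first exact: psd_cauchy.
    rewrite /qf -[X in _ *m X *m _](Mpsd.1) -trmx_mul mxE.
    by apply: eq_bigr => i _; congr (_ * _); rewrite [RHS]mxE.
move=> gt0; have := lt_le_trans gt0 le1 => {gt0 le1}.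
have := Mpsd.2 v; rewrite le_eqVlt => /predU1P[<-|vv]; first by rewrite mul0r ltxx.
by rewrite pmulr_rgt0.
Qed.

End lfun_penalty.

Section lfun_class.
Context {R : realType} {d : nat} (W : Type) (cls : (W -> R) -> Prop) (HC : ring_class cls).
Variables (C : W -> (obs R d -> R) -> Prop) (L : W -> (obs R d -> R) -> R).
Hypothesis HL : forall w, lfun (C w) (L w).
Hypothesis mono_cls : forall q, cls (fun w => L w (monomial q)).
Hypothesis inv_cls : forall P : {set 'I_d}, clsmx cls (fun w => invmx (subgram (mom_xx (L w)) P)).

Let y : option (option 'I_d) := Some None.
Let x i : option (option 'I_d) := Some (Some i).

Lemma cls_L4 a b c e (f : obs R d -> R) :
  (forall z, f z = obs_var a z * obs_var b z * obs_var c z * obs_var e z) ->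
  cls (fun w => L w f).
Proof. by move=> fE; apply: eq_cls (mono_cls (a, b, c, e)) => w; congr (L w); apply/funext => z. Qed.

Lemma clsmx_mom_xx : clsmx cls (fun w => mom_xx (L w)).
Proof.
move=> i j; apply: eq_cls (@cls_L4 (x i) (x j) None None _ (fun=> erefl)) => w.
by rewrite mxE; congr (L w); apply/funext => z /=; rewrite !mulr1.
Qed.

Lemma clsmx_mom_xy : clsmx cls (fun w => mom_xy (L w)).
Proof.
move=> i j; apply: eq_cls (@cls_L4 y (x i) None None _ (fun=> erefl)) => w.
by rewrite mxE; congr (L w); apply/funext => z /=; rewrite !mulr1.
Qed.

Lemma clsmx_subinv P : clsmx cls (fun w => subinv (mom_xx (L w)) P).
Proof.
by apply: clsmxM => //; [apply: clsmxM => //|]; exact: clsmx_cst.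
Qed.

Lemma clsmx_slope P : clsmx cls (fun w => slope (L w) P).
Proof. by apply: clsmxM => //; [exact: clsmx_subinv|exact: clsmx_mom_xy]. Qed.

Lemma cls_risk P : cls (fun w => risk (L w) P).
Proof.
have cs := clsmx_slope P.
apply: (@eq_cls _ _ _ (fun w => L w (fun z => z.2 ^+ 2)
  - 2 * ((slope (L w) P)^T *m mom_xy (L w)) ord0 ord0 + qf (mom_xx (L w)) (slope (L w) P) (slope (L w) P))).
  by move=> w; rewrite (riskE (HL w)).
apply: (clsD HC); last by apply: cls_qf => //; exact: clsmx_mom_xx.
apply: (clsB HC).
  by apply: (@cls_L4 y y None None) => z /=; rewrite !mulr1.
apply: (clsZ HC); apply: clsmxM => //; first exact: clsmxT.
exact: clsmx_mom_xy.
Qed.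

Lemma clsmx_wmom (b : W -> 'cV[R]_d) : clsmx cls b -> clsmx cls (fun w => wmom (L w) (b w)).
Proof.
move=> cb i j; apply: (@eq_cls _ _ _ (fun w =>
  L w (fun z => z.2 ^+ 2 * (tnth z.1 i * tnth z.1 j))
  - 2 * \sum_k b w k ord0 * L w (fun z => z.2 * tnth z.1 k * (tnth z.1 i * tnth z.1 j))
  + \sum_k \sum_l b w k ord0 * L w (fun z => tnth z.1 k * tnth z.1 l * (tnth z.1 i * tnth z.1 j)) * b w l ord0)).
  by move=> w; rewrite (wmomE (HL w)).
apply: (clsD HC); first apply: (clsB HC).
- by apply: (@cls_L4 y y (x i) (x j)) => z /=; ring.
- apply: (clsZ HC); apply: cls_sum => // k; apply: (clsM HC) => //.
  by apply: (@cls_L4 y (x k) (x i) (x j)) => z /=; ring.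
- apply: cls_sum => // k; apply: cls_sum => // l.
  do 2 apply: (clsM HC) => //.
  by apply: (@cls_L4 (x k) (x l) (x i) (x j)) => z /=; ring.
Qed.

Lemma cls_penalty P : cls (fun w => penalty (L w) P).
Proof.
apply: cls_trace => //; apply: clsmxM => //; last exact: clsmx_subinv.
exact: clsmx_wmom (clsmx_slope P).
Qed.

End lfun_class.

Section link_population.
Context {R : realType} {d : nat} (D : probability (obs R d) R).
Implicit Types (P : {set 'I_d}).

Lemma lfun_EX : mom D snd -> (forall i, mom D (fun z => tnth z.1 i)) ->
  lfun (fun f => mom D f) (EX D).
Proof.
move=> my mx; split=> //.
- split=> [c|f g|f g]; [exact: mom_cst|exact: ubmD|exact: ubmM].
- by move=> f g; exact: EX_D.
- by move=> a f; exact: EX_Z.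
- by move=> f; exact: EX_ge0.
Qed.

Lemma subcovE P (z : obs R d) : subcov P z = (emb P)^T *m covX z.
Proof. by apply/matrixP => k j; rewrite tr_emb_mul !mxE. Qed.

Lemma residE P b (z : obs R d) : resid (P := P) b z = residX (emb P *m b) z.
Proof.
rewrite /resid /residX subcovE trmx_mul trmxK -mulmxA mxE; congr (_ - _).
by apply: eq_bigr => i _; rewrite !mxE mulrC.
Qed.

Lemma QmxE P : Qmx D P = subgram (mom_xx (EX D)) P.
Proof.
apply/matrixP => k l; rewrite subgramE !mxE; congr (EX D); apply/funext => z.
by rewrite mxE big_ord1 !mxE.
Qed.

Lemma beta_slope P : emb P *m beta D P = slope (EX D) P.
Proof.
rewrite /beta /slope /subinv QmxE !mulmxA -!(mulmxA _ (emb P)^T); congr (_ *m _).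
apply/matrixP => k j; rewrite tr_emb_mul !mxE; congr (EX D); apply/funext => z.
by rewrite !mxE.
Qed.

Lemma WmxE P : Wmx D P = subgram (wmom (EX D) (slope (EX D) P)) P.
Proof.
apply/matrixP => k l; rewrite subgramE !mxE; congr (EX D); apply/funext => z.
by rewrite residE beta_slope mxE; congr (_ * _); rewrite mxE big_ord1 !mxE.
Qed.

Lemma trace_subinv n (A : 'M[R]_d) (B : 'M[R]_n) (E : 'M[R]_(d, n)) :
  \tr (E^T *m A *m E *m B) = \tr (A *m (E *m B *m E^T)).
Proof. by rewrite (mulmxA A) [RHS]mxtrace_mulC !mulmxA. Qed.

Lemma VmxE P : \tr (Vmx D P) = penalty (EX D) P.
Proof. by rewrite /Vmx WmxE QmxE trace_subinv. Qed.

End link_population.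

Section link_sample.
Context {R : realType} {d : nat}.
Implicit Types (P : {set 'I_d}) (s : seq (obs R d)).

Definition emp s (f : obs R d -> R) : R := (size s)%:R^-1 * \sum_(z <- s) f z.

Lemma lfun_emp s : lfun (fun=> True) (emp s).
Proof.
split=> //.
- by move=> f g _ _; rewrite /emp big_split mulrDr.
- by move=> a f _; rewrite /emp -mulr_sumr mulrCA.
- by move=> f f0; rewrite /emp mulr_ge0 ?invr_ge0// sumr_ge0.
Qed.

Lemma QhatE P s : Qhat P s = subgram (mom_xx (emp s)) P.
Proof.
apply/matrixP => k l; rewrite subgramE !mxE; congr (_ * _).
by rewrite [RHS]big_tnth; apply: eq_bigr => i _; rewrite !mxE.
Qed.

Lemma gramE P s : (0 < size s)%N -> gram P s = (size s)%:R *: subgram (mom_xx (emp s)) P.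
Proof.
by move=> s0; rewrite -QhatE /Qhat scalerA mulfV ?scale1r// pnatr_eq0 -lt0n.
Qed.

Lemma gram_unit P s : (0 < size s)%N ->
  (gram P s \in unitmx) = (subgram (mom_xx (emp s)) P \in unitmx).
Proof.
by move=> s0; rewrite gramE// unitmxZ// unitfE pnatr_eq0 -lt0n.
Qed.

Lemma olsE P s : (0 < size s)%N -> ols P s =
  invmx ((size s)%:R *: subgram (mom_xx (emp s)) P) *m
  ((size s)%:R *: ((emb P)^T *m mom_xy (emp s))).
Proof.
move=> s0; rewrite /ols -mulmxA gramE//; congr (_ *m _).
apply/matrixP => k j; rewrite [RHS]mxE tr_emb_mul mxE [in RHS]mxE /emp.
rewrite mulVKf ?pnatr_eq0 -?lt0n//.
by rewrite [RHS]big_tnth; apply: eq_bigr => i _; rewrite !mxE mulrC.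
Qed.

Section invertible.
Variables (P : {set 'I_d}) (s : seq (obs R d)).
Hypothesis s0 : (0 < size s)%N.
Hypothesis gU : gram P s \in unitmx.

Lemma ols_slope : emb P *m ols P s = slope (emp s) P.
Proof.
have sn0 : ((size s)%:R : R) != 0 by rewrite pnatr_eq0 -lt0n.
have sU : ((size s)%:R : R) \is a GRing.unit by rewrite unitfE.
have subU : subgram (mom_xx (emp s)) P \in unitmx by rewrite -gram_unit.
rewrite olsE// /slope /subinv -!mulmxA.
rewrite invmxZ; last by rewrite unitmxZ.
by congr (_ *m _); rewrite -scalemxAl -scalemxAr scalerA mulVf// scale1r.
Qed.

Lemma penalty_emp : \tr (Vhat P s) = penalty (emp s) P.
Proof.
rewrite /Vhat QhatE; have -> : What P s = subgram (wmom (emp s) (slope (emp s) P)) P.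
  apply/matrixP => k l; rewrite subgramE !mxE; congr (_ * _).
  rewrite summxE; apply: eq_bigr => z _.
  by rewrite mxE residE ols_slope; congr (_ * _); rewrite mxE big_ord1 !mxE.
exact: trace_subinv.
Qed.

Lemma risk_emp : (size s)%:R^-1 * sqnorm (response s - design P s *m ols P s) = risk (emp s) P.
Proof.
rewrite /risk /emp; congr (_ * _); rewrite /sqnorm [RHS]big_tnth; apply: eq_bigr => i _.
rewrite -ols_slope -residE; congr (_ ^+ 2); rewrite /resid !mxE; congr (_ - _).
by apply: eq_bigr => k _; rewrite !mxE.
Qed.

End invertible.
End link_sample.

(** * Uniform consistency of smooth functions of the moments *)

Section approximation.
Context {R : realType} {d : nat} (I : Type) (D : I -> probability (obs R d) R).
Implicit Types (P : {set 'I_d}) (t : I) (s : seq (obs R d)).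

Definition moments_close (e : R) t s :=
  forall q, `|emp s (monomial q) - EX (D t) (monomial q)| <= e.

Lemma close_le e e' t s : e <= e' -> moments_close e t s -> moments_close e' t s.
Proof. by move=> ee ce q; exact: le_trans (ce q) ee. Qed.

(* A function of [(u, b)] is seen as a pair: the sample version ([b = true])
   and the population version ([b = false]) of the same quantity. *)
Definition consistent (f : (I * seq (obs R d)) * bool -> R) :=
  (exists B, forall u, `|f (u, false)| <= B) /\
  forall e : R, 0 < e -> exists2 r : R, 0 < r &
    forall t s, moments_close r t s -> `|f ((t, s), true) - f ((t, s), false)| <= e.

Lemma consistent_ring_class : ring_class consistent.
Proof.
split=> [c|f g [[B HB] cf] [[B' HB'] cg]|f g [[B HB] cf] [[B' HB'] cg]].
- split; first by exists `|c|.
  by move=> e e0; exists 1 => // t s _; rewrite subrr normr0 ltW.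
- split; first by exists (B + B') => u; rewrite (le_trans (ler_normD _ _))// lerD.
  move=> e e0; have e20 : 0 < e / 2 by rewrite divr_gt0.
  have [r r0 Hr] := cf _ e20; have [r' r0' Hr'] := cg _ e20.
  exists (Num.min r r'); first by rewrite lt_min r0.
  move=> t s cl.
  have := Hr t s (close_le _ cl); rewrite ge_min lexx => /(_ isT) H1.
  have := Hr' t s (close_le _ cl); rewrite ge_min lexx orbT => /(_ isT) H2.
  rewrite opprD addrACA (le_trans (ler_normD _ _))// [e]splitr lerD//.
- split; first by exists (B * B') => u; rewrite normrM ler_pM.
  move=> e e0.
  pose c := `|B| + `|B'| + 1.
  have c0 : 0 < c by rewrite /c ltr_wpDl ?addr_ge0.
  pose e1 := Num.min 1 (e / c).
  have e10 : 0 < e1 by rewrite lt_min ltr01 divr_gt0.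
  have [r r0 Hr] := cf _ e10; have [r' r0' Hr'] := cg _ e10.
  exists (Num.min r r'); first by rewrite lt_min r0.
  move=> t s cl.
  have := Hr t s (close_le _ cl); rewrite ge_min lexx => /(_ isT) H1.
  have := Hr' t s (close_le _ cl); rewrite ge_min lexx orbT => /(_ isT) H2.
  set fh := f (_, true) in H1 *; set f0 := f (_, false) in H1 *.
  set gh := g (_, true) in H2 *; set g0 := g (_, false) in H2 *.
  have F0 : `|f0| <= `|B| by rewrite (le_trans (HB _)) ?ler_norm.
  have G0 : `|g0| <= `|B'| by rewrite (le_trans (HB' _)) ?ler_norm.
  have -> : fh * gh - f0 * g0 = (fh - f0) * (gh - g0) + (fh - f0) * g0 + f0 * (gh - g0) by ring.
  have e1c : e1 * c <= e by rewrite -ler_pdivlMr// ge_min lexx orbT.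
  have e11 : e1 <= 1 by rewrite ge_min lexx.
  apply: (le_trans (ler_normD _ _)); rewrite !normrM.
  apply: (@le_trans _ _ (e1 * 1 + e1 * `|B'| + `|B| * e1)); last by apply: le_trans e1c; rewrite /c; lra.
  apply: lerD; last by rewrite ler_pM.
  apply: (le_trans (ler_normD _ _)); rewrite !normrM lerD// ler_pM//.
  exact: le_trans H2 e11.
Qed.

Lemma consistent_congr f g r : 0 < r -> consistent f ->
  (forall u, f (u, false) = g (u, false)) ->
  (forall t s, moments_close r t s -> f ((t, s), true) = g ((t, s), true)) -> consistent g.
Proof.
move=> r0 [[B HB] cf] E0 E1; split; first by exists B => u; rewrite -E0.
move=> e e0; have [r' r0' Hr'] := cf _ e0.
exists (Num.min r r'); first by rewrite lt_min r0.
move=> t s cl.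
have := Hr' t s (close_le _ cl); rewrite ge_min lexx orbT => /(_ isT).
by rewrite E0 E1//; apply: close_le cl; rewrite ge_min lexx.
Qed.

Lemma consistent_bounded_away f (B : R) : 0 < B -> consistent f ->
  (forall u, f (u, false) != 0 /\ `|(f (u, false))^-1| <= B) ->
  exists2 r : R, 0 < r & forall t s, moments_close r t s -> (2 * B)^-1 <= `|f ((t, s), true)|.
Proof.
move=> B0 [_ cf] fB.
have iB0 : 0 < (2 * B)^-1 by rewrite invr_gt0 mulr_gt0.
have [r r0 Hr] := cf _ iB0; exists r => // t s /Hr H.
have [f0] := fB (t, s); rewrite normfV -[leRHS]invrK lef_pV2 ?posrE ?invr_gt0 ?normr_gt0// => H'.
have := ler_normB (f ((t, s), true)) (f ((t, s), true) - f ((t, s), false)).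
rewrite subKr => H2.
have -> : (2 * B)^-1 = B^-1 - (2 * B)^-1 by field; rewrite gt_eqF.
lra.
Qed.

Lemma consistent_inv f (B : R) : 0 < B -> consistent f ->
  (forall u, f (u, false) != 0 /\ `|(f (u, false))^-1| <= B) ->
  consistent (fun w => (f w)^-1).
Proof.
move=> B0 cf fB; have [r r0 Hr] := consistent_bounded_away B0 cf fB.
split; first by exists B => u; have [] := fB u.
move=> e e0.
have e'0 : 0 < e / (2 * B * B) by rewrite divr_gt0// !mulr_gt0.
have [r' r0' Hr'] := cf.2 _ e'0.
exists (Num.min r r'); first by rewrite lt_min r0.
move=> t s cl.
have := Hr t s (close_le _ cl); rewrite ge_min lexx => /(_ isT) H1.
have := Hr' t s (close_le _ cl); rewrite ge_min lexx orbT => /(_ isT) H2.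
have [f0 fB0] := fB (t, s).
have iB0 : 0 < (2 * B)^-1 by rewrite invr_gt0 mulr_gt0.
have fh0 : f ((t, s), true) != 0 by rewrite -normr_gt0 (lt_le_trans iB0).
have -> : (f ((t, s), true))^-1 - (f ((t, s), false))^-1 =
  (f ((t, s), true))^-1 * (f ((t, s), false))^-1 * - (f ((t, s), true) - f ((t, s), false)).
  by field; rewrite fh0 f0.
rewrite !normrM normrN.
apply: (@le_trans _ _ ((2 * B) * B * (e / (2 * B * B)))).
  apply: ler_pM => //.
  apply: ler_pM => //.
  by rewrite normfV -[leRHS]invrK lef_pV2 ?posrE ?normr_gt0.
by rewrite mulrC divfK// !mulf_neq0// gt_eqF.
Qed.

Variables (B : R).
Hypothesis Dy : ubm D (fun=> snd).
Hypothesis Dx : forall i, ubm D (fun _ z => tnth z.1 i).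
Hypothesis Qpos : forall t, posdefmx (mom_xx (EX (D t))).
Hypothesis QinvB : forall t P i j, `|invmx (subgram (mom_xx (EX (D t))) P) i j| <= B.

Definition functional_of (w : (I * seq (obs R d)) * bool) : (obs R d -> R) -> R :=
  if w.2 then emp w.1.2 else EX (D w.1.1).

Lemma lfun_functional_of w : exists C, lfun C (functional_of w).
Proof.
rewrite /functional_of; case: w => -[t s] [] /=; first by exists (fun=> True); exact: lfun_emp.
exists (fun f => mom (D t) f); apply: lfun_EX; first exact: (ubm_at t Dy).
by move=> i; exact: (ubm_at t (Dx i)).
Qed.

Lemma ubm_obs_var v : ubm D (fun _ => obs_var v).
Proof. by case: v => [[i|]|]; [exact: Dx|exact: Dy|exact: (ubm_constant D 1)]. Qed.

Lemma ubm_monomial q : ubm D (fun _ => monomial q).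
Proof.
have u v := ubm_obs_var v.
exact: (ubmM (ubmM (ubmM (u q.1.1.1) (u q.1.1.2)) (u q.1.2)) (u q.2)).
Qed.

Lemma consistent_monomial q : consistent (fun w => functional_of w (monomial q)).
Proof.
split=> [|e e0]; last by exists e => // t s; exact.
by have [b Hb] := ubm_EX_bound (ubm_monomial q); exists b => -[t s]; exact: Hb.
Qed.

Lemma consistent_mom_xx : clsmx consistent (fun w => mom_xx (functional_of w)).
Proof. exact: clsmx_mom_xx consistent_monomial. Qed.

Lemma consistent_det P :
  consistent (fun w => \det (subgram (mom_xx (functional_of w)) P)).
Proof.
apply: (cls_det consistent_ring_class).
by apply: clsmxM; [exact: consistent_ring_class|apply: clsmxM|]; try
  exact: (clsmx_cst consistent_ring_class); [exact: consistent_ring_class|exact: consistent_mom_xx].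
Qed.

Lemma subgram_unit t P : subgram (mom_xx (EX (D t))) P \in unitmx.
Proof. by apply: posdef_unit; exact: subgram_posdef. Qed.

Lemma bounded_det P : exists2 b : R, 0 < b & forall u,
  \det (subgram (mom_xx (functional_of (u, false))) P) != 0 /\
  `|(\det (subgram (mom_xx (functional_of (u, false))) P))^-1| <= b.
Proof.
pose cls (f : I -> R) := exists b : R, forall t, `|f t| <= b.
have Hc : ring_class cls.
  split=> [c|f g [b Hb] [b' Hb']|f g [b Hb] [b' Hb']].
  - by exists `|c|.
  - by exists (b + b') => u; rewrite (le_trans (ler_normD _ _))// lerD.
  - by exists (b * b') => u; rewrite normrM ler_pM.
have : cls (fun t => \det (invmx (subgram (mom_xx (EX (D t))) P))).
  by apply: (cls_det Hc) => i j; exists B => t.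
move=> [b Hb]; exists (`|b| + 1); first by rewrite ltr_wpDl.
move=> [t s]; have := subgram_unit t P; rewrite unitmxE unitfE => u0; split=> //.
rewrite /functional_of /= -det_inv.
by apply: (le_trans (Hb t)); apply: (le_trans (ler_norm b)); rewrite lerDl ler01.
Qed.

Lemma close_unit P : exists2 r : R, 0 < r & forall t s, moments_close r t s ->
  subgram (mom_xx (emp s)) P \in unitmx.
Proof.
have [b b0 Hb] := bounded_det P.
have [r r0 Hr] := consistent_bounded_away b0 (consistent_det P) Hb.
exists r => // t s /Hr; rewrite unitmxE unitfE -normr_gt0; apply: lt_le_trans.
by rewrite invr_gt0 mulr_gt0.
Qed.

Lemma consistent_invmx P :
  clsmx consistent (fun w => invmx (subgram (mom_xx (functional_of w)) P)).
Proof.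
move=> i j; have [r r0 Hr] := close_unit P.
apply: (@consistent_congr (fun w => cramer (subgram (mom_xx (functional_of w)) P) i j) _ r) => //.
- have [b b0 Hb] := bounded_det P.
  apply: (clsmx_cramer consistent_ring_class); last exact: consistent_inv (consistent_det P) Hb.
  by apply: clsmxM; [exact: consistent_ring_class|apply: clsmxM|]; try
    exact: (clsmx_cst consistent_ring_class); [exact: consistent_ring_class|exact: consistent_mom_xx].
- by move=> [t s]; rewrite cramerE//; exact: subgram_unit.
- by move=> t s /Hr H; rewrite cramerE.
Qed.

Lemma consistent_risk P : consistent (fun w => risk (functional_of w) P).
Proof.
have /choice [C HC] := lfun_functional_of.
exact: (cls_risk consistent_ring_class HC consistent_monomial consistent_invmx).
Qed.

Lemma consistent_penalty P : consistent (fun w => penalty (functional_of w) P).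
Proof.
have /choice [C HC] := lfun_functional_of.
exact: (cls_penalty consistent_ring_class HC consistent_monomial consistent_invmx).
Qed.

Lemma consistent_subinv P : clsmx consistent (fun w => subinv (mom_xx (functional_of w)) P).
Proof. exact: (clsmx_subinv consistent_ring_class consistent_invmx). Qed.

End approximation.

Section expectation_kernel.
Context {R : realType} dT (I : measurableType dT) d (T : measurableType d)
  (D : I -> probability T R).
Hypothesis D_measurable : forall A, measurable A -> measurable_fun setT (fun t => D t A).

Lemma measurable_EX (f : T -> R) : measurable_fun setT f ->
  measurable_fun setT (fun t => EX (D t) f).
Proof.
move=> mf.
have mE : measurable_fun setT (EFin \o f) by exact/measurable_EFinP.
rewrite /EX /Rintegral.
rewrite (_ : (fun t => _) = fine \o
  (fun t => \int[D t]_x (EFin \o f)^\+ x - \int[D t]_x (EFin \o f)^\- x)%E); last first.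
  by apply/funext => t /=; rewrite integralE.
apply: measurableT_comp => //; apply: emeasurable_funB.
- apply: measurable_fun_integral_kernel => //; exact: measurable_funepos.
- apply: measurable_fun_integral_kernel => //; exact: measurable_funeneg.
Qed.

End expectation_kernel.

Section sample_averages.
Context {R : realType} {d : nat} (I : Type) (D : I -> probability (obs R d) R).

Lemma size_take_tuple (T : Type) N M (x : M.-tuple T) : size (take N x) = (\sum_(i < M) (i < N))%N.
Proof.
rewrite size_take_min size_tuple; elim: M N {x} => [|M IH] N.
  by rewrite minn0 big_ord0.
case: N => [|N]; first by rewrite min0n big1.
by rewrite minnSS IH big_ord_recl.
Qed.

Lemma sum_take (T : Type) N M (x : M.-tuple T) (f : T -> R) :
  \sum_(z <- take N x) f z = \sum_(i < M | (i < N)%N) f (tnth x i).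
Proof.
elim: M N x => [|M IH] N x.
  by rewrite (tuple0 x) /= big_nil big_ord0.
case: N => [|N]; first by rewrite take0 big_nil big_pred0.
rewrite (tuple_eta x) /= big_cons (IH N [tuple of behead x]) big_mkcond [RHS]big_mkcond.
rewrite big_ord_recl /=; congr (_ + _); apply: eq_bigr => i _.
by rewrite ltnS; case: ifP => // _; rewrite tnthS.
Qed.

Lemma emp_tsum N M (x : M.-tuple (obs R d)) f :
  emp (take N x) f = (\sum_(i < M) (i < N))%N%:R^-1 * tsum (fun i : 'I_M => (i < N)%N) (fun=> f) x.
Proof. by rewrite /emp sum_take size_take_tuple. Qed.

Lemma mom_emp t N M f : mom (D t) f -> mom (iid M (D t)) (fun x => emp (take N x) f).
Proof.
move=> mf; have mS := @mom_tsum _ _ _ M (fun=> D t) (fun i => i < N)%N (fun=> f) (fun _ _ => mf).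
apply: eq_ubm (ubmM (mom_cst (iid M (D t)) (\sum_(i < M) (i < N))%N%:R^-1) mS) => _ x.
by rewrite emp_tsum.
Qed.

Lemma EX_emp t M f : (0 < M)%N -> mom (D t) f ->
  EX (iid M (D t)) (fun x => emp x f) = EX (D t) f.
Proof.
move=> M0 mf; have mS := @mom_tsum _ _ _ M (fun=> D t) predT (fun=> f) (fun _ _ => mf).
rewrite (_ : (fun x => _) = fun x => M%:R^-1 * tsum predT (fun=> f) x); last first.
  apply/funext => x; rewrite /emp size_tuple /tsum; congr (_ * _).
  by rewrite big_tuple.
rewrite EX_Z// EX_tsum//= sumr_const card_ord -[X in _ * X]mulr_natl mulrA mulVf ?mul1r//.
by rewrite pnatr_eq0 -lt0n.
Qed.

Lemma ubm_emp (f : I -> obs R d -> R) : ubm D f ->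
  ubm (fun i : I * nat * nat => iid i.2 (D i.1.1))
    (fun i x => Num.sqrt (size (take i.1.2 x))%:R *
       (emp (take i.1.2 x) (f i.1.1) - EX (D i.1.1) (f i.1.1))).
Proof.
move=> uf; have mf t := ubm_at t uf.
have [B HB] := ubm_EX_bound uf.
pose g t z := f t z - EX (D t) (f t).
have uc : ubm D (fun t _ => EX (D t) (f t)) by apply: ubm_cst HB.
have ug : ubm D g by exact: ubmB.
have g0 t : EX (D t) (g t) = 0.
  by rewrite EX_B//; [rewrite EX_cst subrr|exact: mom_cst].
have := @ubm_nsum R (I * nat * nat)%type _ (fun _ => obs R d) (fun i => i.2)
  (fun i _ => D i.1.1) (fun i j => (j < i.1.2)%N) (fun i _ => g i.1.1).
move=> /(_ (fun i _ _ => ug.1 i.1.1)) H.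
apply: eq_ubm (H _ (fun i _ _ => g0 i.1.1)); last first.
  by move=> k; have [b Hb] := ug.2 k; exists b.
move=> [[t N] M] /= x; rewrite size_take_tuple emp_tsum /tsum /g.
set c := (\sum_(i < M) _)%N; rewrite sumrB sumr_const.
have -> : #|[pred i : 'I_M | (i < N)%N]| = c by rewrite -sum1_card big_mkcond.
have [->|c0] := posnP c; first by rewrite sqrtr0 invr0 !mul0r.
rewrite -[EX _ _ *+ c]mulr_natl.
have s0 : Num.sqrt c%:R != 0 :> R by rewrite sqrtr_eq0 -ltNge ltr0n.
have cE : (c%:R : R) = Num.sqrt c%:R ^+ 2 by rewrite sqr_sqrtr.
by move: (Num.sqrt c%:R) s0 cE => a a0 ->; field.
Qed.

Lemma EX_emp2 t M f g : (0 < M)%N -> mom (D t) f -> mom (D t) g ->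
  EX (D t) f = 0 -> EX (D t) g = 0 -> forall N,
  EX (iid M (D t)) (fun x => (size (take N x))%:R * (emp (take N x) f * emp (take N x) g))
  = (minn N M != 0%N)%:R * EX (D t) (fun z => f z * g z).
Proof.
move=> M0 mf mg f0 g0 N.
pose c : R := (\sum_(i < M) (i < N))%N%:R.
have H := @EX_tsum2 R _ _ M (fun=> D t) (fun i => i < N)%N (fun=> f) (fun=> g)
  (fun _ _ => mf) (fun _ _ => mg) (fun _ _ => f0) (fun _ _ => g0).
have mS h : mom (D t) h -> mom (iid M (D t)) (tsum (fun i : 'I_M => (i < N)%N) (fun=> h)).
  by move=> mh; apply: mom_tsum.
rewrite (_ : (fun x => _) = fun x => c^-1 * (tsum (fun i : 'I_M => (i < N)%N) (fun=> f) x * tsum (fun i : 'I_M => (i < N)%N) (fun=> g) x)); last first.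
  apply/funext => x; rewrite !emp_tsum size_take_tuple -/c.
  have [->|c0] := eqVneq c 0; first by rewrite invr0 !mul0r.
  by field.
rewrite EX_Z; last exact: (ubmM (mS _ mf) (mS _ mg)).
rewrite [X in _ * X]H sumr_const -[X in _ * X]mulr_natl mulrA; congr (_ * _).
have -> : #|[pred i : 'I_M | (i < N)%N]| = (\sum_(i < M) (i < N))%N by rewrite -sum1_card big_mkcond.
have E : (\sum_(i < M) (i < N))%N = minn N M.
  by rewrite -(size_take_tuple N (nseq_tuple M (0%N))) size_take_min size_tuple.
rewrite /c E; case: eqP => [->|/eqP c0]; first by rewrite mulr0.
by rewrite mulVf// pnatr_eq0.
Qed.

End sample_averages.

Section almost_everywhere_expectation.
Context {R : realType} d (T : measurableType d) (mu : probability T R).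

Lemma mom_bounded f : bounded_measurable f -> mom mu f.
Proof.
move=> [mf [B HB]]; split=> // k; exists (B ^+ k) => _.
apply: (@le_trans _ _ (\int[mu]_x (B ^+ k)%:E)%E).
  apply: le_nnintegral => x; rewrite lee_fin ?exprn_ge0//.
  by rewrite lerXn2r ?nnegrE// (le_trans _ (HB x)).
by rewrite integral_cst//= probability_setT mule1.
Qed.

Lemma EX_ae_eq f g : mom mu f -> mom mu g -> {ae mu, forall x, f x = g x} ->
  EX mu f = EX mu g.
Proof.
move=> mf mg fg; rewrite /EX /Rintegral; congr fine; apply: ae_eq_integral => //.
- by apply/measurable_EFinP; exact: (mom_measurable mf).
- by apply/measurable_EFinP; exact: (mom_measurable mg).
- by apply: filterS fg => x fgx _; rewrite fgx.
Qed.

Lemma EX_eq0 f : mom mu f -> {ae mu, forall x, 0 <= f x} -> EX mu f = 0 ->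
  {ae mu, forall x, f x = 0}.
Proof.
move=> mf f0 Ef; have mn := ubm_norm mf.
have : (\int[mu]_x `|(EFin \o f) x| = 0)%E.
  rewrite (_ : (fun x => _) = fun x => (`|f x|)%:E)//.
  rewrite (@EXE _ _ _ _ (fun x => `|f x|))// (EX_ae_eq mn mf) ?Ef//.
  by apply: filterS f0 => x fx; rewrite ger0_norm.
move/ae_eq_integral_abs => /(_ measurableT); case.
  by apply/measurable_EFinP; exact: (mom_measurable mf).
move=> N NP; exists N; case: NP => mN N0 H; split=> // x /= fx; apply: H => /=.
by move=> Hx; apply: fx; have /= [] := Hx I.
Qed.

Lemma ae_not_false : ~ {ae mu, forall x, False}.
Proof.
move=> [N [mN N0 H]]; have := @probability_setT _ _ _ mu.
have -> : setT = N by apply/seteqP; split=> // x _; exact: H.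
by rewrite N0 => /esym/eqP; rewrite onee_eq0.
Qed.

Lemma EX_gt0 f : mom mu f -> {ae mu, forall x, 0 < f x} -> 0 < EX mu f.
Proof.
move=> mf f0.
have f0' : {ae mu, forall x, 0 <= f x} by apply: filterS f0 => x /ltW.
have mn := ubm_norm mf.
have Enn : EX mu f = EX mu (fun x => `|f x|).
  by apply: EX_ae_eq => //; apply: filterS f0' => x fx; rewrite ger0_norm.
rewrite lt_neqAle eq_sym; apply/andP; split; last by rewrite Enn EX_ge0.
apply/eqP => /(EX_eq0 mf f0') E0; apply: ae_not_false.
by apply: filterS2 f0 E0 => x + fx; rewrite fx ltxx.
Qed.

End almost_everywhere_expectation.

Section argmin_expansion.
Context {R : realType} {d : nat}.
Variables (a b : {set 'I_d} -> R) (P0 : {set 'I_d}).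
Hypothesis a_ge : forall P, a P0 <= a P.
Hypothesis b_gt : forall P, P != P0 -> a P = a P0 -> b P0 < b P.

Lemma expansion_gap : exists2 g : R, 0 < g & exists n0 : nat, forall n : nat, (n0 <= n)%N ->
  forall P, P != P0 -> a P0 + b P0 / n%:R + g / n%:R <= a P + b P / n%:R.
Proof.
pose e P := if P == P0 then 1 else if a P == a P0 then b P - b P0 else 1.
have e0 P : 0 < e P.
  rewrite /e; case: eqP => [//|/eqP PP0]; case: eqP => // aE.
  by rewrite subr_gt0 b_gt.
have [g g0 gP] : exists2 g : R, 0 < g & forall P, g <= e P.
  exists (\big[Num.min/1]_P e P).
    by elim/big_ind: _ => // x y x0 y0; rewrite lt_min x0.
  by move=> P; rewrite (bigminD1 P)// ge_min lexx.
exists g => //.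
pose N P := if a P == a P0 then 0%N else Num.bound `|(b P0 + g - b P) / (a P - a P0)|.
exists (\max_P (N P)).+1 => n nN P PP0.
have n0 : (0 : R) < n%:R by rewrite ltr0n (leq_trans _ nN).
have := gP P; rewrite /e (negbTE PP0).
case: eqP => aE gE.
  by rewrite aE -addrA lerD2l -mulrDl ler_pM2r ?invr_gt0//; lra.
have aPP0 : 0 < a P - a P0 by rewrite subr_gt0 lt_neqAle a_ge andbT eq_sym; apply/eqP.
have NP : ((Num.bound `|(b P0 + g - b P) / (a P - a P0)|)%:R : R) <= n%:R.
  rewrite ler_nat (leq_trans _ (ltnW nN))//.
  have := @leq_bigmax _ N P; rewrite /N; case: eqP => //.
have : (b P0 + g - b P) / (a P - a P0) < n%:R.
  apply: lt_le_trans NP; apply: le_lt_trans (ler_norm _) _.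
  exact: archi_boundP.
rewrite ltr_pdivrMr// => H.
rewrite -subr_ge0 (_ : _ - _ = ((a P - a P0) * n%:R - (b P0 + g - b P)) / n%:R); last first.
  by field; rewrite gt_eqF.
by rewrite divr_ge0 ?(ltW n0)//; lra.
Qed.

Lemma argmin_expansion (F : nat -> {set 'I_d} -> \bar R) :
  (forall e : R, 0 < e -> exists n0 : nat, forall n, (n0 <= n)%N -> forall P,
    ((a P + b P / n%:R - e / n%:R)%:E <= F n P <= (a P + b P / n%:R + e / n%:R)%:E)%E) ->
  exists n0 : nat, forall n, (n0 <= n)%N -> argmin_model (F n) = [set P0]%SET.
Proof.
move=> HF; have [g g0 [n1 Hn1]] := expansion_gap.
have g30 : 0 < g / 3 by rewrite divr_gt0.
have [n2 Hn2] := HF _ g30; exists (maxn n1 n2).+1 => n nn.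
have n0 : (0 : R) < n%:R by rewrite ltr0n (leq_trans _ nn).
have /andP[nn1 nn2] : (n1 <= n)%N && (n2 <= n)%N by rewrite -geq_max ltnW.
have lt P : P != P0 -> (F n P0 < F n P)%E.
  move=> PP0; have /andP[_ H0] := Hn2 n nn2 P0; have /andP[HP _] := Hn2 n nn2 P.
  apply: (le_lt_trans H0); apply: lt_le_trans HP; rewrite lte_fin.
  have := Hn1 n nn1 P PP0; have : 0 < g / n%:R by rewrite divr_gt0.
  have -> : g / 3 / n%:R = g / n%:R / 3 by field; rewrite gt_eqF.
  by lra.
apply/setP => P; rewrite !inE; apply/forallP/eqP => [H|-> P'].
  by apply/eqP/negPn/negP => /lt; rewrite ltNge H.
by have [->//|/lt/ltW] := eqVneq P' P0.
Qed.

End argmin_expansion.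

(** * Failure probabilities *)

Section failure_probability.
Context {R : realType}.

(* The exceptional set is asked to be measurable; [P] itself need not be. *)
Definition fails_le d (T : measurableType d) (D : probability T R) (p : R) (P : T -> Prop) :=
  exists B, [/\ measurable B, (D B <= p%:E)%E & forall x, ~ B x -> P x].

Section calculus.
Context d (T : measurableType d) (D : probability T R).

Lemma fails_leW p p' (P P' : T -> Prop) : p <= p' -> (forall x, P x -> P' x) ->
  fails_le D p P -> fails_le D p' P'.
Proof.
move=> pp PP [B [mB DB HB]]; exists B; split=> //; last by move=> x /HB/PP.
by rewrite (le_trans DB)// lee_fin.
Qed.

Lemma fails_le_and p p' (P P' : T -> Prop) : fails_le D p P -> fails_le D p' P' ->
  fails_le D (p + p') (fun x => P x /\ P' x).
Proof.
move=> [B [mB DB HB]] [B' [mB' DB' HB']]; exists (B `|` B'); split.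
- exact: measurableU.
- by rewrite (le_trans (measureU2 _ _ _))// EFinD leeD.
- by move=> x /not_orP[/HB ? /HB' ?].
Qed.

Lemma fails_le_sure (P : T -> Prop) : (forall x, P x) -> fails_le D 0 P.
Proof. by move=> HP; exists set0; split=> //; rewrite measure0. Qed.

Lemma fails_le_forall (E : finType) (p : E -> R) (P : E -> T -> Prop) :
  (forall e, fails_le D (p e) (P e)) -> fails_le D (\sum_e p e) (fun x => forall e, P e x).
Proof.
move=> H.
suff : fails_le D (\sum_(e <- index_enum E) p e) (fun x => forall e, e \in index_enum E -> P e x).
  by apply: fails_leW => // x Hx e; apply: Hx; rewrite mem_index_enum.
elim: (index_enum E) => [|e r IH]; first by rewrite big_nil; exact: fails_le_sure.
rewrite big_cons; apply: fails_leW (fails_le_and (H e) IH) => // x [Pe Pr] e'.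
by rewrite inE => /predU1P[->//|]; exact: Pr.
Qed.

Lemma fails_le_ae (P : T -> Prop) : {ae D, forall x, P x} -> fails_le D 0 P.
Proof.
move=> [N [mN N0 H]]; exists N; split=> //; first by rewrite N0.
by move=> x xN; apply: contrapT => nP; exact: xN (H _ nP).
Qed.

Lemma fails_le_compl p (P : T -> Prop) : fails_le D p P ->
  exists A, [/\ measurable A, ((1 - p)%:E <= D A)%E & forall x, A x -> P x].
Proof.
move=> [B [mB DB HB]]; exists (~` B); split=> //; first exact: measurableC.
rewrite probability_setC// EFinB leeB//.
Qed.

End calculus.

Lemma prod_prob_marginal d (T : measurableType d) n (Q : 'I_n -> probability T R) j (A : set T) :
  measurable A -> prod_prob Q [set x | A (tnth x j)] = Q j A.
Proof.
move=> mA; pose F i := if i == j then A else setT.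
have mF i : measurable (F i) by rewrite /F; case: eqP.
rewrite (_ : [set x | _] = [set x | forall i, F i (tnth x i)]); last first.
  apply/seteqP; split=> [x /= Ax i|x /= /(_ j)]; last by rewrite /F eqxx.
  by rewrite /F; case: eqP => [->|].
rewrite prod_prob_box// (bigD1 j)//= /F eqxx big1 ?mule1// => i ij.
by rewrite (negbTE ij); exact: probability_setT.
Qed.

Lemma fails_le_tnth d (T : measurableType d) n (Q : 'I_n -> probability T R) j p (P : T -> Prop) :
  fails_le (Q j) p P -> fails_le (prod_prob Q) p (fun x => P (tnth x j)).
Proof.
move=> [B [mB DB HB]]; exists [set x | B (tnth x j)]; split.
- rewrite -[X in measurable X]setTI; exact: (@measurable_tnth _ T n j measurableT B mB).
- by rewrite prod_prob_marginal.
- by move=> x /HB.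
Qed.

Lemma ubm_fails (I : Type) (disp : I -> measure_display)
    (T : forall i, measurableType (disp i)) (D : forall i, probability (T i) R)
    (f : forall i, T i -> R) : ubm D f ->
  exists K : R, 0 <= K /\ forall i (e : R), 0 < e ->
    fails_le (D i) (K / e ^+ 2) (fun x => `|f i x| < e).
Proof.
move=> /ubm_chebyshev[K K0 HK]; exists K; split=> // i e e0; have [mB DB] := HK i e e0.
exists [set x | e <= `|f i x|]; split=> // x /= /negP; by rewrite -ltNge.
Qed.

Lemma iid_average_fails d (T : measurableType d) (mu : probability T R) f (m : R) :
  mom mu f -> m < EX mu f -> exists2 K : R, 0 <= K & forall J : nat, (0 < J)%N ->
  fails_le (iid J mu) (K / J%:R) (fun t => m < J%:R^-1 * \sum_(j < J) f (tnth t j)).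
Proof.
move=> mf mE; pose g x := f x - EX mu f.
have mg : mom mu g by exact: (ubmB mf (mom_cst mu _)).
have g0 : EX mu g = 0 by rewrite (EX_B mf (mom_cst mu _)) EX_cst subrr.
have ug : ubm (fun J : nat => iid J mu) (fun J t => (Num.sqrt (\sum_(j < J) true)%:R)^-1 * tsum predT (fun=> g) t).
  apply: (@ubm_nsum R nat _ (fun=> T) id (fun _ _ => mu) (fun _ => predT) (fun _ _ => g)) => //.
  - by move=> _ _ _; exact: (mom_measurable mg).
  - by move=> k; have [B HB] := mg.2 k; exists B => _ _ _; exact: (HB tt).
have [K [K0 HK]] := ubm_fails ug.
pose h := EX mu f - m; have h0 : 0 < h by rewrite subr_gt0.
exists (K / h ^+ 2); first by rewrite divr_ge0// exprn_ge0// ltW.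
move=> J J0; have JR : (0 : R) < J%:R by rewrite ltr0n.
have sJ : 0 < Num.sqrt (J%:R : R) by rewrite sqrtr_gt0.
have e0 : 0 < Num.sqrt J%:R * h by rewrite mulr_gt0.
have Jn : (\sum_(j < J) true)%N = J by rewrite sum_nat_const card_ord muln1.
apply: fails_leW (HK J _ e0) => [|t].
  by rewrite exprMn sqr_sqrtr ?(ltW JR)// invfM mulrA mulrAC.
rewrite Jn normrM gtr0_norm ?invr_gt0// -ltr_pdivlMl ?invr_gt0// invrK mulrA -expr2 sqr_sqrtr ?(ltW JR)//.
rewrite /tsum /g sumrB sumr_const card_ord => H.
have {}H : - (J%:R * h) < \sum_(i < J) f (tnth t i) - EX mu f *+ J.
  by move: H; rewrite ltr_norml => /andP[].
rewrite -(ltr_pM2l JR) mulVKf ?gt_eqF//; move: H; rewrite -mulr_natl /h; lra.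
Qed.

End failure_probability.

Section data_probability.
Context {R : realType} {d : nat} {dT : measure_display} {Theta : measurableType dT}.
Variables (mu : probability Theta R) (G : Theta -> probability (obs R d) R).

Lemma data_prob_ge J (N : 'rV[nat]_J) (E : set ('I_J -> seq (obs R d))) (p q : R)
    (S : J.-tuple Theta -> Prop) : 0 <= p -> 0 <= q ->
  fails_le (iid J mu) p S ->
  (forall t, S t -> fails_le (prod_prob (fun j => iid (\max_(k < J) N ord0 k)%N (G (tnth t j)))) q
     (fun x => E (fun j => take (N ord0 j) (tnth x j)))) ->
  ((1 - (p + q))%:E <= data_prob mu G N E)%E.
Proof.
move=> p0 q0 /fails_le_compl[A [mA DA HA]] HS; rewrite /data_prob.
have [q1|q1] := ltP 1 q.
  apply: (@le_trans _ _ 0%E); first by rewrite lee_fin; lra.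
  by apply: integral_ge0 => t _; exact: measure_ge0.
have q10 : 0 <= 1 - q by rewrite subr_ge0.
apply: (@le_trans _ _ (\int[iid J mu]_t ((1 - q)%:E * (\1_A t)%:E))%E).
  rewrite ge0_integralZl//; last exact/measurable_EFinP.
  rewrite integral_indic// setIT.
  apply: (@le_trans _ _ ((1 - q)%:E * (1 - p)%:E)%E).
    rewrite -EFinM lee_fin.
    by have := mulr_ge0 p0 q0; lra.
  by rewrite lee_wpmul2l.
apply: le_nnintegral => t; first by rewrite -EFinM lee_fin mulr_ge0.
rewrite indicE; case: (boolP (t \in A)) => [|_]; last by rewrite mule0 measure_ge0.
rewrite inE mule1 => /HA/HS/fails_le_compl[A' [mA' DA' HA']].
by apply: (le_trans DA'); apply: prod_prob_le => x /HA'.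
Qed.

End data_probability.

Lemma limf_einf_ge (R : realType) (T : choiceType) (X : filteredType T) (f : X -> \bar R)
    (F : set_system X) (c : R) :
  (forall e : R, 0 < e -> exists2 V, F V & forall x, V x -> ((c - e)%:E <= f x)%E) ->
  (c%:E <= limf_einf f F)%E.
Proof.
move=> H; rewrite limf_einfE; apply/lee_subgt0Pr => e e0.
have [V FV HV] := H e e0; rewrite -EFinB.
apply: (@le_trans _ _ (ereal_inf (f @` V))).
  by apply: le_ereal_inf_tmp => _ [x Vx <-]; exact: HV.
by apply: ereal_sup_ubound; exists V.
Qed.

Section averages.
Context {R : realType}.

Lemma average_ge J (a b : 'I_J -> R) (k : R) : (0 < J)%N -> (forall j, b j - k <= a j) ->
  J%:R^-1 * \sum_(j < J) b j - k <= J%:R^-1 * \sum_(j < J) a j.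
Proof.
move=> J0 ab; have JR : (0 : R) < J%:R by rewrite ltr0n.
rewrite ler_pdivlMl// mulrBr mulVKf ?gt_eqF//.
have -> : \sum_(j < J) b j - J%:R * k = \sum_(j < J) (b j - k).
  by rewrite mulr_natl sumrB sumr_const card_ord.
exact: ler_sum.
Qed.

Lemma nested_gap_le (p q p1 q1 c C r E e Q : R) : 0 <= c <= C -> 0 <= E -> - Q - E <= r ->
  `|p1 - p| <= e -> `|q1 - q| <= e ->
  p - q - c * (Q - (p - q)) - (2 * e * (1 + C) + C * E) <= c * r + (p1 - q1) * (1 + c).
Proof.
move=> /andP[c0 cC] E0 Hr; rewrite !ler_norml => /andP[h1 h2] /andP[h3 h4].
have H1 : c * (- Q - E) <= c * r by rewrite ler_wpM2l.
have H2 : c * E <= C * E by rewrite ler_wpM2r.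
have c1 : 0 <= 1 + c by lra.
have H3 : (p - q - 2 * e) * (1 + c) <= (p1 - q1) * (1 + c) by rewrite ler_wpM2r//; lra.
have e0 : 0 <= 2 * e by lra.
have H4 : 2 * e * c <= 2 * e * C by rewrite ler_wpM2l.
lra.
Qed.

Lemma separated_gap_le (r s r1 s1 p q p1 q1 e B u v C : R) : 0 <= u -> 0 <= v <= u * C ->
  `|r1 - r| <= e -> `|s1 - s| <= e -> `|p1 - p| <= e -> `|q1 - q| <= e -> `|p| <= B -> `|q| <= B ->
  r - s - (2 * e + 2 * (B + e) * (u + u * C)) <= r1 + p1 * (u + v) - (s1 + q1 * (u + v)).
Proof.
move=> u0 /andP[v0 vC]; rewrite !ler_norml.
move=> /andP[? ?] /andP[? ?] /andP[? ?] /andP[? ?] /andP[? ?] /andP[? ?].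
have uv : 0 <= u + v by rewrite addr_ge0.
have H1 : - (2 * (B + e)) * (u + v) <= (p1 - q1) * (u + v) by rewrite ler_wpM2r//; lra.
have H2 : 2 * (B + e) * (u + v) <= 2 * (B + e) * (u + u * C) by rewrite ler_wpM2l//; lra.
lra.
Qed.

End averages.

(** * Families of environments *)

Section environments.
Context {R : realType} {d : nat} {dT : measure_display} {Theta : measurableType dT}.
Variable (G : Theta -> probability (obs R d) R).
Hypothesis G_measurable : forall A, measurable A -> measurable_fun setT (fun t => G t A).
Hypothesis Q_invertible : forall t P, Qmx (G t) P \in unitmx.
Hypothesis gram_invertible : forall t P (n : nat), (d < n)%N ->
  {ae iid n (G t), forall s : n.-tuple (obs R d), gram P s \in unitmx}.
Hypothesis moments_bounded : forall k : nat, exists B : R, forall t,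
  (forall i, (\int[G t]_z (`|tnth z.1 i| ^+ k)%:E <= B%:E)%E) /\
  (\int[G t]_z (`|z.2| ^+ k)%:E <= B%:E)%E.
Hypothesis inverse_third_moments_bounded : forall P, exists (n0 : nat) (B : R),
  forall n : nat, (n0 <= n)%N -> forall t i j,
  (\int[iid n (G t)]_s (`|invmx (n%:R^-1 *: gram P s) i j| ^+ 3)%:E <= B%:E)%E.

Lemma ubm_response : ubm G (fun=> snd).
Proof.
split=> // k; have [B HB] := moments_bounded k.
by exists B => t; have [_] := HB t.
Qed.

Lemma measurable_covariate i : measurable_fun setT (fun z : obs R d => tnth z.1 i).
Proof.
by apply: (@measurableT_comp _ _ _ _ _ _ (fun x : d.-tuple R => tnth x i)) => //; exact: measurable_tnth.
Qed.

Lemma ubm_covariate i : ubm G (fun _ z => tnth z.1 i).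
Proof.
split=> [_|k]; first exact: measurable_covariate.
by have [B HB] := moments_bounded k; exists B => t; have [] := HB t.
Qed.

Lemma lfun_G t : lfun (fun f => mom (G t) f) (EX (G t)).
Proof.
apply: lfun_EX; first exact: (ubm_at t ubm_response).
by move=> i; exact: (ubm_at t (ubm_covariate i)).
Qed.

Lemma Q_posdef t : posdefmx (mom_xx (EX (G t))).
Proof.
apply: posdef_setT; first exact: (mom_xx_psd (lfun_G t)).
by rewrite -QmxE; exact: Q_invertible.
Qed.

Lemma measurable_emp n f : measurable_fun setT f ->
  measurable_fun setT (fun s : n.-tuple (obs R d) => emp s f).
Proof.
move=> mf; rewrite (_ : (fun s => _) = fun s : n.-tuple _ => n%:R^-1 * tsum predT (fun=> f) s); last first.
  by apply/funext => s; rewrite /emp size_tuple big_tuple.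
by apply: measurable_funM => //; exact: measurable_tsum.
Qed.

Lemma measurable_Qhat n P : clsmx (fun f : n.-tuple (obs R d) -> R => measurable_fun setT f)
  (fun s => subgram (mom_xx (emp s)) P).
Proof.
move=> k l; rewrite (_ : (fun s : n.-tuple (obs R d) => _) = fun s : n.-tuple (obs R d) =>
    emp s (fun z => tnth z.1 (enum_val k) * tnth z.1 (enum_val l))); last first.
  by apply/funext => s; rewrite subgramE mxE.
by apply: measurable_emp; apply: measurable_funM; exact: measurable_covariate.
Qed.

Lemma QhatnE n P (s : n.-tuple (obs R d)) : n%:R^-1 *: gram P s = subgram (mom_xx (emp s)) P.
Proof. by rewrite -QhatE /Qhat size_tuple. Qed.

Lemma emp_Q_posdef (s : seq (obs R d)) : (0 < size s)%N ->
  gram [set: 'I_d]%SET s \in unitmx -> posdefmx (mom_xx (emp s)).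
Proof.
move=> s0 gu; apply: posdef_setT; first exact: (mom_xx_psd (lfun_emp s)).
by rewrite -gram_unit.
Qed.

(* With [A] the sample second moment matrix, of mean [Q], and [v = Q^-1 u],
   taking expectations gives [u' Q^-1 u <= E (u' A^-1 u)]. *)
Lemma invmx_variational n (A : 'M[R]_n) (u v : 'cV[R]_n) : posdefmx A ->
  2 * (v^T *m u) ord0 ord0 - qf A v v <= qf (invmx A) u u.
Proof.
move=> pA; have [As _] := posdef_psd pA; have := (invmx_psd pA).2 (u - A *m v).
rewrite !(qfDl, qfDr, qfNl, qfNr) (qfC (A *m v) u (invmx_psd pA).1).
have -> : qf (invmx A) (A *m v) (A *m v) = qf A v v.
  by rewrite qf_mulr qf_mull As mulVmx ?posdef_unit// mulmx1.
have -> : qf (invmx A) u (A *m v) = (v^T *m u) ord0 ord0.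
  rewrite qf_mulr mulVmx ?posdef_unit// /qf mulmx1 !mxE.
  by apply: eq_bigr => i _; rewrite !mxE mulrC.
by move=> H; rewrite -subr_ge0; apply: le_trans H _; lra.
Qed.

Lemma Qinv_bounded P : exists B : R, forall t i j,
  `|invmx (subgram (mom_xx (EX (G t))) P) i j| <= B.
Proof.
have [n0 [B HB]] := inverse_third_moments_bounded P.
pose n := maxn n0 d.+1.
have n00 : (n0 <= n)%N by rewrite leq_maxl.
have dn : (d < n)%N by rewrite leq_maxr.
have n_gt0 : (0 < n)%N by exact: leq_ltn_trans dn.
suff H t k : invmx (subgram (mom_xx (EX (G t))) P) k k <= 1 + B.
  exists ((1 + B) + (1 + B)) => t i j.
  rewrite (le_trans (psd_entry _ _ (invmx_psd (subgram_posdef P (Q_posdef t)))))//.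
  exact: lerD.
set A := subgram _ _; have pA : posdefmx A by exact: subgram_posdef (Q_posdef t).
pose e : 'cV[R]_#|P| := delta_mx k ord0.
pose v := invmx A *m e.
pose a : R := invmx A k k; rewrite -/a.
have vAv : qf A v v = a.
  rewrite /v qf_mulr qf_mull mulmxV ?posdef_unit// mulmx1 (invmx_psd pA).1.
  exact: qf_delta.
have ve : (v^T *m e) ord0 ord0 = a.
  by rewrite /v trmx_mul (invmx_psd pA).1 -/(qf _ _ _) qf_delta.
have a0 : 0 <= a by exact: psd_diag_ge0 (invmx_psd pA).
have mi3 : measurable_fun setT (fun s : n.-tuple (obs R d) => (`|invmx (n%:R^-1 *: gram P s) k k| ^+ 3)%:E).
  apply/measurable_EFinP; apply: measurable_funX; apply: measurableT_comp; first exact: normr_measurable.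
  under eq_fun do rewrite QhatnE.
  exact: (measurable_invmx (@measurable_Qhat n P)).
pose f (z : obs R d) : R := (\sum_i (emb P *m v) i ord0 * tnth z.1 i) ^+ 2.
have mf : mom (G t) f by apply: (clsX (lfun_ring (lfun_G t))); exact: (C_comb (lfun_G t)).
have fE (s : seq (obs R d)) : qf (subgram (mom_xx (emp s)) P) v v = emp s f.
  by rewrite /subgram qf_congr (mom_xx_quad (lfun_emp s)).
have mEf := @mom_emp _ _ _ G t n n f mf.
have EXf : EX (iid n (G t)) (fun s => emp s f) = a.
  by rewrite EX_emp// -vAv /A /subgram qf_congr (mom_xx_quad (lfun_G t)).
have mf' : mom (iid n (G t)) (fun s => emp s f).
  by apply: eq_ubm mEf => _ s; rewrite take_oversize// size_tuple.
suff : (\int[iid n (G t)]_s (2 * a)%:E <= \int[iid n (G t)]_s ((emp s f + 1)%:E +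
      (`|invmx (n%:R^-1 *: gram P s) k k| ^+ 3)%:E))%E.
  rewrite integral_cst//= probability_setT mule1 ge0_integralD//; last 2 first.
  - by move=> s _; rewrite lee_fin addr_ge0// (lfun_ge0 (lfun_emp s))// => z; rewrite sqr_ge0.
  - by apply/measurable_EFinP; apply: measurable_funD => //; exact: (mom_measurable mf').
  rewrite (EXE (ubmD mf' (mom_cst (iid n (G t)) 1))) (EX_D mf' (mom_cst _ 1)) EXf EX_cst.
  move=> H; have := le_trans H (leeD2l _ (HB n n00 t k k)).
  by rewrite -EFinD lee_fin; lra.
apply: ae_ge0_le_integral => //.
- by move=> s _; rewrite lee_fin mulr_ge0.
- by move=> s _; rewrite adde_ge0 ?lee_fin ?exprn_ge0// addr_ge0// (lfun_ge0 (lfun_emp s))// => z; rewrite sqr_ge0.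
- apply: emeasurable_funD; last exact: mi3.
  by apply/measurable_EFinP; apply: measurable_funD => //; exact: (mom_measurable mf').
have gP := gram_invertible t P dn; have gT := gram_invertible t [set: 'I_d]%SET dn.
move: gT; apply: filterS => s gs _.
have s0 : (0 < size s)%N by rewrite size_tuple.
have pQ := emp_Q_posdef s0 gs.
have pE := subgram_posdef P pQ.
rewrite -EFinD lee_fin QhatnE -fE.
have := invmx_variational e v pE; rewrite ve qf_delta.
set x := invmx _ k k; move=> H.
have x0 : 0 <= x by exact: psd_diag_ge0 (invmx_psd pE).
rewrite ger0_norm//; have : x <= 1 + x ^+ 3; last by lra.
have := sqr_ge0 (x - 1); rewrite exprS; nra.
Qed.

Lemma Qinv_uniformly_bounded : exists B : R, forall t P i j,
  `|invmx (subgram (mom_xx (EX (G t))) P) i j| <= B.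
Proof.
have /choice [B HB] := Qinv_bounded.
exists (\sum_P `|B P|) => t P i j; apply: le_trans (HB P t i j) _.
by rewrite (bigD1 P)//= (le_trans (ler_norm _))// lerDl sumr_ge0.
Qed.

Lemma bounded_measurable_monomial q : bounded_measurable (fun t => EX (G t) (monomial q)).
Proof.
have um := ubm_monomial ubm_response ubm_covariate q.
split; last by have [B HB] := ubm_EX_bound um; exists B.
apply: measurable_EX => //.
have mv v : measurable_fun setT (obs_var v : obs R d -> R).
  case: v => [[i|]|] //=; [exact: measurable_covariate|exact: measurable_snd|exact: measurable_cst].
by do 3 (apply: measurable_funM; last exact: mv); exact: mv.
Qed.

Lemma bounded_measurable_Qinv P : clsmx (@bounded_measurable R _ Theta)
  (fun t => invmx (subgram (mom_xx (EX (G t))) P)).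
Proof.
move=> i j; have [B HB] := Qinv_uniformly_bounded; split; last by exists B.
apply: measurable_invmx => k l.
have H := clsmx_mom_xx (L := fun t => EX (G t)) bounded_measurable_monomial (enum_val k) (enum_val l).
by under eq_fun do rewrite subgramE; have [] := H.
Qed.

Lemma bounded_measurable_risk P : bounded_measurable (fun t => risk (EX (G t)) P).
Proof.
exact: (cls_risk (@bounded_measurable_ring_class R _ Theta) lfun_G
  bounded_measurable_monomial bounded_measurable_Qinv).
Qed.

Lemma bounded_measurable_penalty P : bounded_measurable (fun t => penalty (EX (G t)) P).
Proof.
exact: (cls_penalty (@bounded_measurable_ring_class R _ Theta) lfun_G
  bounded_measurable_monomial bounded_measurable_Qinv).
Qed.

Lemma bounded_slope P : exists B : R, forall t i, `|slope (EX (G t)) P i ord0| <= B.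
Proof.
have H := clsmx_slope (@bounded_measurable_ring_class R _ Theta)
  bounded_measurable_monomial bounded_measurable_Qinv P.
have /choice [B HB] : forall i, exists B : R, forall t, `|slope (EX (G t)) P i ord0| <= B.
  by move=> i; have [] := H i ord0.
exists (\sum_i `|B i|) => t i; apply: le_trans (HB i t) _.
by rewrite (bigD1 i)//= (le_trans (ler_norm _))// lerDl sumr_ge0.
Qed.

Definition sscore (P : {set 'I_d}) (k : 'I_#|P|) t (z : obs R d) : R :=
  residX (slope (EX (G t)) P) z * tnth z.1 (enum_val k).

(* Dominates the terms of the prediction error of least squares that are of
   lower order than [1/n]; the cube is the moment that the hypotheses control. *)
Definition remainder (P : {set 'I_d}) t n (s : seq (obs R d)) : R :=
  n%:R ^- 2 * \sum_(k < #|P|) \sum_(l < #|P|) \sum_(m < #|P|)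
    (`|invmx (subgram (mom_xx (emp s)) P) l m| ^+ 3 +
     ((Num.sqrt n%:R * (emp s (fun z => tnth z.1 (enum_val k) * tnth z.1 (enum_val l))
         - EX (G t) (fun z => tnth z.1 (enum_val k) * tnth z.1 (enum_val l)))) *
      (Num.sqrt n%:R * (emp s (sscore m t) - EX (G t) (sscore m t)))) ^+ 6).

Definition slope_err (P : {set 'I_d}) t (s : seq (obs R d)) : 'cV[R]_#|P| :=
  (emb P)^T *m (slope (emp s) P - slope (EX (G t)) P).

Definition gram_err (P : {set 'I_d}) t (s : seq (obs R d)) : 'M[R]_#|P| :=
  subgram (mom_xx (EX (G t))) P - subgram (mom_xx (emp s)) P.

Definition score_qf (P : {set 'I_d}) t (s : seq (obs R d)) : R :=
  qf (invmx (subgram (mom_xx (EX (G t))) P))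
     ((emb P)^T *m score (emp s) (slope (EX (G t)) P))
     ((emb P)^T *m score (emp s) (slope (EX (G t)) P)).

Definition ols_err (P : {set 'I_d}) t (s : seq (obs R d)) : 'cV[R]_#|P| :=
  ols P s - (emb P)^T *m slope (EX (G t)) P.

Definition ols_excess (P : {set 'I_d}) t n : \bar R :=
  (\int[iid n (G t)]_s
    (qf (subgram (mom_xx (EX (G t))) P) (ols_err P t s) (ols_err P t s))%:E)%E.

Lemma ubm_resid P : ubm G (fun t => residX (slope (EX (G t)) P)).
Proof.
have [B HB] := bounded_slope P.
apply: ubmB; first exact: ubm_response.
apply: (@ubm_sum _ _ _ _ _ _ _ _ (fun i t z => slope (EX (G t)) P i ord0 * tnth z.1 i)) => i.
apply: ubmM; last exact: ubm_covariate.
by apply: (@ubm_cst _ _ _ _ _ _ B) => t; exact: HB.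
Qed.

Lemma ubm_sscore (P : {set 'I_d}) (k : 'I_#|P|) : ubm G (sscore k).
Proof. by apply: ubmM; [exact: ubm_resid|exact: ubm_covariate]. Qed.

Lemma EX_sscore (P : {set 'I_d}) (k : 'I_#|P|) t : EX (G t) (sscore k t) = 0.
Proof.
have := slope_score (lfun_G t) (Q_posdef t) P.
by move=> /matrixP/(_ k ord0); rewrite tr_emb_mul !mxE.
Qed.

Lemma ubm_root_emp (f : Theta -> obs R d -> R) : ubm G f ->
  ubm (fun i : Theta * nat => iid i.2 (G i.1))
    (fun i s => Num.sqrt i.2%:R * (emp s (f i.1) - EX (G i.1) (f i.1))).
Proof.
move=> /ubm_emp /(@ubm_reindex _ _ _ _ _ _ _ (fun i : Theta * nat => (i.1, i.2, i.2))).
by apply: eq_ubm => -[t n] s /=; rewrite take_oversize ?size_tuple.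
Qed.

Lemma emp_gram_slope P (s : seq (obs R d)) b : posdefmx (mom_xx (emp s)) -> supported P b ->
  subgram (mom_xx (emp s)) P *m ((emb P)^T *m (slope (emp s) P - b)) =
  (emb P)^T *m score (emp s) b.
Proof.
move=> pQ sb; rewrite (slope_shift (lfun_emp s))//.
have := congr1 trmx (subinv_mul_emb pQ (subxx P)).
rewrite [LHS]trmx_mul [(_ *m mom_xx _)^T]trmx_mul subinv_sym ?pQ.1// => E.
have E2 : emb P *m ((emb P)^T *m (subinv (mom_xx (emp s)) P *m score (emp s) b)) =
    subinv (mom_xx (emp s)) P *m score (emp s) b.
  by rewrite /subinv -!mulmxA; exact: supported_emb.
by rewrite /subgram -(mulmxA _ (emb P)) E2 -(mulmxA (emb P)^T) (mulmxA (mom_xx _)) (mulmxA (emb P)^T) E.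
Qed.

Lemma remainder_ge0 P t n s : 0 <= remainder P t n s.
Proof.
rewrite mulr_ge0 ?invr_ge0 ?exprn_ge0//; do 3 (apply: sumr_ge0 => ? _).
by apply: addr_ge0; [rewrite exprn_ge0|rewrite exprn_even_ge0].
Qed.

Lemma measurable_remainder P t n :
  measurable_fun setT (fun s : n.-tuple (obs R d) => remainder P t n s).
Proof.
have H := @measurable_ring_class R _ (n.-tuple (obs R d)).
apply: (clsZ H); do 3 (apply: (cls_sum H) => ?).
apply: (clsD H).
  apply: measurable_funX; apply: measurableT_comp; first exact: normr_measurable.
  exact: (measurable_invmx (@measurable_Qhat n P)).
have mr f : measurable_fun setT f -> measurable_fun setT
    (fun s : n.-tuple (obs R d) => Num.sqrt n%:R * (emp s f - EX (G t) f)).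
  move=> mf; apply: (clsZ H); apply: (clsB H); last exact: (cls_cst H).
  exact: measurable_emp.
apply: (clsX H); apply: (clsM H); apply: mr.
- by apply: measurable_funM; exact: measurable_covariate.
- exact: (mom_measurable (ubm_at t (ubm_sscore _))).
Qed.

Lemma integral_remainder P : exists (n0 : nat) (c : R), forall n, (n0 <= n)%N -> forall t,
  (\int[iid n (G t)]_s (remainder P t n s)%:E <= (n%:R ^- 2 * c)%:E)%E.
Proof.
have [n0 [B HB]] := inverse_third_moments_bounded P.
pose w (k l m : 'I_#|P|) (i : Theta * nat) (s : i.2.-tuple (obs R d)) : R :=
  (Num.sqrt i.2%:R * (emp s (fun z => tnth z.1 (enum_val k) * tnth z.1 (enum_val l))
         - EX (G i.1) (fun z => tnth z.1 (enum_val k) * tnth z.1 (enum_val l)))) *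
      (Num.sqrt i.2%:R * (emp s (sscore m i.1) - EX (G i.1) (sscore m i.1))).
have uw k l m : ubm (fun i : Theta * nat => iid i.2 (G i.1)) (@w k l m).
  have u1 := ubm_root_emp (ubmM (ubm_covariate (enum_val k)) (ubm_covariate (enum_val l))).
  exact: (ubmM u1 (ubm_root_emp (ubm_sscore m))).
have /choice [B6 HB6] : forall klm : 'I_#|P| * 'I_#|P| * 'I_#|P|, exists b : R, forall i,
    (\int[iid i.2 (G i.1)]_s (`|w klm.1.1 klm.1.2 klm.2 i s| ^+ 6)%:E <= b%:E)%E.
  by move=> klm; have [_ /(_ 6%N)] := uw klm.1.1 klm.1.2 klm.2.
exists n0, (\sum_(k < #|P|) \sum_(l < #|P|) \sum_(m < #|P|) (B + B6 (k, l, m))) => n n0n t.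
have mi l m : measurable_fun setT (fun s : n.-tuple (obs R d) =>
    (`|invmx (subgram (mom_xx (emp s)) P) l m| ^+ 3)%:E).
  apply/measurable_EFinP; apply: measurable_funX; apply: measurableT_comp; first exact: normr_measurable.
  exact: (measurable_invmx (@measurable_Qhat n P)).
have mw k l m : measurable_fun setT (fun s : n.-tuple (obs R d) => (`|w k l m (t, n) s| ^+ 6)%:E).
  exact: (@measurable_normX R _ _ _ (t, n) _ 6 ((uw k l m).1 (t, n))).
pose tm (k l m : 'I_#|P|) (s : n.-tuple (obs R d)) : \bar R := ((`|invmx (subgram (mom_xx (emp s)) P) l m| ^+ 3)%:E + (`|w k l m (t, n) s| ^+ 6)%:E)%E.
have tm0 k l m s : (0 <= tm k l m s)%E by rewrite adde_ge0 ?lee_fin ?exprn_ge0.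
have mtm k l m : measurable_fun setT (tm k l m) by exact: emeasurable_funD.
have itm k l m : (\int[iid n (G t)]_s tm k l m s <= (B + B6 (k, l, m))%:E)%E.
  rewrite ge0_integralD//.
  rewrite EFinD leeD//; last exact: (HB6 (k, l, m) (t, n)).
  by under eq_integral do rewrite -QhatnE; exact: HB.
rewrite (_ : (fun s => _) = fun s => ((n%:R ^- 2)%:E * \sum_k \sum_l \sum_m tm k l m s)%E); last first.
  apply/funext => s; rewrite /remainder EFinM; congr (_ * _)%E.
  rewrite -sumEFin; apply: eq_bigr => k _; rewrite -sumEFin; apply: eq_bigr => l _.
  rewrite -sumEFin; apply: eq_bigr => m _; rewrite EFinD; congr (_ + _)%E.
  by congr EFin; rewrite -[RHS]normrX ger0_norm// exprn_even_ge0.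
rewrite ge0_integralZl//; last 2 first.
- by do 3 (apply: emeasurable_sum => ? ).
- by move=> s _; do 3 (apply: sume_ge0 => ? _).
rewrite EFinM lee_wpmul2l ?lee_fin ?invr_ge0 ?exprn_ge0//.
rewrite ge0_integral_sum//; last 2 first.
- by move=> k; do 2 (apply: emeasurable_sum => ? ).
- by move=> k s _; do 2 (apply: sume_ge0 => ? _).
rewrite -sumEFin; apply: lee_sum => k _.
rewrite ge0_integral_sum//; last 2 first.
- by move=> l; apply: emeasurable_sum.
- by move=> l s _; apply: sume_ge0 => ? _.
rewrite -sumEFin; apply: lee_sum => l _.
rewrite ge0_integral_sum//.
by rewrite -sumEFin; apply: lee_sum => m _.
Qed.

Lemma remainder_bound P : exists2 c : R, 0 <= c & forall t n (s : n.-tuple (obs R d)),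
  (0 < n)%N -> posdefmx (mom_xx (emp s)) ->
  qf (invmx (subgram (mom_xx (EX (G t))) P)) (gram_err P t s *m slope_err P t s)
    (gram_err P t s *m slope_err P t s) <= c * remainder P t n s.
Proof.
have [B0 HB0] := Qinv_uniformly_bounded; pose B : R := `|B0|.
have Bge0 : 0 <= B by exact: normr_ge0.
have HB t i j : `|invmx (subgram (mom_xx (EX (G t))) P) i j| <= B.
  by rewrite (le_trans (HB0 t P i j))// ler_norm.
pose p := #|P|.
have c0 : 0 <= B * p%:R * (p * p)%:R by rewrite !mulr_ge0.
exists (B * p%:R * (p * p)%:R) => // t n s n0 pQ.
set E := gram_err P t s; set h := slope_err P t s; set X := invmx (subgram (mom_xx (emp s)) P).
pose g := (emb P)^T *m score (emp s) (slope (EX (G t)) P).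
have hE : h = X *m g.
  have := emp_gram_slope pQ (supported_slope (EX (G t)) P).
  by move=> H; rewrite /g -H mulKmx//; exact: posdef_unit (subgram_posdef P pQ).
apply: (le_trans (qf_bound _ (HB t))).
rewrite -[X in _ <= X]mulrA; apply: ler_wpM2l; first by rewrite mulr_ge0.
rewrite /remainder mulr_sumr mulr_sumr.
apply: ler_sum => k _.
have -> : (E *m h) k ord0 = \sum_(lm : 'I_p * 'I_p) E k lm.1 * X lm.1 lm.2 * g lm.2 ord0.
  rewrite mxE hE -(pair_bigA _ (fun l m => E k l * X l m * g m ord0)) /=.
  by apply: eq_bigr => l _; rewrite [(X *m g) _ _]mxE mulr_sumr; apply: eq_bigr => m _; rewrite mulrA.
apply: (le_trans (sqr_sum_le _)); rewrite card_prod card_ord ler_wpM2l//.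
rewrite (pair_bigA _ (fun l m => `|X l m| ^+ 3 + ((Num.sqrt n%:R * (emp s (fun z => tnth z.1 (enum_val k) * tnth z.1 (enum_val l))
         - EX (G t) (fun z => tnth z.1 (enum_val k) * tnth z.1 (enum_val l)))) *
      (Num.sqrt n%:R * (emp s (sscore m t) - EX (G t) (sscore m t)))) ^+ 6)) /= mulr_sumr.
apply: ler_sum => -[l m] _ /=.
have gE : g m ord0 = emp s (sscore m t) by rewrite /g tr_emb_mul mxE.
have EE : E k l = EX (G t) (fun z => tnth z.1 (enum_val k) * tnth z.1 (enum_val l)) -
   emp s (fun z => tnth z.1 (enum_val k) * tnth z.1 (enum_val l)).
  by rewrite /E /gram_err [LHS]mxE [X in _ + X]mxE !subgramE !mxE.
rewrite gE EX_sscore subr0 EE.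
set e1 := emp s _; set e2 := EX _ _; set y := emp s _.
have nn0 : (0 : R) < n%:R ^+ 2 by rewrite exprn_gt0// ltr0n.
have := cubic_young (X l m) (sqr_ge0 ((e2 - e1) * y)) nn0.
set x := X l m.
have -> : (e2 - e1) * x * y = x * ((e2 - e1) * y) by ring.
rewrite [(x * _) ^+ 2]exprMn => H; apply: (le_trans H).
rewrite mulrDr lerD2l le_eqVlt; apply/orP; left; apply/eqP.
have -> : Num.sqrt n%:R * (e1 - e2) * (Num.sqrt n%:R * y) = Num.sqrt n%:R ^+ 2 * ((e1 - e2) * y) by ring.
by rewrite sqr_sqrtr//; field; rewrite pnatr_eq0 -lt0n.
Qed.

Lemma emb_score P t s m :
  ((emb P)^T *m score (emp s) (slope (EX (G t)) P)) m ord0 = emp s (sscore m t).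
Proof. by rewrite tr_emb_mul mxE. Qed.

Lemma mom_emp_all t n f : mom (G t) f -> mom (iid n (G t)) (fun s => emp s f).
Proof.
move=> mf; apply: eq_ubm (mom_emp n n mf) => _ s.
by rewrite take_oversize// size_tuple.
Qed.

Lemma score_qfE P t s : score_qf P t s = \sum_k \sum_l
  invmx (subgram (mom_xx (EX (G t))) P) k l * (emp s (sscore k t) * emp s (sscore l t)).
Proof.
rewrite /score_qf qfE; apply: eq_bigr => k _; apply: eq_bigr => l _.
by rewrite !emb_score; ring.
Qed.

Lemma mom_score_qf P t n : mom (iid n (G t)) (fun s => score_qf P t s).
Proof.
have ms k := @mom_emp_all t n _ (ubm_at t (@ubm_sscore P k)).
have H k l := ubmM (mom_cst (iid n (G t)) (invmx (subgram (mom_xx (EX (G t))) P) k l)) (ubmM (ms k) (ms l)).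
have := ubm_sum (index_enum 'I_#|P|) predT (fun k => ubm_sum (index_enum 'I_#|P|) predT (fun l => H k l)).
by apply: eq_ubm => _ s; rewrite score_qfE.
Qed.

Lemma EX_score_qf P t n : (0 < n)%N ->
  EX (iid n (G t)) (fun s => score_qf P t s) = n%:R^-1 * penalty (EX (G t)) P.
Proof.
move=> n0; have nn0 : (n%:R : R) != 0 by rewrite pnatr_eq0 -lt0n.
have ms k := @mom_emp_all t n _ (ubm_at t (@ubm_sscore P k)).
have H k l := ubmM (mom_cst (iid n (G t)) (invmx (subgram (mom_xx (EX (G t))) P) k l)) (ubmM (ms k) (ms l)).
under [X in EX _ X]eq_fun do rewrite score_qfE.
rewrite (EX_sum (index_enum 'I_#|P|) predT (fun k => ubm_sum (index_enum 'I_#|P|) predT (fun l => H k l))).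
transitivity (\sum_k \sum_l invmx (subgram (mom_xx (EX (G t))) P) k l *
   (n%:R^-1 * subgram (wmom (EX (G t)) (slope (EX (G t)) P)) P k l)).
  apply: eq_bigr => k _; rewrite (EX_sum (index_enum 'I_#|P|) predT (H k)).
  apply: eq_bigr => l _; rewrite (EX_Z _ (ubmM (ms k) (ms l))); congr (_ * _).
  have := EX_emp2 n0 (ubm_at t (@ubm_sscore P k)) (ubm_at t (@ubm_sscore P l)) (EX_sscore _ t) (EX_sscore _ t) n.
  rewrite minnn -lt0n n0 mul1r.
  rewrite (_ : (fun x => _) = fun x : n.-tuple (obs R d) => n%:R * (emp x (sscore k t) * emp x (sscore l t))); last first.
    by apply/funext => x; rewrite take_oversize ?size_tuple.
  rewrite (EX_Z _ (ubmM (ms k) (ms l))) => E.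
  rewrite -[LHS](mulKf nn0) E; congr (_ * _); rewrite subgramE mxE; congr EX.
  by apply/funext => z; rewrite /sscore; ring.
rewrite /penalty -trace_subinv -/(subgram _ _) mxtrace_mulC mulr_sumr; apply: eq_bigr => k _.
rewrite mxE mulr_sumr; apply: eq_bigr => l _.
rewrite mulrCA; congr (_ * (_ * _)).
by rewrite !subgramE -[in LHS]wmom_sym [LHS]mxE.
Qed.

Lemma risk_ols P t (s : seq (obs R d)) :
  (\int[G t]_z ((resid (ols P s) z ^+ 2)%R)%:E =
   (risk (EX (G t)) P + qf (subgram (mom_xx (EX (G t))) P) (ols_err P t s) (ols_err P t s))%:E)%E.
Proof.
under eq_integral do rewrite residE.
rewrite EXE; last exact: (clsX (lfun_ring (lfun_G t)) 2 (C_resid (lfun_G t) _)).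
rewrite (risk_pythagoras (lfun_G t) (Q_posdef t) (supported_emb (ols P s))).
congr (_ + _)%:E; rewrite /subgram qf_congr /ols_err mulmxBr.
by rewrite (supported_slope (EX (G t)) P).
Qed.

Lemma measurable_ols n P : (0 < n)%N -> clsmx (fun f : n.-tuple (obs R d) -> R => measurable_fun setT f)
  (fun s => ols P s).
Proof.
move=> n0; have H := @measurable_ring_class R _ (n.-tuple (obs R d)).
have E (s : n.-tuple (obs R d)) : ols P s = invmx (n%:R *: subgram (mom_xx (emp s)) P) *m
   (n%:R *: ((emb P)^T *m mom_xy (emp s))).
  by rewrite olsE size_tuple.
apply: (eq_clsmx (fun s => esym (E s))).
have Hc (m p : nat) (A : n.-tuple (obs R d) -> 'M[R]_(m, p)) : clsmx (fun f => measurable_fun setT f) A ->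
   clsmx (fun f => measurable_fun setT f) (fun s => n%:R *: A s).
  by move=> mA i j; apply: eq_cls (clsZ H n%:R (mA i j)) => s; rewrite mxE.
apply: clsmxM => //; first by apply: measurable_invmx; apply: Hc; exact: measurable_Qhat.
apply: Hc => k j; rewrite (_ : (fun s => _) = fun s : n.-tuple (obs R d) => emp s (fun z => z.2 * tnth z.1 (enum_val k))); last first.
  by apply/funext => s; rewrite tr_emb_mul mxE.
apply: measurable_emp; apply: measurable_funM; [exact: measurable_snd|exact: measurable_covariate].
Qed.

Lemma measurable_ols_qf n P t : (0 < n)%N -> measurable_fun setT (fun s : n.-tuple (obs R d) =>
  qf (subgram (mom_xx (EX (G t))) P) (ols_err P t s) (ols_err P t s)).
Proof.
move=> n0; have H := @measurable_ring_class R _ (n.-tuple (obs R d)).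
have me : clsmx (fun f : n.-tuple (obs R d) -> R => measurable_fun setT f) (fun s => ols_err P t s).
  move=> k j; rewrite (_ : (fun s : n.-tuple (obs R d) => _) = fun s : n.-tuple (obs R d) => ols P s k j - ((emb P)^T *m slope (EX (G t)) P) k j).
    by apply: (clsB H); [exact: measurable_ols|exact: (cls_cst H)].
  by apply/funext => s; rewrite /ols_err mxE [X in _ + X]mxE.
by apply: (cls_qf H) => //; exact: (clsmx_cst H).
Qed.

Lemma integral_risk_ols P t n : (0 < n)%N ->
  (\int[iid n (G t) \x G t]_w ((resid (ols P w.1) w.2 ^+ 2)%R)%:E =
   (risk (EX (G t)) P)%:E + ols_excess P t n)%E.
Proof.
move=> n0; rewrite /ols_excess.
have q0 s : 0 <= qf (subgram (mom_xx (EX (G t))) P) (ols_err P t s) (ols_err P t s).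
  exact: (posdef_psd (subgram_posdef P (Q_posdef t))).2.
have r0 : 0 <= risk (EX (G t)) P by apply: (lfun_ge0 (lfun_G t)) => z; exact: sqr_ge0.
have H := @measurable_ring_class R _ (n.-tuple (obs R d) * obs R d)%type.
rewrite fubini_tonelli1; last 2 first.
- apply/measurable_EFinP; apply: (clsX H).
  rewrite (_ : (fun w => _) = fun w : n.-tuple (obs R d) * obs R d => w.2.2 - \sum_k ols P w.1 k ord0 * tnth w.2.1 (enum_val k)); last first.
    apply/funext => w; rewrite /resid mxE; congr (_ - _); apply: eq_bigr => k _.
    by rewrite mulrC !mxE.
  apply: (clsB H); first by apply: (@measurableT_comp _ _ _ _ _ _ snd) => //; exact: measurable_snd.
  apply: (cls_sum H) => k; apply: (clsM H).
    apply: (@measurableT_comp _ _ _ _ _ _ (fun s : n.-tuple (obs R d) => ols P s k ord0)) => //.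
    exact: measurable_ols.
  apply: (@measurableT_comp _ _ _ _ _ _ (fun z : obs R d => tnth z.1 (enum_val k))) => //.
  exact: measurable_covariate.
- by move=> w; rewrite lee_fin sqr_ge0.
rewrite /fubini_F; under eq_integral do rewrite risk_ols EFinD.
rewrite ge0_integralD//; last 2 first.
- by move=> s _; rewrite lee_fin; exact: q0.
- by apply/measurable_EFinP; exact: measurable_ols_qf.
by rewrite integral_cst//= probability_setT mule1.
Qed.

Lemma ols_err_bound P : exists2 c : R, 0 <= c & forall t n, (d < n)%N -> forall e : R, 0 < e ->
  {ae iid n (G t), forall s : n.-tuple (obs R d),
   `|qf (subgram (mom_xx (EX (G t))) P) (ols_err P t s) (ols_err P t s) - score_qf P t s|
   <= e * score_qf P t s + (1 + e^-1) * (c * remainder P t n s)}.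
Proof.
have [c c0 Hc] := remainder_bound P; exists c => // t n dn e e0.
have n0 : (0 < n)%N by exact: leq_ltn_trans dn.
have gP := gram_invertible t P dn; have gT := gram_invertible t [set: 'I_d]%SET dn.
apply: filterS2 gP gT => s gs gT.
have s0 : (0 < size s)%N by rewrite size_tuple.
have pQ := emp_Q_posdef s0 gT.
have -> : ols_err P t s = slope_err P t s.
  rewrite /ols_err /slope_err mulmxBr; congr (_ - _).
  by rewrite -(ols_slope s0 gs) (mulmxA (emb P)^T) embK mul1mx.
have pA := subgram_posdef P (Q_posdef t).
have hE : subgram (mom_xx (EX (G t))) P *m slope_err P t s =
   (emb P)^T *m score (emp s) (slope (EX (G t)) P) + gram_err P t s *m slope_err P t s.
  rewrite -(emp_gram_slope pQ (supported_slope (EX (G t)) P)) -/(slope_err P t s).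
  by rewrite /gram_err mulmxBl subrKC.
apply: (le_trans (perturbed_qf pA e0 hE)).
rewrite lerD2l ler_wpM2l//; last exact: Hc.
by rewrite addr_ge0// invr_ge0 ltW.
Qed.

Lemma integral_ols_qf P : exists (n0 : nat) (c : R), 0 <= c /\ forall t n, (n0 <= n)%N -> forall e : R,
  0 < e -> e <= 1 -> forall b : R, b = penalty (EX (G t)) P / n%:R ->
  ((b - (e * b + (1 + e^-1) * (c * n%:R ^- 2)))%:E <= ols_excess P t n <=
   (b + (e * b + (1 + e^-1) * (c * n%:R ^- 2)))%:E)%E.
Proof.
have [c1 c10 Hc1] := ols_err_bound P; have [n0 [c2 Hc2]] := integral_remainder P.
pose c := c1 * `|c2|; exists (maxn n0 d.+1), c; split; first by rewrite mulr_ge0.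
move=> t n; rewrite geq_max => /andP[n0n dn] e e0 e1 b bE; rewrite /ols_excess; set I := integral _ _ _.
have n_gt0 : (0 < n)%N by exact: leq_ltn_trans dn.
have mg := mom_score_qf P t n; have Eg := EX_score_qf P t n_gt0.
have g0 s : 0 <= score_qf P t s by exact: (invmx_psd (subgram_posdef P (Q_posdef t))).2.
have q0 s : 0 <= qf (subgram (mom_xx (EX (G t))) P) (ols_err P t s) (ols_err P t s).
  exact: (posdef_psd (subgram_posdef P (Q_posdef t))).2.
have r0 s : 0 <= (1 + e^-1) * (c1 * remainder P t n s).
  by rewrite mulr_ge0 ?addr_ge0 ?invr_ge0 ?(ltW e0)// mulr_ge0// remainder_ge0.
have mq := measurable_ols_qf P t n_gt0.
have mr : measurable_fun setT (fun s : n.-tuple (obs R d) => (1 + e^-1) * (c1 * remainder P t n s)).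
  by do 2 apply: measurable_funM => //; exact: measurable_remainder.
have iR : (\int[iid n (G t)]_s ((1 + e^-1) * (c1 * remainder P t n s))%:E <= ((1 + e^-1) * (c * n%:R ^- 2))%:E)%E.
  under eq_integral do rewrite mulrA EFinM.
  rewrite ge0_integralZl//; last 3 first.
  - by apply/measurable_EFinP; exact: measurable_remainder.
  - by move=> s _; rewrite lee_fin remainder_ge0.
  - by rewrite lee_fin mulr_ge0 ?addr_ge0 ?invr_ge0 ?(ltW e0).
  apply: (@le_trans _ _ (((1 + e^-1) * c1)%:E * (n%:R ^- 2 * c2)%:E)%E).
    by rewrite lee_wpmul2l ?Hc2// lee_fin mulr_ge0 ?addr_ge0 ?invr_ge0 ?(ltW e0).
  rewrite -EFinM lee_fin -mulrA ler_wpM2l ?addr_ge0 ?invr_ge0 ?(ltW e0)//.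
  rewrite /c -mulrA ler_wpM2l// mulrC ler_wpM2r ?ler_norm// invr_ge0 exprn_ge0//.
have Egk (k : R) : EX (iid n (G t)) (fun s => k * score_qf P t s) = k * b.
  by rewrite EX_Z// Eg bE; ring.
have mgk (k : R) : mom (iid n (G t)) (fun s => k * score_qf P t s).
  exact: (ubmM (mom_cst (iid n (G t)) k) mg).
apply/andP; split.
- have e10 : 0 <= 1 - e by rewrite subr_ge0.
  suff : (((1 - e) * b)%:E <= I + ((1 + e^-1) * (c * n%:R ^- 2))%:E)%E.
    rewrite -leeBlDr// -EFinB; apply: le_trans; rewrite lee_fin; lra.
  rewrite -Egk -EXE//; apply: le_trans (leeD2l _ iR).
  rewrite -ge0_integralD//; last 4 first.
  - by move=> s _; rewrite lee_fin; exact: q0.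
  - by apply/measurable_EFinP.
  - by move=> s _; rewrite lee_fin; exact: r0.
  - by apply/measurable_EFinP.
  apply: ae_ge0_le_integral => //.
  - by move=> s _; rewrite lee_fin mulr_ge0.
  - by apply/measurable_EFinP; exact: (mom_measurable (mgk _)).
  - by move=> s _; rewrite -EFinD lee_fin addr_ge0; [|exact: q0|exact: r0].
  - by apply: emeasurable_funD; apply/measurable_EFinP.
  apply: filterS (Hc1 t n dn e e0) => s H _.
  by move: H; rewrite -EFinD lee_fin ler_norml => /andP[]; lra.
- apply: (@le_trans _ _ (((1 + e) * b)%:E + ((1 + e^-1) * (c * n%:R ^- 2))%:E)%E); last first.
    by rewrite -EFinD lee_fin; lra.
  rewrite -Egk -EXE//; apply: le_trans (leeD2l _ iR).
  have e10 : 0 <= 1 + e by rewrite addr_ge0// ltW.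
  rewrite -ge0_integralD//; last 4 first.
  - by move=> s _; rewrite lee_fin mulr_ge0.
  - by apply/measurable_EFinP; exact: (mom_measurable (mgk _)).
  - by move=> s _; rewrite lee_fin; exact: r0.
  - by apply/measurable_EFinP.
  apply: ae_ge0_le_integral => //.
  - by move=> s _; rewrite lee_fin; exact: q0.
  - by apply/measurable_EFinP.
  - by move=> s _; rewrite -EFinD lee_fin; apply: addr_ge0; [exact: mulr_ge0|exact: r0].
  - by apply: emeasurable_funD; apply/measurable_EFinP => //; exact: (mom_measurable (mgk _)).
  apply: filterS (Hc1 t n dn e e0) => s H _.
  by move: H; rewrite -EFinD lee_fin ler_norml => /andP[]; lra.
Qed.

Variable mu : probability Theta R.
Hypothesis W_posdef : forall t P, posdefmx (Wmx (G t) P).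

Definition mean_risk P : R := EX mu (fun t => risk (EX (G t)) P).
Definition mean_penalty P : R := EX mu (fun t => penalty (EX (G t)) P).

Definition risk_optimal : {set {set 'I_d}} :=
  [set P | mean_risk P == mean_risk [set: 'I_d]%SET]%SET.

(* A model attains the risk of the full one on average iff almost surely its
   slope is the full slope, hence iff it contains the support of the full slope
   for almost all environments; so the intersection is again risk optimal. *)
Definition best_model : {set 'I_d} := (\bigcap_(P in risk_optimal) P)%SET.

Lemma AR_popE n P : AR_pop mu G n P = (mean_risk P + mean_penalty P / n%:R)%:E.
Proof.
have mr := mom_bounded mu (bounded_measurable_risk P).
have mp := mom_bounded mu (bounded_measurable_penalty P).
rewrite /AR_pop (eq_integral (fun t => (risk (EX (G t)) P + n%:R^-1 * penalty (EX (G t)) P)%:E)).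
  rewrite (EXE (ubmD mr (ubmM (mom_cst mu n%:R^-1) mp))) (EX_D mr (ubmM (mom_cst mu n%:R^-1) mp)).
  by rewrite (EX_Z _ mp) [n%:R^-1 * _]mulrC.
move=> t _; rewrite VmxE EFinD; congr (_ + _)%E.
under eq_integral do rewrite residE beta_slope.
by rewrite EXE//; exact: (clsX (lfun_ring (lfun_G t)) 2 (C_resid (lfun_G t) _)).
Qed.

Lemma R_pop_integrand P (e : R) : 0 < e -> exists n0 : nat, forall n, (n0 <= n)%N -> forall t,
  ((risk (EX (G t)) P + penalty (EX (G t)) P / n%:R - e / n%:R)%:E <=
   \int[iid n (G t) \x G t]_w ((resid (ols P w.1) w.2 ^+ 2)%R)%:E <=
   (risk (EX (G t)) P + penalty (EX (G t)) P / n%:R + e / n%:R)%:E)%E.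
Proof.
move=> e0; have [n0 [c [c0 Hc]]] := integral_ols_qf P.
have [B HB] := (bounded_measurable_penalty P).2.
pose r := Num.min 1 (e / 2 / (`|B| + 1)).
have B1 : 0 < `|B| + 1 by rewrite ltr_wpDl.
have r0 : 0 < r by rewrite lt_min ltr01 !divr_gt0.
have r1 : r <= 1 by rewrite ge_min lexx.
have rB : r * (`|B| + 1) <= e / 2 by rewrite -ler_pdivlMr// ge_min lexx orbT.
pose X := (1 + r^-1) * c / (e / 2).
have X0 : 0 <= X by rewrite !mulr_ge0 ?addr_ge0 ?invr_ge0 ?(ltW r0)// divr_ge0 ?(ltW e0).
exists (maxn n0 (Num.bound X)).+1 => n nn t.
have n_gt0 : (0 < n)%N by exact: leq_trans nn.
have nR0 : (0 : R) < n%:R by rewrite ltr0n.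
have /andP[nn0 nn1] : (n0 <= n)%N && (Num.bound X <= n)%N by rewrite -geq_max ltnW.
rewrite integral_risk_ols//.
have /andP[lo hi] := Hc t n nn0 r r0 r1 _ erefl.
set b := penalty (EX (G t)) P in lo hi *.
have bB : r * (b / n%:R) <= e / 2 / n%:R.
  rewrite mulrA ler_pM2r ?invr_gt0//; apply: le_trans rB.
  by rewrite ler_wpM2l ?(ltW r0)// (le_trans (ler_norm _))// (le_trans (HB t))// (le_trans (ler_norm _))// lerDl.
have cE : (1 + r^-1) * (c * n%:R ^- 2) <= e / 2 / n%:R.
  have : X <= n%:R by rewrite (le_trans (ltW (archi_boundP X0)))// ler_nat.
  rewrite ler_pdivrMr ?divr_gt0// => H.
  rewrite ler_pdivlMr// -(ler_pM2r nR0).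
  have fE (k y z : R) : y != 0 -> k * (z * y ^- 2) * y * y = k * z by move=> y0; field.
  by rewrite fE ?gt_eqF// [X in _ <= X]mulrC.
have eE : e / n%:R = e / 2 / n%:R + e / 2 / n%:R by rewrite -mulrDl -splitr.
apply/andP; split.
- rewrite -addrA EFinD leeD2l// (le_trans _ lo)// lee_fin; lra.
- rewrite -addrA EFinD leeD2l// (le_trans hi)// lee_fin; lra.
Qed.

Lemma R_pop_expansion (e : R) : 0 < e -> exists n0 : nat, forall n, (n0 <= n)%N -> forall P,
  ((mean_risk P + mean_penalty P / n%:R - e / n%:R)%:E <= R_pop mu G n P <=
   (mean_risk P + mean_penalty P / n%:R + e / n%:R)%:E)%E.
Proof.
move=> e0; have /choice [N HN] := fun P => R_pop_integrand P e0.
exists (\max_P N P).+1 => n nn P.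
have NP : (N P <= n)%N by rewrite (leq_trans _ (ltnW nn))// leq_bigmax.
have n_gt0 : (0 < n)%N by exact: leq_trans nn.
have nR0 : (0 : R) < n%:R by rewrite ltr0n.
have HC := @bounded_measurable_ring_class R _ Theta.
have bmf (k : R) : bounded_measurable (fun t => risk (EX (G t)) P + penalty (EX (G t)) P / n%:R + k).
  apply: (clsD HC); last exact: (cls_cst HC).
  apply: (clsD HC); first exact: bounded_measurable_risk.
  by apply: (clsM HC); [exact: bounded_measurable_penalty|exact: (cls_cst HC)].
have mr := mom_bounded mu (bounded_measurable_risk P).
have mp := mom_bounded mu (bounded_measurable_penalty P).
have mpn := ubmM mp (mom_cst mu n%:R^-1).
have E (k : R) : EX mu (fun t => risk (EX (G t)) P + penalty (EX (G t)) P / n%:R + k) =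
    mean_risk P + mean_penalty P / n%:R + k.
  by rewrite (EX_D (ubmD mr mpn) (mom_cst mu k)) (EX_D mr mpn) (EX_Zr _ mp) EX_cst.
have I0 t : (0 <= \int[iid n (G t) \x G t]_w ((resid (ols P w.1) w.2 ^+ 2)%R)%:E)%E.
  by apply: integral_ge0 => w _; rewrite lee_fin sqr_ge0.
have b0 (k : R) t : risk (EX (G t)) P + penalty (EX (G t)) P / n%:R + k <= Num.max 0 (risk (EX (G t)) P + penalty (EX (G t)) P / n%:R + k).
  by rewrite le_max lexx orbT.
apply/andP; split.
- rewrite -E.
  have bm : bounded_measurable (fun t => Num.max 0 (risk (EX (G t)) P + penalty (EX (G t)) P / n%:R - e / n%:R)).
    have [m1 [B HB]] := bmf (- (e / n%:R)); split.
      by apply: measurable_maxr.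
    exists B => t; apply: le_trans (HB t).
    by rewrite ger0_norm ?le_max ?lexx// ge_max normr_ge0 ler_norm.
  apply: (@le_trans _ _ (EX mu (fun t => Num.max 0 (risk (EX (G t)) P + penalty (EX (G t)) P / n%:R - e / n%:R)))%:E).
    by rewrite lee_fin; apply: EX_le => [||t]; [exact: mom_bounded (bmf _)|exact: mom_bounded|].
  rewrite -(EXE (mom_bounded mu bm)) /R_pop; apply: le_nnintegral => t.
    by rewrite lee_fin le_max lexx.
  have /andP[H _] := HN P n NP t; rewrite EFin_max ge_max; apply/andP; split => //; exact: I0.
- rewrite -E -(EXE (mom_bounded mu (bmf _))) /R_pop; apply: le_nnintegral => t; first exact: I0.
  by have /andP[_] := HN P n NP t.
Qed.

Lemma mom_riskB P P' : mom mu (fun t => risk (EX (G t)) P - risk (EX (G t)) P').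
Proof.
exact: (ubmB (mom_bounded mu (bounded_measurable_risk P)) (mom_bounded mu (bounded_measurable_risk P'))).
Qed.

Lemma mean_risk_setT P : mean_risk [set: 'I_d]%SET <= mean_risk P.
Proof.
apply: EX_le => [||t]; [exact: (mom_bounded mu (bounded_measurable_risk _))|exact: (mom_bounded mu (bounded_measurable_risk _))|].
exact: (risk_le_setT (lfun_G t) (Q_posdef t)).
Qed.

Lemma risk_optimal_ae : {ae mu, forall t, forall P, P \in risk_optimal ->
  risk (EX (G t)) P = risk (EX (G t)) [set: 'I_d]%SET}.
Proof.
apply: filter_forall => P.
have [/[!inE]/eqP PM|PM] := boolP (P \in risk_optimal); last by apply: nearW => t.
have : EX mu (fun t => risk (EX (G t)) P - risk (EX (G t)) [set: 'I_d]%SET) = 0.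
  rewrite (EX_B (mom_bounded mu (bounded_measurable_risk P)) (mom_bounded mu (bounded_measurable_risk _))).
  by apply/eqP; rewrite subr_eq0; apply/eqP.
move/EX_eq0 => /(_ (mom_riskB _ _)).
have H0 : {ae mu, forall t, 0 <= risk (EX (G t)) P - risk (EX (G t)) [set: 'I_d]%SET}.
  by apply: nearW => t; rewrite subr_ge0; exact: (risk_le_setT (lfun_G t) (Q_posdef t)).
move=> /(_ H0); apply: filterS => t H _.
by apply/eqP; rewrite -subr_eq0; apply/eqP.
Qed.

Lemma supported_bigcap (S : {set {set 'I_d}}) (b : 'cV[R]_d) :
  (forall P, P \in S -> supported P b) -> supported (\bigcap_(P in S) P)%SET b.
Proof.
move=> sb; apply: emb_id => i j /bigcapP iP.
have [P PS iNP] : exists2 P, P \in S & i \notin P.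
  have [/exists_inP[P PS iP']|/exists_inPn H] := boolP [exists P in S, i \notin P]; first by exists P.
  by case: iP => P /H; rewrite negbK.
by rewrite -(sb P PS) emb_outside.
Qed.

Lemma best_model_ae : {ae mu, forall t,
  (forall P, P \in risk_optimal -> risk (EX (G t)) P = risk (EX (G t)) best_model /\
     slope (EX (G t)) P = slope (EX (G t)) best_model) /\
  risk (EX (G t)) best_model = risk (EX (G t)) [set: 'I_d]%SET}.
Proof.
apply: filterS risk_optimal_ae => t H.
have HL := lfun_G t; have pQ := Q_posdef t.
have sE P : P \in risk_optimal -> slope (EX (G t)) P = slope (EX (G t)) [set: 'I_d]%SET.
  by move=> /H /(risk_eq_setT HL pQ).
have supp : supported best_model (slope (EX (G t)) [set: 'I_d]%SET).
  by apply: supported_bigcap => P PM; rewrite -(sE P PM); exact: supported_slope.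
have rE : risk (EX (G t)) best_model = risk (EX (G t)) [set: 'I_d]%SET.
  apply/eqP; rewrite eq_le (risk_le_setT HL pQ) andbT.
  exact: (risk_le HL pQ supp).
split=> // P PM; split; first by rewrite rE; exact: H.
by rewrite (sE P PM); apply/esym/(risk_eq_setT HL pQ).
Qed.

Lemma mean_risk_best : mean_risk best_model = mean_risk [set: 'I_d]%SET.
Proof.
apply: EX_ae_eq; [exact: (mom_bounded mu (bounded_measurable_risk _))|exact: (mom_bounded mu (bounded_measurable_risk _))|].
by apply: filterS best_model_ae => t [].
Qed.

Lemma best_model_sub P : P \in risk_optimal -> best_model \subset P.
Proof. move=> PM; exact: finset.bigcap_inf PM. Qed.

Lemma mean_risk_ge P : mean_risk best_model <= mean_risk P.
Proof. by rewrite mean_risk_best mean_risk_setT. Qed.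

Lemma mean_penalty_gt P : P != best_model -> mean_risk P = mean_risk best_model ->
  mean_penalty best_model < mean_penalty P.
Proof.
move=> PP0; rewrite mean_risk_best => /eqP aE.
have PM : P \in risk_optimal by rewrite inE.
have P0P : best_model \proper P by rewrite finset.properEneq eq_sym PP0 best_model_sub.
have mP := mom_bounded mu (bounded_measurable_penalty P).
have mP0 := mom_bounded mu (bounded_measurable_penalty best_model).
rewrite -subr_gt0 -(EX_B mP mP0); apply: EX_gt0; first exact: ubmB.
apply: filterS best_model_ae => t [/(_ P PM)[_ sE] _].
rewrite subr_gt0; apply: (penalty_lt (lfun_G t) (Q_posdef t) P0P sE).
by rewrite -WmxE; exact: W_posdef.
Qed.

Lemma Pstar_pop_eventually : exists n0 : nat, forall n, (n0 <= n)%N ->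
  Pstar_pop mu G n = [set best_model]%SET.
Proof. exact: (argmin_expansion mean_risk_ge mean_penalty_gt R_pop_expansion). Qed.

Lemma pistar_pop_eventually : exists n0 : nat, forall n, (n0 <= n)%N ->
  pistar_pop mu G n = [set best_model]%SET.
Proof.
apply: (argmin_expansion mean_risk_ge mean_penalty_gt) => e e0; exists 0%N => n _ P.
have en : 0 <= e / n%:R by rewrite divr_ge0 ?(ltW e0).
rewrite AR_popE !lee_fin; apply/andP; split; lra.
Qed.

Lemma close_forall (E : finType) (A : E -> Theta -> seq (obs R d) -> Prop) :
  (forall e, exists2 r : R, 0 < r & forall t s, moments_close G r t s -> A e t s) ->
  exists2 r : R, 0 < r & forall t s, moments_close G r t s -> forall e, A e t s.
Proof.
move=> H.
have /choice [r Hr] : forall e, exists r : R, 0 < r /\ forall t s, moments_close G r t s -> A e t s.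
  by move=> e; have [r r0 Hr] := H e; exists r.
exists (\big[Num.min/1]_e r e).
  by elim/big_ind: _ => // [x y x0 y0|e _]; [rewrite lt_min x0|exact: (Hr e).1].
move=> t s cl e; apply: (Hr e).2; apply: close_le cl.
by rewrite (bigminD1 e)// ge_min lexx.
Qed.

Lemma close_fails : exists2 K : R, 0 <= K & forall t (N M : nat) (e : R), 0 < e ->
  (0 < N)%N -> (N <= M)%N ->
  fails_le (iid M (G t)) (K / (N%:R * e ^+ 2)) (fun x => moments_close G e t (take N x)).
Proof.
have /choice [K HK] := fun q => ubm_fails (ubm_emp (ubm_monomial ubm_response ubm_covariate q)).
exists (\sum_q K q); first by apply: sumr_ge0 => q _; exact: (HK q).1.
move=> t N M e e0 N0 NM; have NR : (0 : R) < N%:R by rewrite ltr0n.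
have sN : 0 < Num.sqrt (N%:R : R) by rewrite sqrtr_gt0.
rewrite mulr_suml; apply: fails_le_forall => q.
have := (HK q).2 (t, N, M) _ (mulr_gt0 sN e0); apply: fails_leW => [|x].
  by rewrite exprMn sqr_sqrtr// ltW.
rewrite size_takel ?size_tuple// normrM (gtr0_norm sN) ltr_pM2l//.
exact: ltW.
Qed.

Lemma uniform_consistency (e : R) : 0 < e -> exists2 r : R, 0 < r & forall t s, moments_close G r t s ->
  (forall P, [/\ subgram (mom_xx (emp s)) P \in unitmx,
     `|risk (emp s) P - risk (EX (G t)) P| <= e,
     `|penalty (emp s) P - penalty (EX (G t)) P| <= e &
     forall i j, `|subinv (mom_xx (emp s)) P i j - subinv (mom_xx (EX (G t))) P i j| <= e]).
Proof.
move=> e0; have [B HB] := Qinv_uniformly_bounded.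
apply: close_forall => P.
have [r1 r10 H1] := close_unit ubm_response ubm_covariate Q_posdef HB P.
have [r2 r20 H2] := (consistent_risk ubm_response ubm_covariate Q_posdef HB P).2 e e0.
have [r3 r30 H3] := (consistent_penalty ubm_response ubm_covariate Q_posdef HB P).2 e e0.
have [r4 r40 H4] : exists2 r : R, 0 < r & forall t s, moments_close G r t s -> forall ij : 'I_d * 'I_d,
    `|subinv (mom_xx (emp s)) P ij.1 ij.2 - subinv (mom_xx (EX (G t))) P ij.1 ij.2| <= e.
  apply: close_forall => ij.
  exact: (consistent_subinv ubm_response ubm_covariate Q_posdef HB P ij.1 ij.2).2 e e0.
exists (Num.min (Num.min r1 r2) (Num.min r3 r4)); first by rewrite !lt_min r10 r20 r30.
move=> t s cl; split.
- by apply: (H1 t); apply: close_le cl; rewrite !ge_min lexx.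
- by apply: H2; apply: close_le cl; rewrite !ge_min lexx orbT.
- by apply: H3; apply: close_le cl; rewrite !ge_min lexx !orbT.
- by move=> i j; apply: (H4 t s _ (i, j)); apply: close_le cl; rewrite !ge_min lexx !orbT.
Qed.

Lemma criterionE J n (D : 'I_J -> seq (obs R d)) P :
  (forall j, (0 < size (D j))%N) ->
  (forall j, subgram (mom_xx (emp (D j))) P \in unitmx) ->
  criterion n D P = J%:R^-1 * \sum_(j < J)
    (risk (emp (D j)) P + penalty (emp (D j)) P * (n%:R^-1 + (size (D j))%:R^-1)).
Proof.
move=> s0 U; rewrite /criterion; congr (_ * _); apply: eq_bigr => j _.
have gU : gram P (D j) \in unitmx by rewrite gram_unit.
by rewrite risk_emp// penalty_emp.
Qed.

Lemma penalty_bound : exists2 B : R, 0 <= B & forall t P, `|penalty (EX (G t)) P| <= B.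
Proof.
have /choice [B HB] : forall P, exists B : R, forall t, `|penalty (EX (G t)) P| <= B.
  by move=> P; have [] := bounded_measurable_penalty P.
exists (\sum_P `|B P|); first exact: sumr_ge0.
move=> t P; apply: le_trans (HB P t) _.
by rewrite (bigD1 P)//= (le_trans (ler_norm _))// lerDl sumr_ge0.
Qed.

Lemma close_data_fails (J : nat) (e q : R) : 0 < e -> 0 < q -> exists2 M0 : nat, (0 < M0)%N &
  forall (N : 'rV[nat]_J), (forall j, (M0 <= N ord0 j)%N) -> forall t : J.-tuple Theta,
  fails_le (prod_prob (fun j => iid (\max_(k < J) N ord0 k)%N (G (tnth t j)))) q
    (fun x => forall j, moments_close G e (tnth t j) (take (N ord0 j) (tnth x j))).
Proof.
move=> e0 q0; have [K K0 HK] := close_fails.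
pose X : R := J%:R * K / (e ^+ 2 * q).
have X0 : 0 <= X by rewrite divr_ge0 ?mulr_ge0// ?exprn_ge0 ltW.
exists (Num.bound X).+1 => // N NM t.
have NJ j : (N ord0 j <= \max_(k < J) N ord0 k)%N by rewrite (leq_bigmax j).
have N0 j : (0 < N ord0 j)%N by exact: leq_trans (NM j).
have := @fails_le_forall _ _ _ (prod_prob (fun j => iid (\max_(k < J) N ord0 k)%N (G (tnth t j)))) _ _ _
  (fun j => @fails_le_tnth _ _ _ J (fun j => iid (\max_(k < J) N ord0 k)%N (G (tnth t j))) j _ _ (HK (tnth t j) _ _ e e0 (N0 j) (NJ j))).
apply: fails_leW => //.
have [J0|J0] := posnP J; first by rewrite big1 ?(ltW q0)// => j; have := ltn_ord j; rewrite [X in (_ < X)%N]J0.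
apply: (@le_trans _ _ (\sum_(j < J) q / J%:R)); last first.
  by rewrite sumr_const card_ord -[_ *+ _]mulr_natr divfK// pnatr_eq0 -lt0n.
apply: ler_sum => j _; have NR : (0 : R) < (N ord0 j)%:R by rewrite ltr0n.
have JR : (0 : R) < J%:R by rewrite ltr0n.
rewrite ler_pdivrMr ?mulr_gt0 ?exprn_gt0// mulrAC ler_pdivlMr//.
have : X <= (N ord0 j)%:R.
  by rewrite (le_trans (ltW (archi_boundP X0)))// ler_nat ltnW// NM.
rewrite ler_pdivrMr ?mulr_gt0 ?exprn_gt0//.
lra.
Qed.

Lemma selection_fixed_n (n J : nat) (g q : R) : (0 < n)%N -> (0 < J)%N -> 0 < g -> 0 < q ->
  exists M0 : nat, forall (N : 'rV[nat]_J), (forall j, (M0 <= N ord0 j)%N) ->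
  forall (t : J.-tuple Theta) (S : {set {set 'I_d}}) P0,
  (forall P, P \notin S -> g <= J%:R^-1 * \sum_(j < J)
     (risk (EX (G (tnth t j))) P - risk (EX (G (tnth t j))) P0
      + (penalty (EX (G (tnth t j))) P - penalty (EX (G (tnth t j))) P0) / n%:R)) ->
  fails_le (prod_prob (fun j => iid (\max_(k < J) N ord0 k)%N (G (tnth t j)))) q
    (fun x => pihat n (fun j => take (N ord0 j) (tnth x j)) \subset S).
Proof.
move=> n0 J0 g0 q0; have nR : (0 : R) < n%:R by rewrite ltr0n.
have JR : (0 : R) < J%:R by rewrite ltr0n.
pose e := g / 12; have e0 : 0 < e by rewrite divr_gt0.
have [r r0 Hr] := uniform_consistency e0.
have [B B0 HB] := penalty_bound.
have [M1 M10 HM1] := @close_data_fails J r q r0 q0.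
pose X : R := B / e; have X0 : 0 <= X by rewrite divr_ge0// ltW.
exists (maxn M1 (Num.bound X)) => N NM t S P0 HS.
have NM1 j : (M1 <= N ord0 j)%N by rewrite (leq_trans _ (NM j)) ?leq_maxl.
have NX j : B / (N ord0 j)%:R <= e.
  have NR : (0 : R) < (N ord0 j)%:R by rewrite ltr0n (leq_trans M10).
  rewrite ler_pdivrMr// mulrC -ler_pdivrMr// (le_trans (ltW (archi_boundP X0)))//.
  by rewrite ler_nat (leq_trans _ (NM j)) ?leq_maxr.
apply: fails_leW (HM1 N NM1 t) => // x cl; apply/fintype.subsetP => P.
rewrite inE => /forallP /(_ P0) PP0; apply/negPn/negP => PS.
have sz j : size (take (N ord0 j) (tnth x j)) = N ord0 j.
  by rewrite size_takel// size_tuple (leq_bigmax j).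
have sz0 j : (0 < size (take (N ord0 j) (tnth x j)))%N by rewrite sz (leq_trans M10).
have U P' j : subgram (mom_xx (emp (take (N ord0 j) (tnth x j)))) P' \in unitmx.
  by have [] := Hr _ _ (cl j) P'.
have n1 : n%:R^-1 <= 1 :> R by rewrite invf_le1// ler1n.
have err P' : `|criterion n (fun j => take (N ord0 j) (tnth x j)) P' -
   J%:R^-1 * \sum_(j < J) (risk (EX (G (tnth t j))) P' + penalty (EX (G (tnth t j))) P' / n%:R)| <= 4 * e.
  rewrite criterionE// -mulrBr -sumrB normrM gtr0_norm ?invr_gt0//.
  rewrite ler_pdivrMl//; apply: (le_trans (ler_norm_sum _ _ _)).
  apply: (@le_trans _ _ (\sum_(j < J) (4 * e))); last by rewrite sumr_const card_ord -[X in X <= _]mulr_natl.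
  apply: ler_sum => j _; have [_ h1 h2 _] := Hr _ _ (cl j) P'; rewrite sz.
  set r1 := risk (emp _) _ in h1 *; set r2 := risk _ _ in h1 *.
  set p1 := penalty (emp _) _ in h2 *; set p2 := penalty _ _ in h2 *.
  set u := n%:R^-1 in n1 *; set v := (N ord0 j)%:R^-1.
  have u0 : 0 <= u by rewrite invr_ge0.
  have v0 : 0 <= v by rewrite invr_ge0.
  have v1 : v <= 1 by rewrite invf_le1 ?ler1n ?ltr0n// (leq_trans M10).
  have p2v : `|p2 * v| <= e.
    by rewrite normrM (ger0_norm v0) (le_trans _ (NX j))// ler_wpM2r// HB.
  have -> : r1 + p1 * (u + v) - (r2 + p2 * u) = (r1 - r2) + (p1 - p2) * (u + v) + p2 * v by ring.
  have : `|(p1 - p2) * (u + v)| <= e * 2.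
    by rewrite normrM (ger0_norm (addr_ge0 u0 v0)) ler_pM// ?addr_ge0//; lra.
  move: h1 p2v; rewrite !ler_norml => /andP[? ?] /andP[? ?] /andP[? ?]; apply/andP; split; lra.
have := err P; have := err P0; have := HS P PS.
under eq_bigr do rewrite mulrBl addrACA -opprD.
rewrite sumrB mulrBr; move: PP0; rewrite !ler_norml => + + /andP[+ +] /andP[].
rewrite (_ : g = 12 * e); last by rewrite /e; field.
lra.
Qed.

Definition gap (P P' : {set 'I_d}) t : R :=
  if P \in risk_optimal then penalty (EX (G t)) P - penalty (EX (G t)) P'
  else risk (EX (G t)) P - risk (EX (G t)) P'.

Definition regular t : Prop :=
  (forall P, P \in risk_optimal -> risk (EX (G t)) P = risk (EX (G t)) best_model /\
     slope (EX (G t)) P = slope (EX (G t)) best_model) /\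
  risk (EX (G t)) best_model = risk (EX (G t)) [set: 'I_d]%SET.

Definition separated_by (g : R) J (t : J.-tuple Theta) : Prop :=
  (forall j, regular (tnth t j)) /\ forall P, P != best_model ->
    g <= J%:R^-1 * \sum_(j < J) gap P best_model (tnth t j).

Lemma family_average_fails (f : {set 'I_d} -> Theta -> R) (S : pred {set 'I_d}) :
  (forall P, mom mu (f P)) -> (forall P, S P -> 0 < EX mu (f P)) ->
  exists2 g : R, 0 < g & exists2 K : R, 0 <= K & forall J : nat, (0 < J)%N ->
    fails_le (iid J mu) (K / J%:R) (fun t => forall P, S P ->
      g <= J%:R^-1 * \sum_(j < J) f P (tnth t j)).
Proof.
move=> mf f0.
pose m P := if S P then EX mu (f P) / 2 else 1.
have m0 P : 0 < m P by rewrite /m; case: ifP => // /f0 SP; rewrite divr_gt0.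
have /choice [K HK] : forall P, exists K : R, 0 <= K /\ (S P -> forall J : nat, (0 < J)%N ->
    fails_le (iid J mu) (K / J%:R) (fun t => m P < J%:R^-1 * \sum_(j < J) f P (tnth t j))).
  move=> P; case SP : (S P); last by exists 0.
  have mE : m P < EX mu (f P) by rewrite /m SP ltr_pdivrMr// ltr_pMr ?f0// ltr1n.
  by have [K K0 HK] := iid_average_fails (mf P) mE; exists K.
exists (\big[Num.min/1]_P m P).
  by elim/big_ind: _ => // x y x0 y0; rewrite lt_min x0.
exists (\sum_P K P); first by apply: sumr_ge0 => P _; exact: (HK P).1.
move=> J J0; rewrite mulr_suml.
have := @fails_le_forall _ _ _ (iid J mu) _ (fun P => K P / J%:R)
  (fun P t => S P -> m P < J%:R^-1 * \sum_(j < J) f P (tnth t j)).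
have HP P : fails_le (iid J mu) (K P / J%:R) (fun t => S P -> m P < J%:R^-1 * \sum_(j < J) f P (tnth t j)).
  case SP : (S P).
    by apply: fails_leW ((HK P).2 SP J J0).
  by apply: fails_leW (fails_le_sure (iid J mu) (fun _ => I)) => //; rewrite divr_ge0// (HK P).1.
move=> /(_ HP); apply: fails_leW => // t H P SP; apply: (le_trans _ (ltW (H P SP))).
by rewrite (bigminD1 P)// ge_min lexx.
Qed.

Lemma mom_gap P P' : mom mu (gap P P').
Proof.
rewrite /gap; case: (P \in risk_optimal); apply: ubmB; apply: mom_bounded;
  [exact: bounded_measurable_penalty|exact: bounded_measurable_penalty|
   exact: bounded_measurable_risk|exact: bounded_measurable_risk].
Qed.

Lemma EX_gap_gt0 P : P != best_model -> 0 < EX mu (gap P best_model).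
Proof.
move=> PP0; rewrite /gap.
have mr P' := mom_bounded mu (bounded_measurable_risk P').
have mp P' := mom_bounded mu (bounded_measurable_penalty P').
have opt : best_model \in risk_optimal.
  rewrite inE; apply/eqP; exact: (EX_ae_eq (mr _) (mr _)
   (filterS (fun t (H : regular t) => H.2) best_model_ae)).
have optE : mean_risk best_model = mean_risk [set: 'I_d]%SET.
  by apply/eqP; move: opt; rewrite inE.
case: (boolP (P \in risk_optimal)) => PM.
  rewrite (EX_B (mp P) (mp best_model)) subr_gt0; apply: (mean_penalty_gt PP0).
  by rewrite optE; apply/eqP; move: PM; rewrite inE.
rewrite (EX_B (mr P) (mr best_model)) subr_gt0 lt_neqAle mean_risk_ge andbT.
by apply: contra PM => /eqP E; rewrite inE -optE; apply/eqP/esym.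
Qed.

Lemma separated_fails : exists2 g : R, 0 < g & exists2 K : R, 0 <= K & forall J : nat, (0 < J)%N ->
  fails_le (iid J mu) (K / J%:R) (separated_by g (J := J)).
Proof.
have [g g0 [K K0 HK]] := @family_average_fails (fun P => gap P best_model)
  (fun P => P != best_model) (fun P => mom_gap P _) (fun P => @EX_gap_gt0 P).
exists g => //; exists K => // J J0.
have reg j : fails_le (iid J mu) 0 (fun t => regular (tnth t j)).
  apply: (@fails_le_tnth _ _ _ J (fun=> mu) j 0 regular).
  by apply: fails_le_ae; exact: best_model_ae.
apply: fails_leW (fails_le_and (fails_le_forall reg) (HK J J0)) => [|t [rt st]]; last by split.
by rewrite big1 ?add0r.
Qed.

Definition selection_bound n (K : R) : Prop := forall J : nat, (0 < J)%N ->
  ((1 - K / J%:R)%:E <= limf_einf (fun N : 'rV[nat]_J =>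
     data_prob mu G N [set D | pihat n D \subset pistar_pop mu G n]) (sizes_oo J))%E.

Lemma liminf_fixed_n (n : nat) (K g : R) P0 : (0 < n)%N -> 0 <= K -> 0 < g ->
  (forall J : nat, (0 < J)%N -> fails_le (iid J mu) (K / J%:R) (fun t => forall P,
     P \notin pistar_pop mu G n -> g <= J%:R^-1 * \sum_(j < J)
     (risk (EX (G (tnth t j))) P - risk (EX (G (tnth t j))) P0
      + (penalty (EX (G (tnth t j))) P - penalty (EX (G (tnth t j))) P0) / n%:R))) ->
  selection_bound n K.
Proof.
move=> n0 K0 g0 H J J0; apply: limf_einf_ge => e e0.
have [M0 HM] := selection_fixed_n n0 J0 g0 e0.
exists [set N : 'rV[nat]_J | forall j, (M0 <= N ord0 j)%N]; first by exists M0.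
move=> N /= NM.
have KJ : 0 <= K / J%:R by rewrite divr_ge0.
have := data_prob_ge (N := N) (E := [set D | pihat n D \subset pistar_pop mu G n]) KJ (ltW e0) (H J J0).
rewrite -addrA -opprD; apply => t Ht.
exact: HM NM t _ P0 Ht.
Qed.

Lemma liminf_small_n (n : nat) : (0 < n)%N -> exists2 K : R, 0 <= K & selection_bound n K.
Proof.
move=> n0.
pose v P := mean_risk P + mean_penalty P / n%:R.
have [P0 P0min] : exists P0, forall P, v P0 <= v P.
  by case: (arg_minP v (i0 := [set: 'I_d]%SET) (P := predT) isT) => P1 _ H; exists P1 => P; exact: H.
have ARE P : AR_pop mu G n P = (v P)%:E by exact: AR_popE.
have mr P := mom_bounded mu (bounded_measurable_risk P).
have mp P := mom_bounded mu (bounded_measurable_penalty P).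
pose f P t := risk (EX (G t)) P - risk (EX (G t)) P0
      + (penalty (EX (G t)) P - penalty (EX (G t)) P0) / n%:R.
have mpn P := ubmM (ubmB (mp P) (mp P0)) (mom_cst mu n%:R^-1).
have mf P : mom mu (f P) by exact: (ubmD (ubmB (mr P) (mr P0)) (mpn P)).
have f0 P : P \notin pistar_pop mu G n -> 0 < EX mu (f P).
  move=> PS; rewrite (EX_D (ubmB (mr P) (mr P0)) (mpn P)) (EX_B (mr P) (mr P0)).
  rewrite (EX_Zr _ (ubmB (mp P) (mp P0))) (EX_B (mp P) (mp P0)).
  have aux (a b c e u : R) : a + b * u < c + e * u -> 0 < c - a + (e - b) * u.
    by move=> H; rewrite mulrBl; lra.
  have vP : v P0 < v P.
    rewrite lt_neqAle P0min andbT; apply: contra PS => /eqP vE.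
    rewrite inE; apply/forallP => P'.
    by rewrite !ARE lee_fin -vE; exact: P0min.
  exact: aux vP.
have [g g0 [K K0 HK]] := @family_average_fails f (fun P => P \notin pistar_pop mu G n) mf f0.
by exists K => //; exact: (liminf_fixed_n n0 K0 g0 HK).
Qed.

Lemma liminf_large_n : exists (n1 : nat) (K : R), 0 <= K /\ forall n, (n1 <= n)%N ->
  selection_bound n K.
Proof.
have [n2 Hn2] := pistar_pop_eventually.
have [g g0 [K K0 HK]] := separated_fails.
have [B B0 HB] := penalty_bound.
pose X : R := 4 * B / g; have X0 : 0 <= X by rewrite divr_ge0 ?mulr_ge0// ltW.
exists (maxn n2 (Num.bound X)).+1, K; split=> // n nn.
have n0 : (0 < n)%N by exact: leq_trans nn.
have nR : (0 : R) < n%:R by rewrite ltr0n.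
have /andP[nn2 nX] : (n2 <= n)%N && (Num.bound X <= n)%N by rewrite -geq_max ltnW.
have Bn : 2 * B / n%:R <= g / 2.
  have : X <= n%:R by rewrite (le_trans (ltW (archi_boundP X0)))// ler_nat.
  by rewrite ler_pdivrMr// ler_pdivrMr//; lra.
pose e := Num.min (g / 2) (g / n%:R).
have e0 : 0 < e by rewrite lt_min !divr_gt0.
apply: (@liminf_fixed_n n K e best_model) => // J J0.
have JR : (0 : R) < J%:R by rewrite ltr0n.
apply: fails_leW (HK J J0) => // t [reg sep] P.
rewrite Hn2// inE => PP0; have := sep P PP0.
rewrite /gap; case: (boolP (P \in risk_optimal)) => PM.
- move=> H; rewrite (eq_bigr (fun j => (penalty (EX (G (tnth t j))) P - penalty (EX (G (tnth t j))) best_model) / n%:R)); last first.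
    by move=> j _; have [/(_ P PM)[-> _] _] := reg j; rewrite subrr add0r.
  rewrite -mulr_suml mulrA ge_min; apply/orP; right.
  by rewrite ler_pM2r ?invr_gt0.
- move=> H; rewrite big_split /= mulrDr.
  rewrite ge_min; apply/orP; left.
  have : `|J%:R^-1 * \sum_(j < J) (penalty (EX (G (tnth t j))) P - penalty (EX (G (tnth t j))) best_model) / n%:R| <= 2 * B / n%:R.
    rewrite normrM gtr0_norm ?invr_gt0// ler_pdivrMl// (le_trans (ler_norm_sum _ _ _))//.
    apply: (@le_trans _ _ (\sum_(j < J) (2 * B / n%:R))); last first.
      by rewrite sumr_const card_ord -[X in X <= _]mulr_natl.
    apply: ler_sum => j _; rewrite normrM [`|n%:R^-1|]gtr0_norm ?invr_gt0// ler_pM2r ?invr_gt0//.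
    by rewrite (le_trans (ler_normB _ _))// mulr2n mulrDl mul1r lerD.
  by rewrite ler_norml => /andP[? _]; lra.
Qed.

Lemma liminf_all_n : exists2 K : R, 0 <= K & forall n : nat, (0 < n)%N -> selection_bound n K.
Proof.
have [n1 [K [K0 HK]]] := liminf_large_n.
have /choice [k Hk] : forall n : nat, exists k : R, 0 <= k /\ ((0 < n)%N -> selection_bound n k).
  move=> n; have [n0|n0] := posnP n; first by exists 0; split=> //; rewrite n0.
  by have [k k0 Hk] := liminf_small_n n0; exists k.
have s0 : 0 <= \sum_(n < n1) k n by apply: sumr_ge0 => i _; exact: (Hk i).1.
exists (K + \sum_(n < n1) k n); first by rewrite addr_ge0.
move=> n n0 J J0; have JR : (0 : R) < J%:R by rewrite ltr0n.
have [nn1|nn1] := leqP n1 n.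
  apply: le_trans (HK n nn1 J J0).
  by rewrite lee_fin lerD2l lerN2 ler_pM2r ?invr_gt0// lerDl.
apply: le_trans ((Hk n).2 n0 J J0).
rewrite lee_fin lerD2l lerN2 ler_pM2r ?invr_gt0//.
rewrite (bigD1 (Ordinal nn1))//= addrCA lerDl addr_ge0// sumr_ge0// => i _.
exact: (Hk i).1.
Qed.

Definition bscore (k : 'I_d) t (z : obs R d) : R :=
  residX (slope (EX (G t)) best_model) z * tnth z.1 k.

(* Up to a small error, minus the sample size times the difference of the
   empirical risks of [P] and [best_model]: a quadratic form in the normalized
   score, whose mean is exactly the difference of the two penalties. *)
Definition quad P t (s : seq (obs R d)) : R :=
  (size s)%:R * qf (subinvB (mom_xx (EX (G t))) P best_model)
    (score (emp s) (slope (EX (G t)) best_model))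
    (score (emp s) (slope (EX (G t)) best_model)).

Lemma quadE P t s : quad P t s = \sum_k \sum_l
  subinvB (mom_xx (EX (G t))) P best_model k l *
  ((size s)%:R * (emp s (bscore k t) * emp s (bscore l t))).
Proof.
rewrite /quad qfE mulr_sumr; apply: eq_bigr => k _; rewrite mulr_sumr; apply: eq_bigr => l _.
by rewrite [score _ _ k _]mxE [score _ _ l _]mxE -/(bscore k t) -/(bscore l t); ring.
Qed.

Lemma ubm_bscore k : ubm G (bscore k).
Proof. by apply: ubmM; [exact: ubm_resid|exact: ubm_covariate]. Qed.

Lemma EX_bscore t k : regular t -> EX (G t) (bscore k t) = 0.
Proof.
move=> [_ rE]; have sE := risk_eq_setT (lfun_G t) (Q_posdef t) rE.
have := slope_score (lfun_G t) (Q_posdef t) [set: 'I_d]%SET.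
have kT : k \in [set: 'I_d]%SET by rewrite inE.
move=> /matrixP/(_ (enum_rank_in kT k) ord0).
by rewrite tr_emb_mul enum_rankK_in// !mxE -sE.
Qed.

Lemma EX_quad t P N M : regular t -> P \in risk_optimal -> (0 < N <= M)%N ->
  EX (iid M (G t)) (fun x => quad P t (take N x)) =
  penalty (EX (G t)) P - penalty (EX (G t)) best_model.
Proof.
move=> rt PM /andP[N0 NM]; have M0 : (0 < M)%N by exact: leq_trans NM.
have mb k := ubm_at t (ubm_bscore k).
have NM0 : minn N M != 0%N by rewrite (minn_idPl NM) -lt0n.
have me k l : mom (iid M (G t)) (fun x => (size (take N x))%:R *
    (emp (take N x) (bscore k t) * emp (take N x) (bscore l t))).
  apply: (eq_ubm _ (ubmM (mom_cst (iid M (G t)) (size (take N (nseq M (0%N))))%:R)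
    (ubmM (mom_emp N M (mb k)) (mom_emp N M (mb l))))) => _ x.
  by rewrite !size_take_min size_nseq size_tuple.
rewrite (_ : (fun x => _) = fun x : M.-tuple (obs R d) => \sum_k \sum_l
  subinvB (mom_xx (EX (G t))) P best_model k l *
  ((size (take N x))%:R * (emp (take N x) (bscore k t) * emp (take N x) (bscore l t)))); last first.
  by apply/funext => x; exact: quadE.
have mk k l := ubmM (mom_cst (iid M (G t)) (subinvB (mom_xx (EX (G t))) P best_model k l)) (me k l).
rewrite EX_sum; last by move=> k; apply: ubm_sum => l; exact: mk.
have [/(_ P PM)[_ sE] _] := rt.
rewrite /penalty sE -linearB -mulmxBr /= -/(subinvB _ _ _) mxtrace_mulC.
apply: eq_bigr => k _; rewrite EX_sum; last by move=> l; exact: mk.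
rewrite mxE; apply: eq_bigr => l _; rewrite (EX_Z _ (me k l)).
rewrite (EX_emp2 M0 (mb k) (mb l) (EX_bscore _ rt) (EX_bscore _ rt)) NM0 mul1r [wmom _ _ l k]mxE; congr (_ * EX _ _).
by apply/funext => z; rewrite /bscore; ring.
Qed.

Lemma ubm_quad P : ubm (fun i : {t | regular t} * nat * nat => iid i.2 (G (sval i.1.1)))
  (fun i x => quad P (sval i.1.1) (take i.1.2 x)).
Proof.
have u k := ubm_reindex (fun i : {t | regular t} * nat * nat => (sval i.1.1, i.1.2, i.2)) (ubm_emp (ubm_bscore k)).
have /choice [B HB] : forall kl : 'I_d * 'I_d, exists B : R, forall t,
    `|subinvB (mom_xx (EX (G t))) P best_model kl.1 kl.2| <= B.
  move=> [k l]; have bm P' := clsmx_subinv (@bounded_measurable_ring_class R _ Theta)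
    bounded_measurable_Qinv P' k l.
  have [_ [B1 H1]] := bm P; have [_ [B2 H2]] := bm best_model.
  exists ((B1 : R) + B2) => t /=; rewrite [subinvB _ _ _ _ _]mxE [X in `|_ + X|]mxE.
  by rewrite (le_trans (ler_normB _ _))// lerD.
have uc k l : ubm (fun i : {t | regular t} * nat * nat => iid i.2 (G (sval i.1.1)))
    (fun i _ => subinvB (mom_xx (EX (G (sval i.1.1)))) P best_model k l).
  by apply: ubm_cst => i; exact: (HB (k, l)).
have us := ubm_sum (index_enum 'I_d) xpredT
  (fun k => ubm_sum (index_enum 'I_d) xpredT (fun l => ubmM (uc k l) (ubmM (u k) (u l)))).
apply: (eq_ubm _ us).
move=> [[[t rt] N] M] x /=; rewrite quadE.
apply: eq_bigr => k _; apply: eq_bigr => l _; rewrite !EX_bscore// !subr0; congr (_ * _).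
by rewrite mulrACA -expr2 sqr_sqrtr.
Qed.

Lemma quad_average_fails (C e : R) P : 0 <= C -> 0 < e -> exists K : R, 0 <= K /\
  forall J : nat, (0 < J)%N -> forall (t : J.-tuple Theta) (N : 'I_J -> nat) M (c : 'I_J -> R),
  (forall j, regular (tnth t j)) -> (forall j, `|c j| <= C) ->
  fails_le (prod_prob (fun j => iid M (G (tnth t j)))) (K / J%:R)
   (fun x => `|J%:R^-1 * \sum_(j < J) c j * (quad P (tnth t j) (take (N j) (tnth x j)) -
       EX (iid M (G (tnth t j))) (fun x => quad P (tnth t j) (take (N j) x)))| < e).
Proof.
move=> C0 e0.
pose I0 : Type := ({t | regular t} * nat * nat * {c : R | `|c| <= C})%type.
pose h (i : I0) := i.1.
have uq := ubm_reindex h (ubm_quad P).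
have [B HB] := ubm_EX_bound uq.
have uE := @ubm_cst _ _ _ _ (fun i : I0 => iid i.1.2 (G (sval i.1.1.1))) _ B HB.
have uc := @ubm_cst _ _ _ _ (fun i : I0 => iid i.1.2 (G (sval i.1.1.1))) (fun i => sval i.2) C (fun i => svalP i.2).
have uf := ubmM uc (ubmB uq uE).
pose I1 : Type := {J : nat & ('I_J -> {t | regular t} * nat * {c : R | `|c| <= C}) * nat}%type.
pose ix (i : I1) (j : 'I_(tag i)) : I0 := (((tagged i).1 j).1, (tagged i).2, ((tagged i).1 j).2).
have := @ubm_nsum R I1 _ (fun i => (tagged i).2.-tuple (obs R d)) (fun i => tag i)
  (fun i j => iid (tagged i).2 (G (sval ((tagged i).1 j).1.1))) (fun _ => predT)
  (fun i j x => sval (ix i j).2 * (quad P (sval (ix i j).1.1.1) (take (ix i j).1.1.2 x)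
     - EX (iid (tagged i).2 (G (sval (ix i j).1.1.1))) (fun x => quad P (sval (ix i j).1.1.1) (take (ix i j).1.1.2 x)))).
move=> /(_ (fun i j _ => uf.1 (ix i j))) un.
unshelve epose proof (un _ _) as us.
- by move=> k; have [b Hb] := uf.2 k; exists b => i j _; exact: (Hb (ix i j)).
- move=> i j _; have mq := ubm_at (ix i j) uq.
  rewrite EX_Z; last exact: (ubmB mq (mom_cst _ _)).
  by rewrite (EX_B mq (mom_cst _ _)) EX_cst subrr mulr0.
have [K [K0 HK]] := ubm_fails us; exists (K / e ^+ 2); split; first by rewrite divr_ge0// exprn_ge0// ltW.
move=> J J0 t N M c rt cC; have JR : (0 : R) < J%:R by rewrite ltr0n.
have sJ : 0 < Num.sqrt (J%:R : R) by rewrite sqrtr_gt0.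
have se : 0 < Num.sqrt J%:R * e by rewrite mulr_gt0.
have Jn : (\sum_(j < J) true)%N = J by rewrite sum_nat_const card_ord muln1.
pose i : I1 := existT _ J (fun j => (exist _ (tnth t j) (rt j), N j, exist _ (c j) (cC j)), M).
have := HK i _ se; rewrite /= Jn; apply: fails_leW => [|x].
  by rewrite exprMn sqr_sqrtr ?(ltW JR)// invfM mulrA mulrAC.
rewrite normrM gtr0_norm ?invr_gt0// -ltr_pdivlMl ?invr_gt0// invrK mulrA -expr2 sqr_sqrtr ?(ltW JR)//.
by move=> H; rewrite normrM gtr0_norm ?invr_gt0// ltr_pdivrMl.
Qed.

Lemma bscores_fail J (q : R) : 0 < q -> exists2 Lam : R, 0 < Lam &
  forall (t : J.-tuple Theta) (N : 'I_J -> nat) M, (forall j, regular (tnth t j)) ->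
  fails_le (prod_prob (fun j => iid M (G (tnth t j)))) q
    (fun x => forall j k, (size (take (N j) (tnth x j)))%:R *
       emp (take (N j) (tnth x j)) (bscore k (tnth t j)) ^+ 2 <= Lam).
Proof.
move=> q0.
have /choice [K HK] := fun k => ubm_fails (ubm_emp (ubm_bscore k)).
pose S : R := J%:R * \sum_k K k; have S0 : 0 <= S.
  by rewrite mulr_ge0// sumr_ge0// => k _; exact: (HK k).1.
pose e : R := Num.sqrt ((S + 1) / q).
have L0 : 0 < (S + 1) / q by rewrite divr_gt0// ltr_wpDl.
have e0 : 0 < e by rewrite sqrtr_gt0.
exists (e ^+ 2); first by rewrite exprn_gt0.
move=> t N M rt.
have F j := fails_le_forall (fun k => (HK k).2 (tnth t j, N j, M) e e0).
have := fails_le_forall (fun j => @fails_le_tnth _ _ _ J (fun j => iid M (G (tnth t j))) j _ _ (F j)).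
apply: fails_leW => [|x H j k].
  rewrite -mulr_suml sumr_const card_ord -[_ *+ J]mulr_natl mulrA -/S.
  by rewrite ler_pdivrMr ?exprn_gt0// /e sqr_sqrtr ?ltW// [q * _]mulrC divfK ?gt_eqF//; lra.
have := H j k; rewrite /= EX_bscore// subr0 => /ltW.
rewrite -(@ler_pXn2r _ 2)// ?nnegrE ?(ltW e0)//.
by rewrite real_normK ?num_real// exprMn sqr_sqrtr.
Qed.

Lemma risk_quad_bound t s P (e Lam : R) : regular t -> P \in risk_optimal ->
  posdefmx (mom_xx (emp s)) ->
  (forall P i j, `|subinv (mom_xx (emp s)) P i j - subinv (mom_xx (EX (G t))) P i j| <= e) ->
  (forall k, (size s)%:R * emp s (bscore k t) ^+ 2 <= Lam) ->
  - quad P t s - 2 * e * d%:R * (d%:R * Lam) <=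
    (size s)%:R * (risk (emp s) P - risk (emp s) best_model).
Proof.
move=> rt PM pQ He HL; have [/(_ P PM)[_ sE] _] := rt.
have sP : supported P (slope (EX (G t)) best_model) by rewrite -sE; exact: supported_slope.
have s0 := supported_slope (EX (G t)) best_model.
rewrite (risk_score (lfun_emp s) pQ sP) (risk_score (lfun_emp s) pQ s0).
rewrite /quad /subinvB qfBm; set g := score (emp s) _.
pose A := (subinv (mom_xx (emp s)) P - subinv (mom_xx (EX (G t))) P)
  - (subinv (mom_xx (emp s)) best_model - subinv (mom_xx (EX (G t))) best_model).
have AB i j : `|A i j| <= 2 * e.
  have E (A' B' : 'M[R]_d) : (A' - B') i j = A' i j - B' i j by rewrite mxE [X in _ + X]mxE.
  by rewrite /A !E mulr2n mulrDl mul1r (le_trans (ler_normB _ _))// lerD.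
have Ag : (size s)%:R * qf A g g <= 2 * e * d%:R * (d%:R * Lam).
  apply: (@le_trans _ _ ((size s)%:R * (2 * e * d%:R * \sum_k g k ord0 ^+ 2))).
    by rewrite ler_wpM2l// qf_bound.
  have [d0|d0] := posnP d.
    by rewrite [X in _ * (_ * X%:R * _)]d0 [X in _ <= _ * X%:R * _]d0 !(mulr0, mul0r).
  have e0 : 0 <= 2 * e by exact: le_trans (AB (Ordinal d0) (Ordinal d0)).
  rewrite [leLHS]mulrCA; apply: ler_wpM2l; [by rewrite mulr_ge0|rewrite mulr_sumr].
  apply: (@le_trans _ _ (\sum_(k < d) Lam)); last by rewrite sumr_const card_ord -[X in X <= _]mulr_natl.
  by apply: ler_sum => k _; rewrite [g k ord0]mxE; exact: HL.
move: Ag; rewrite /A !qfBm; move: (qf _ _ _) (qf _ _ _) (qf _ _ _) (qf _ _ _) (emp s _) => q1 q2 q3 q4 q5; lra.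
Qed.

Lemma criterion_gap J n (t : J.-tuple Theta) (D : 'I_J -> seq (obs R d)) (g C e Lam B : R) P :
  (0 < J)%N -> (0 < n)%N -> (forall j, (0 < size (D j))%N) -> 0 <= C ->
  (forall j, n%:R / (size (D j))%:R <= C) -> separated_by g t -> P != best_model ->
  (forall j P, [/\ subgram (mom_xx (emp (D j))) P \in unitmx,
     `|risk (emp (D j)) P - risk (EX (G (tnth t j))) P| <= e,
     `|penalty (emp (D j)) P - penalty (EX (G (tnth t j))) P| <= e &
     forall i k, `|subinv (mom_xx (emp (D j))) P i k - subinv (mom_xx (EX (G (tnth t j)))) P i k| <= e]) ->
  (forall j k, (size (D j))%:R * emp (D j) (bscore k (tnth t j)) ^+ 2 <= Lam) ->
  (forall t P, `|penalty (EX (G t)) P| <= B) ->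
  (P \in risk_optimal -> `|J%:R^-1 * \sum_(j < J) n%:R / (size (D j))%:R *
     (quad P (tnth t j) (D j) - (penalty (EX (G (tnth t j))) P -
        penalty (EX (G (tnth t j))) best_model))| < g / 8) ->
  2 * e + 2 * (B + e) * (n%:R^-1 + n%:R^-1 * C) < g ->
  2 * e * (1 + C) + C * (2 * e * d%:R * (d%:R * Lam)) <= g / 2 -> 0 < g -> 0 <= Lam ->
  criterion n D best_model < criterion n D P.
Proof.
move=> J0 n0 s0 C0 nC [reg sep] PP0 cons HL HB Hq small1 small2 g0 Lam0.
have nR : (0 : R) < n%:R by rewrite ltr0n.
have U P' j : subgram (mom_xx (emp (D j))) P' \in unitmx by have [] := cons j P'.
have c0 j : 0 <= n%:R / (size (D j))%:R :> R by rewrite divr_ge0.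
rewrite !criterionE// -subr_gt0 -mulrBr -sumrB.
have := sep P PP0; rewrite /gap.
case: (boolP (P \in risk_optimal)) => [PM|PM] sepP.
- rewrite -(pmulr_rgt0 _ nR) mulrCA mulr_sumr.
  have := Hq PM; rewrite ltr_norml => /andP[_] {}Hq.
  set S1 := J%:R^-1 * _ in Hq; set S2 := J%:R^-1 * _ in sepP.
  have Sd : S2 - S1 = J%:R^-1 * \sum_(j < J)
    ((penalty (EX (G (tnth t j))) P - penalty (EX (G (tnth t j))) best_model) -
     n%:R / (size (D j))%:R * (quad P (tnth t j) (D j) - (penalty (EX (G (tnth t j))) P -
        penalty (EX (G (tnth t j))) best_model))).
    by rewrite sumrB mulrBr.
  apply: (@lt_le_trans _ _ (S2 - S1 - g / 2)); first lra.
  rewrite Sd; apply: average_ge => // j.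
  have pQ : posdefmx (mom_xx (emp (D j))).
    by apply: posdef_setT; [exact: (mom_xx_psd (lfun_emp (D j)))|exact: U].
  have := risk_quad_bound (reg j) PM pQ (fun P => let: And4 _ _ _ h := cons j P in h) (HL j).
  have [_ _ h1 _] := cons j P; have [_ _ h2 _] := cons j best_model.
  have sR : (0 : R) < (size (D j))%:R by rewrite ltr0n.
  have := nC j; have := c0 j.
  have -> : n%:R * (risk (emp (D j)) P + penalty (emp (D j)) P * (n%:R^-1 + (size (D j))%:R^-1) -
    (risk (emp (D j)) best_model + penalty (emp (D j)) best_model * (n%:R^-1 + (size (D j))%:R^-1)))
    = n%:R / (size (D j))%:R * ((size (D j))%:R * (risk (emp (D j)) P - risk (emp (D j)) best_model))
     + (penalty (emp (D j)) P - penalty (emp (D j)) best_model) * (1 + n%:R / (size (D j))%:R).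
    by field; rewrite !gt_eqF.
  move=> c0j cCj Hr; have E0 : 0 <= 2 * e * d%:R * (d%:R * Lam).
    by rewrite !mulr_ge0// (le_trans (normr_ge0 _) h1).
  have cb := introT andP (conj c0j cCj).
  by apply: (le_trans _ (nested_gap_le cb E0 Hr h1 h2)); rewrite lerD2l lerN2.
- apply: (@lt_le_trans _ _ (g - (2 * e + 2 * (B + e) * (n%:R^-1 + n%:R^-1 * C)))); first by rewrite subr_gt0.
  apply: (le_trans (lerB sepP (lexx _))); apply: average_ge => // j.
  have [_ h1 h2 _] := cons j P; have [_ h3 h4 _] := cons j best_model.
  have v0 : 0 <= (size (D j))%:R^-1 :> R by rewrite invr_ge0.
  have vC : (size (D j))%:R^-1 <= n%:R^-1 * C :> R.
    have : n%:R^-1 * (n%:R / (size (D j))%:R) <= n%:R^-1 * C by rewrite ler_wpM2l ?invr_ge0.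
    by rewrite mulKf ?gt_eqF.
  have u0 : 0 <= n%:R^-1 :> R by rewrite invr_ge0.
  exact: (separated_gap_le u0 (introT andP (conj v0 vC)) h1 h3 h2 h4 (HB _ _) (HB _ _)).
Qed.

(* The summands are independent and centered with variances bounded uniformly in
   the sample sizes, which is why [K / J] does not depend on them. *)
Lemma nested_gap_fails (C e : R) : 0 <= C -> 0 < e -> exists2 K : R, 0 <= K &
  forall J : nat, (0 < J)%N -> forall (t : J.-tuple Theta) (N : 'rV[nat]_J) n,
  (forall j, regular (tnth t j)) -> (forall j, (0 < N ord0 j)%N) ->
  (forall j, n%:R / (N ord0 j)%:R <= C) ->
  fails_le (prod_prob (fun j => iid (\max_(k < J) N ord0 k)%N (G (tnth t j)))) (K / J%:R)
   (fun x => forall P, P \in risk_optimal -> `|J%:R^-1 * \sum_(j < J)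
     n%:R / (size (take (N ord0 j) (tnth x j)))%:R *
     (quad P (tnth t j) (take (N ord0 j) (tnth x j)) - (penalty (EX (G (tnth t j))) P -
        penalty (EX (G (tnth t j))) best_model))| < e).
Proof.
move=> C0 e0.
have /choice [K HK] := fun P => quad_average_fails P C0 e0.
exists (\sum_P K P); first by apply: sumr_ge0 => P _; exact: (HK P).1.
move=> J J0 t N n rt N0 nC; rewrite mulr_suml.
have cC j : `|n%:R / (N ord0 j)%:R| <= C by rewrite ger0_norm ?divr_ge0.
have := fails_le_forall (fun P => (HK P).2 J J0 t (fun j => N ord0 j)
  (\max_(k < J) N ord0 k)%N (fun j => n%:R / (N ord0 j)%:R) rt cC).
apply: fails_leW => // x H P PM; apply: le_lt_trans (H P).
rewrite le_eqVlt; apply/orP; left; apply/eqP; congr `|_ * _|; apply: eq_bigr => j _.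
have NM : (N ord0 j <= \max_(k < J) N ord0 k)%N by rewrite (leq_bigmax j).
rewrite size_takel ?size_tuple//; congr (_ * (_ - _)).
by rewrite EX_quad// N0.
Qed.

Lemma selection_growing_n (C g : R) : 0 <= C -> 0 < g -> exists2 K : R, 0 <= K &
  forall J : nat, (0 < J)%N -> forall q : R, 0 < q -> exists M0 : nat,
  forall n (N : 'rV[nat]_J), (M0 <= n)%N -> (forall j, (M0 <= N ord0 j)%N) ->
  (forall j, n%:R / (N ord0 j)%:R <= C) -> forall t : J.-tuple Theta, separated_by g t ->
  fails_le (prod_prob (fun j => iid (\max_(k < J) N ord0 k)%N (G (tnth t j)))) (K / J%:R + q)
    (fun x => pihat n (fun j => take (N ord0 j) (tnth x j)) = [set best_model]%SET).
Proof.
move=> C0 g0; have g8 : 0 < g / 8 by rewrite divr_gt0.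
have [B B0 HB] := penalty_bound.
have [K K0 HK] := nested_gap_fails C0 g8; exists K => // J J0 q q0.
have q2 : 0 < q / 2 by rewrite divr_gt0.
have [Lam Lam0 HLam] := bscores_fail J q2.
pose A : R := 1 + C + C * (d%:R * (d%:R * Lam)).
have A1 : 1 <= A by rewrite /A -addrA lerDl addr_ge0// !mulr_ge0// ltW.
have A0 : 0 < A by exact: lt_le_trans A1.
pose e : R := Num.min 1 (g / (16 * A)).
have e0 : 0 < e by rewrite lt_min ltr01 divr_gt0// mulr_gt0.
have e1 : e <= 1 by rewrite ge_min lexx.
have eA : 16 * (e * A) <= g.
  have : e <= g / (16 * A) by rewrite ge_min lexx orbT.
  by rewrite ler_pdivlMr ?mulr_gt0// mulrCA.
have eA' : e <= e * A by rewrite ler_peMr// ltW.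
have [r r0 Hr] := uniform_consistency e0.
have [M1 M10 HM1] := @close_data_fails J r (q / 2) r0 q2.
pose X : R := 8 * ((B + 1) * (1 + C)) / g.
have X0 : 0 <= X by rewrite divr_ge0 ?(ltW g0)// !mulr_ge0// addr_ge0.
exists (maxn M1 (Num.bound X)) => n N nM NM nC t sep; have [reg _] := sep.
have n0 : (0 < n)%N by rewrite (leq_trans M10)// (leq_trans _ nM) ?leq_maxl.
have nR : (0 : R) < n%:R by rewrite ltr0n.
have NM1 j : (M1 <= N ord0 j)%N by rewrite (leq_trans _ (NM j)) ?leq_maxl.
have N0 j : (0 < N ord0 j)%N by exact: leq_trans (NM1 j).
have nX : 8 * ((B + 1) * (1 + C)) * n%:R^-1 <= g.
  have : X <= n%:R.
    by rewrite (le_trans (ltW (archi_boundP X0)))// ler_nat (leq_trans _ nM) ?leq_maxr.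
  by rewrite ler_pdivrMr// [n%:R * _]mulrC -ler_pdivrMr.
have F1 := HK J J0 t N n reg N0 nC.
have F2 := HM1 N NM1 t.
have F3 := HLam t (fun j => N ord0 j) (\max_(k < J) N ord0 k)%N reg.
apply: fails_leW (fails_le_and F1 (fails_le_and F2 F3)) => [|x [h1 [h2 h3]]].
  by rewrite [X in _ + X <= _](_ : _ = q)//; field.
have sz j : size (take (N ord0 j) (tnth x j)) = N ord0 j.
  by rewrite size_takel// size_tuple (leq_bigmax j).
have lt P : P != best_model ->
    criterion n (fun j => take (N ord0 j) (tnth x j)) best_model <
    criterion n (fun j => take (N ord0 j) (tnth x j)) P.
  move=> PP0; have szn j : n%:R / (size (take (N ord0 j) (tnth x j)))%:R <= C by rewrite sz.
  have sz0 j : (0 < size (take (N ord0 j) (tnth x j)))%N by rewrite sz.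
  apply: (criterion_gap J0 n0 sz0 C0 szn sep PP0 (fun j => Hr _ _ (h2 j)) h3 HB (h1 P) _ _ g0 (ltW Lam0)).
    have u0 : 0 < n%:R^-1 :> R by rewrite invr_gt0.
    have C1 : 0 <= (1 + C) * n%:R^-1 by rewrite mulr_ge0 ?(ltW u0)// addr_ge0.
    have H := ler_wpM2r C1 e1.
    lra.
  rewrite (_ : _ + _ = 2 * (e * A)); last by rewrite /A; ring.
  lra.
apply/setP => P; rewrite !inE; apply/forallP/eqP => [H|-> P'].
  by apply/eqP/negPn/negP => /lt; rewrite ltNge H.
by have [->|/lt/ltW] := eqVneq P' best_model.
Qed.

Lemma liminf_growing_n (C : R) : exists2 K : R, 0 <= K & forall J : nat, (0 < J)%N ->
  ((1 - K / J%:R)%:E <= limf_einf (fun x : nat * 'rV[nat]_J =>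
     data_prob mu G x.2 [set D | pihat x.1 D = Pstar_pop mu G x.1]) (n_sizes_oo J C))%E.
Proof.
have [g g0 [K1 K10 HK1]] := separated_fails.
have C0 : 0 <= `|C| by [].
have [K2 K20 HK2] := selection_growing_n C0 g0.
have [n1 Hn1] := Pstar_pop_eventually.
exists (K1 + K2); first by rewrite addr_ge0.
move=> J J0; apply: limf_einf_ge => e e0.
have [M0 HM0] := HK2 J J0 e e0.
exists [set x : nat * 'rV[nat]_J | [/\ forall j, x.1%:R / (x.2 ord0 j)%:R <= C,
    (maxn n1 M0 <= x.1)%N & forall j, (M0 <= x.2 ord0 j)%N]].
  exists ([set n | (maxn n1 M0 <= n)%N], [set N : 'rV[nat]_J | forall j, (M0 <= N ord0 j)%N]).
    by split=> /=; [exists (maxn n1 M0)|exists M0].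
  by move=> [n N] /= [h1 h2] nC; split.
move=> [n N] [/= nC nM NM].
have nn1 : (n1 <= n)%N by rewrite (leq_trans _ nM) ?leq_maxl.
have nM0 : (M0 <= n)%N by rewrite (leq_trans _ nM) ?leq_maxr.
have nC' j : n%:R / (N ord0 j)%:R <= `|C| by rewrite (le_trans (nC j))// ler_norm.
have KJ K : 0 <= K -> 0 <= K / J%:R :> R by move=> K0; rewrite divr_ge0.
have q0 : 0 <= K2 / J%:R + e by rewrite addr_ge0 ?KJ// ltW.
have := data_prob_ge (N := N) (E := [set D | pihat n D = Pstar_pop mu G n]) (KJ _ K10) q0 (HK1 J J0).
rewrite (_ : 1 - (K1 / J%:R + (K2 / J%:R + e)) = 1 - (K1 + K2) / J%:R - e); last by rewrite mulrDl; lra.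
apply=> t sep /=; rewrite Hn1//.
exact: HM0.
Qed.

End environments.

Unset Implicit Arguments.

Theorem proposition3p6 (R : realType) (d : nat)
    (dT : measure_display) (Theta : measurableType dT)
    (mu : probability Theta R) (G : Theta -> probability (obs R d) R)
    (G_measurable : forall A, measurable A -> measurable_fun setT (fun t => G t A))
    (Q_invertible : forall t P, Qmx (G t) P \in unitmx)
    (W_posdef : forall t P, posdefmx (Wmx (G t) P))
    (gram_invertible : forall t P (n : nat), (d < n)%N ->
      {ae iid n (G t), forall s : n.-tuple (obs R d), gram P s \in unitmx})
    (moments_bounded : forall k : nat, exists B : R, forall t,
      (forall i, (\int[G t]_z (`|tnth z.1 i| ^+ k)%:E <= B%:E)%E) /\
      (\int[G t]_z (`|z.2| ^+ k)%:E <= B%:E)%E)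
    (inverse_third_moments_bounded : forall P, exists (n0 : nat) (B : R),
      forall n : nat, (n0 <= n)%N -> forall t i j,
      (\int[iid n (G t)]_s (`|invmx (n%:R^-1 *: gram P s) i j| ^+ 3)%:E
        <= B%:E)%E) :
  exists K : R -> R, forall C : R,
    (forall t P, [/\ lambda_max (Wmx (G t) P) <= C,
                     (lambda_min (Wmx (G t) P))^-1 <= C
                   & lambda_max (Qmx (G t) P) <= C]) ->
    forall J : nat, (0 < J)%N ->
    (forall n : nat, (0 < n)%N ->
      ((1 - K C / J%:R)%:E <=
        limf_einf (fun N : 'rV[nat]_J =>
          data_prob mu G N [set D | pihat n D \subset pistar_pop mu G n])
        (sizes_oo J))%E) /\
    ((1 - K C / J%:R)%:E <=
      limf_einf (fun x : nat * 'rV[nat]_J =>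
        data_prob mu G x.2 [set D | pihat x.1 D = Pstar_pop mu G x.1])
      (n_sizes_oo J C))%E.
Proof.
have [K1 K10 HK1] := liminf_all_n G_measurable Q_invertible gram_invertible
  moments_bounded inverse_third_moments_bounded mu W_posdef.
have /choice [K2 HK2] : forall C : R, exists K : R, 0 <= K /\ forall J : nat, (0 < J)%N ->
    ((1 - K / J%:R)%:E <= limf_einf (fun x : nat * 'rV[nat]_J =>
     data_prob mu G x.2 [set D | pihat x.1 D = Pstar_pop mu G x.1]) (n_sizes_oo J C))%E.
  move=> C; have [K K0 HK] := liminf_growing_n G_measurable Q_invertible gram_invertible
    moments_bounded inverse_third_moments_bounded mu W_posdef C.
  by exists K.
exists (fun C => K1 + K2 C) => C _ J J0; have JR : (0 : R) < J%:R by rewrite ltr0n.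
have [K20 HC] := HK2 C; split=> [n n0|].
  apply: le_trans (HK1 n n0 J J0).
  by rewrite lee_fin lerD2l lerN2 ler_pM2r ?invr_gt0// lerDl.
apply: le_trans (HC J J0).
by rewrite lee_fin lerD2l lerN2 ler_pM2r ?invr_gt0// lerDr.
Qed.
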